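(* Suppose the noise is super smooth with parameters $\nu_0,\nu_1,d_0,d_1,\delta,\beta$ (Assumption 2 of the context). Let $s>0$, $R>0$, $\psi_N=(\log N)^{-2s/\beta}$ and $K_0>0$. Consider $L^*=\left\lfloor\left(\delta\log(N)/8\right)^{1/\beta}\right\rfloor$ and the test statistic $$D_N=\mathbf{1}_{\{|T_{L^*}|/t_{L^*}^2>K_0\}},\qquad t_L^2=L^{-2\nu_0+1}\exp(2L^\beta/\delta)/N,$$ where $T_L$ is defined in the context. Then, if $\mathcal{C}>K_0+((4\pi)^{-1}+R^2)(\delta/16)^{-2s/\beta}$, $$\lim_{N\to\infty}\left\{\mathbb{P}_{f_0}(D_N=1)+\sup_{f\in H_1(s,R,\mathcal{C}\psi_N)}\mathbb{P}_f(D_N=0)\right\}=0.$$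
   Context: Model. $\mathbb{S}^2$ is the unit sphere of $\mathbb{R}^3$ with its surface (Lebesgue) measure $dx$ of total mass $4\pi$; $\|\cdot\|_2$ is the norm of $\mathbb{L}_2(\mathbb{S}^2)$. One observes $Z_i=\varepsilon_iX_i$, $i=1,\dots,N$, where the $\varepsilon_i$ are i.i.d. random rotations in $SO(3)$ with known density $f_\varepsilon$ with respect to the probability Haar measure, the $X_i$ are i.i.d. random variables on $\mathbb{S}^2$ with unknown density $f$ with respect to $dx$, and the $X_i$ are independent of the $\varepsilon_i$. The density of $Z_i$ is $f_Z=f_\varepsilon*f$, where $f_\varepsilon*f(\omega)=\int_{SO(3)}f_\varepsilon(u)f(u^{-1}\omega)\,du$. $\mathbb{P}_f$ denotes the probability when the $X_i$ have density $f$. The uniform density is $f_0=(4\pi)^{-1}\mathbf{1}_{\mathbb{S}^2}$. Fourier analysis. $(Y^l_m)_{l\ge0,\,-l\le m\le l}$ is the usual complex orthonormal basis of spherical harmonics of $\mathbb{L}_2(\mathbb{S}^2)$. For $f\in\mathbb{L}_2(\mathbb{S}^2)$, $f^{\star l}_m=\int_{\mathbb{S}^2}f(x)\overline{Y^l_m(x)}\,dx$. The rotational harmonics $D^l_{mn}$ on $SO(3)$ ($-l\le m,n\le l$) are the matrix coefficients with $\overline{Y^l_m(gx)}=\sum_{n=-l}^l D^l_{mn}(g)\overline{Y^l_n(x)}$. The rotational Fourier transform of $f_\varepsilon$ at order $l$ is the $(2l+1)\times(2l+1)$ matrix $f_\varepsilon^{\star l}$ with entries $(f_\varepsilon^{\star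 l})_{mn}=\int_{SO(3)}f_\varepsilon(g)D^l_{mn}(g)\,dg$, so that $(f_\varepsilon*f)^{\star l}=f_\varepsilon^{\star l}f^{\star l}$. $\|\cdot\|_{op}$ is the operator norm associated with the Euclidean norm. Assumption 2 (super smooth noise). For all $l\ge0$ the matrix $f_\varepsilon^{\star l}$ is invertible, with inverse denoted $f^{\star l}_{\varepsilon^{-1}}$, and there exist reals $\nu_1\le\nu_0$ and positive constants $d_0,d_1,\delta,\beta$ such that for all $l\ge1$: $\|f^{\star l}_{\varepsilon^{-1}}\|_{op}\le d_0^{-1}l^{-\nu_0}\exp(l^\beta/\delta)$ and $\|f^{\star l}_{\varepsilon}\|_{op}\le d_1l^{\nu_1}\exp(-l^\beta/\delta)$. Sobolev classes and alternatives. $\|f\|_{W_s}^2=\sum_{l\ge0}\sum_{m=-l}^l(1+l(l+1))^s|f^{\star l}_m|^2$; $W_s(\mathbb{S}^2)$ is the completion of $C^\infty(\mathbb{S}^2)$ for this norm; for $R>0$, $W_s(\mathbb{S}^2,R)$ is the set of probability densities $f\in W_s(\mathbb{S}^2)$ with $\|f\|_{W_s}^2\le\frac1{4\pi}+R^2$. $H_1(s,R,\rho)$ is the set of $f\in W_s(\mathbb{S}^2,R)$ with $\|f-f_0\|_2^2\ge\rho$. Test statistic. $\Phi_{lm}(x)=\sum_{n=-l}^l(f^{\star l}_{\varepsilon^{-1}})_{mn}\overline{Y^l_n(x)}$ and $$T_L=\sum_{l=1}^L\sum_{m=-l}^l\frac{2}{N(N-1)}\sum_{1\le i_1<i_2\le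 N}\Phi_{lm}(Z_{i_1})\overline{\Phi_{lm}(Z_{i_2})}.$$ $\lfloor x\rfloor$ is the largest integer $\le x$. *)

(* Defs.v *)
From HB Require Import structures.
From mathcomp Require Import all_boot all_order all_algebra.
From mathcomp Require Import all_classical all_reals all_analysis.
From mathcomp Require Import measurable_realfun complex.

Set Implicit Arguments.
Unset Strict Implicit.
Unset Printing Implicit Defensive.

Import Order.TTheory GRing.Theory Num.Theory.
Import numFieldNormedType.Exports.
Import ComplexField.

Local Open Scope classical_set_scope.
Local Open Scope ring_scope.

Section sphere.
Variable R : realType.

Record sphere := Sphere {
  sphere_val :> 'cV[R]_3 ;
  sphereP : \sum_i sphere_val i 0 ^+ 2 == 1 }.

HB.instance Definition _ := [isSub for sphere_val].
HB.instance Definition _ := [Choice of sphere by <:].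

Fact sph_point_subproof (a : R * R) :
  \sum_i (\col_(j < 3) [:: sin a.1 * cos a.2; sin a.1 * sin a.2; cos a.1]`_j
            : 'cV[R]_3) i 0 ^+ 2 == 1.
Proof.
apply/eqP; rewrite !big_ord_recr big_ord0/= !mxE/= add0r !exprMn -mulrDr.
by rewrite cos2Dsin2 mulr1 addrC cos2Dsin2.
Qed.

(* The point with colatitude a.1 and longitude a.2. *)
Definition sph_point (a : R * R) : sphere := Sphere (sph_point_subproof a).

HB.instance Definition _ := isPointed.Build sphere (sph_point (0, 0)).

(* The Borel sigma-algebra, generated by the three coordinates. *)
Definition sphere_measurable : set (set sphere) :=
  <<s [set A | exists i : 'I_3,
        preimage_set_system setT (fun x : sphere => x i 0) measurable A] >>.

Let sphere_measurable0 : sphere_measurable set0.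
Proof. exact: sigma_algebra0. Qed.
Let sphere_measurableC A : sphere_measurable A -> sphere_measurable (~` A).
Proof. exact: sigma_algebraC. Qed.
Let sphere_measurable_bigcup (F : (set sphere)^nat) :
  (forall i, sphere_measurable (F i)) -> sphere_measurable (\bigcup_i F i).
Proof. exact: sigma_algebra_bigcup. Qed.

HB.instance Definition _ := @isMeasurable.Build default_measure_display sphere
  sphere_measurable sphere_measurable0 sphere_measurableC
  sphere_measurable_bigcup.

Lemma measurable_sph_point :
  measurable_fun [set: measurableTypeR R * measurableTypeR R] sph_point.
Proof.
apply: (@measurability _ _ _ _ _ _
  [set A | exists i : 'I_3,
        preimage_set_system setT (fun x : sphere => x i 0) measurable A]) => //.
move=> _ [_ [i [B mB <-]] <-]; rewrite setTI setTI -comp_preimage.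
rewrite -[X in measurable X]setTI; suff : measurable_fun
  [set: measurableTypeR R * measurableTypeR R] (fun a => sph_point a i 0) by exact.
have ms : measurable_fun [set: measurableTypeR R] (@sin R).
  by apply: continuous_measurable_fun; exact: continuous_sin.
have mc : measurable_fun [set: measurableTypeR R] (@cos R).
  by apply: continuous_measurable_fun; exact: continuous_cos.
have ms1 := measurableT_comp ms (@measurable_fst _ _ (measurableTypeR R) (measurableTypeR R)).
have mc1 := measurableT_comp mc (@measurable_fst _ _ (measurableTypeR R) (measurableTypeR R)).
have ms2 := measurableT_comp ms (@measurable_snd _ _ (measurableTypeR R) (measurableTypeR R)).
have mc2 := measurableT_comp mc (@measurable_snd _ _ (measurableTypeR R) (measurableTypeR R)).
under eq_fun do rewrite /= mxE.
by case: i => [[|[|[|//]]]] _ /=; [exact: measurable_funM|exact: measurable_funM|].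
Qed.

Definition angles : set (R * R) := `[0, pi] `*` `[0, 2 * pi].

(* The measure sin(theta) dtheta dphi in spherical coordinates. *)
Definition surface_measure (A : set sphere) : \bar R :=
  (\int[lebesgue_measure \x lebesgue_measure]_(a in
      sph_point @^-1` A `&` angles) (sin a.1)%:E)%E.

Let sin_dom_ge0 (A : set (R * R)) (a : R * R) :
  (A `&` angles) a -> (0 <= (sin a.1)%:E)%E.
Proof. by move=> [_ [/=]]; rewrite in_itv/= => ? _; rewrite lee_fin sin_ge0_pi. Qed.

Let surface_measure0 : surface_measure set0 = 0%E.
Proof. by rewrite /surface_measure preimage_set0 set0I integral_set0. Qed.

Let surface_measure_ge0 A : (0 <= surface_measure A)%E.
Proof. by apply: integral_ge0 => a; exact: sin_dom_ge0. Qed.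

Let surface_measure_sigma_additive : semi_sigma_additive surface_measure.
Proof.
move=> F mF tF mUF; rewrite /surface_measure preimage_bigcup setI_bigcupl.
rewrite ge0_integral_bigcup//.
- by apply: is_cvg_ereal_nneg_natsum_cond => n _ _; exact: surface_measure_ge0.
- move=> n; apply: measurableI; last exact: measurableX.
  by rewrite -[X in measurable X]setTI; exact: measurable_sph_point.
- apply: measurable_funTS; apply/measurable_EFinP.
  apply: (@measurableT_comp _ _ _ _ _ _ (@sin R)).
    by apply: continuous_measurable_fun; exact: continuous_sin.
  exact: measurable_fst.
- by move=> a [n _]; exact: sin_dom_ge0.
- apply/trivIsetP => i j _ _ ij; rewrite setIACA setIid -preimage_setI.
  by move/trivIsetP : tF => ->//; rewrite preimage_set0 set0I.
Qed.

HB.instance Definition _ := isMeasure.Build _ _ _ surface_measure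
  surface_measure0 surface_measure_ge0 surface_measure_sigma_additive.

End sphere.

Section rotations.
Variable R : realType.

Record SO3 := Rotation {
  rot_val :> 'M[R]_3 ;
  rotP : (rot_val^T *m rot_val == 1%:M) && (\det rot_val == 1) }.

HB.instance Definition _ := [isSub for rot_val].
HB.instance Definition _ := [Choice of SO3 by <:].

Fact rot1_subproof :
  ((1%:M : 'M[R]_3)^T *m 1%:M == 1%:M) && (\det (1%:M : 'M[R]_3) == 1).
Proof. by rewrite trmx1 mulmx1 det1 !eqxx. Qed.

Definition rot1 : SO3 := Rotation rot1_subproof.

HB.instance Definition _ := isPointed.Build SO3 rot1.

Fact rot_mul_subproof (g h : SO3) :
  ((g *m h)^T *m (g *m h) == 1%:M) && (\det (g *m h) == 1).
Proof.
have /andP[/eqP gg /eqP dg] := rotP g; have /andP[/eqP hh /eqP dh] := rotP h.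
by rewrite trmx_mul mulmxA -(mulmxA h^T) gg mulmx1 hh det_mulmx dg dh mulr1 !eqxx.
Qed.

Definition rot_mul (g h : SO3) : SO3 := Rotation (rot_mul_subproof g h).

Fact rot_act_subproof (g : SO3) (x : sphere R) :
  \sum_i (g *m x) i 0 ^+ 2 == 1.
Proof.
have sqE (v : 'cV[R]_3) : \sum_i v i 0 ^+ 2 = (v^T *m v) 0 0.
  by rewrite mxE; apply: eq_bigr => i _; rewrite mxE expr2.
have /andP[/eqP gg _] := rotP g.
by rewrite sqE trmx_mul mulmxA -(mulmxA _ g^T) gg mulmx1 -sqE; exact: sphereP.
Qed.

Definition rot_act (g : SO3) (x : sphere R) : sphere R :=
  Sphere (rot_act_subproof g x).

(* The Borel sigma-algebra, generated by the nine entries. *)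
Definition rot_measurable : set (set SO3) :=
  <<s [set A | exists i j : 'I_3,
        preimage_set_system setT (fun g : SO3 => g i j) measurable A] >>.

Let rot_measurable0 : rot_measurable set0.
Proof. exact: sigma_algebra0. Qed.
Let rot_measurableC A : rot_measurable A -> rot_measurable (~` A).
Proof. exact: sigma_algebraC. Qed.
Let rot_measurable_bigcup (F : (set SO3)^nat) :
  (forall i, rot_measurable (F i)) -> rot_measurable (\bigcup_i F i).
Proof. exact: sigma_algebra_bigcup. Qed.

HB.instance Definition _ := @isMeasurable.Build default_measure_display SO3
  rot_measurable rot_measurable0 rot_measurableC rot_measurable_bigcup.

Definition is_haar (mu : probability SO3 R) : Prop :=
  forall (g : SO3) (A : set SO3), measurable A ->
    mu (rot_mul g @^-1` A) = mu A.

End rotations.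

Section densities.
Context d (T : measurableType d) (R : realType).

Definition is_density (mu : {measure set T -> \bar R}) (f : T -> R) : Prop :=
  [/\ measurable_fun setT f, forall x, 0 <= f x
    & (\int[mu]_x (f x)%:E = 1)%E].

Definition cintegral (mu : {measure set T -> \bar R}) (f : T -> R[i]) : R[i] :=
  Complex (\int[mu]_x complex.Re (f x)) (\int[mu]_x complex.Im (f x)).

End densities.

Section harmonics.
Variable R : realType.
Local Open Scope complex_scope.

Definition uniform_density (x : sphere R) : R := (4 * pi)^-1.

(* Rodrigues' formula. *)
Definition legendre (l : nat) : {poly R} :=
  (2 ^+ l * l`!%:R)^-1 *: (('X^2 - 1) ^+ l)^`(l).

(* With x = (sin t cos p, sin t sin p, cos t), the factor
   (x_1 + i x_2)^m (d/dz)^m P_l(x_3) is e^{imp} sin^m t (d/dz)^m P_l(cos t),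
   i.e. e^{imp} times the associated Legendre function of cos t; the
   Condon-Shortley phase (-1)^m is kept separate. *)
Definition sph_harm_nneg (l m : nat) (x : sphere R) : R[i] :=
  ((-1) ^+ m
    * Num.sqrt ((2 * l + 1)%:R / (4 * pi) * ((l - m)`!%:R / (l + m)`!%:R))
    * (legendre l)^`(m).[x (inord 2) 0])%:C
  * (x (inord 0) 0 +i* x (inord 1) 0) ^+ m.

Definition sph_harm (l : nat) (m : int) (x : sphere R) : R[i] :=
  match m with
  | Posz m => sph_harm_nneg l m x
  | Negz m => (-1) ^+ m.+1 * (sph_harm_nneg l m.+1 x)^*
  end.

(* Coordinates indexed by -l <= m <= l are stored in position m + l, so that
   position k : 'I_((2 * l).+1) is the harmonic of order k - l. *)
Definition Ylm (l : nat) (k : 'I_((2 * l).+1)) : sphere R -> R[i] :=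
  sph_harm l (k%:Z - l%:Z).

Definition sph_coef (f : sphere R -> R) (l : nat) : 'cV[R[i]]_((2 * l).+1) :=
  \col_k cintegral (@surface_measure R) (fun x => (f x)%:C * (Ylm k x)^*).

(* The functions Y^l_m being linearly independent, this determines D. *)
Definition is_rotational_harmonics
    (D : forall l, SO3 R -> 'M[R[i]]_((2 * l).+1)) : Prop :=
  forall l (m : 'I_((2 * l).+1)) (g : SO3 R) (x : sphere R),
    (Ylm m (rot_act g x))^* = \sum_n D l g m n * (Ylm n x)^*.

Definition rot_fourier (haar : probability (SO3 R) R)
    (D : forall l, SO3 R -> 'M[R[i]]_((2 * l).+1)) (feps : SO3 R -> R) (l : nat) :
    'M[R[i]]_((2 * l).+1) :=
  \matrix_(m, n) cintegral haar (fun g => (feps g)%:C * D l g m n).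

Definition norm2 n (v : 'cV[R[i]]_n) : R :=
  Num.sqrt (\sum_i Normc.normc (v i 0) ^+ 2).

Definition opnorm n (A : 'M[R[i]]_n) : R :=
  sup [set norm2 (A *m v) | v in [set v | norm2 v <= 1]].

Definition super_smooth (F : forall l, 'M[R[i]]_((2 * l).+1))
    (nu0 nu1 d0 d1 delta beta : R) : Prop :=
  [/\ nu1 <= nu0, [/\ 0 < d0, 0 < d1, 0 < delta & 0 < beta],
      forall l, F l \in unitmx
    & forall l : nat, (1 <= l)%N ->
        opnorm (invmx (F l))
          <= d0^-1 * l%:R `^ (- nu0) * expR (l%:R `^ beta / delta) /\
        opnorm (F l) <= d1 * l%:R `^ nu1 * expR (- (l%:R `^ beta / delta)) ].

End harmonics.

Section sobolev.
Variable R : realType.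

Fixpoint is_Ck (k : nat) (f : 'cV[R]_3 -> R) : Prop :=
  match k with
  | 0 => continuous f
  | k.+1 => forall v, (forall x, derivable f x v) /\ is_Ck k ('D_v f)
  end.

(* C^infinity functions on the sphere: restrictions of those on R^3. *)
Definition smooth_on_sphere (f : sphere R -> R) : Prop :=
  exists2 F : 'cV[R]_3 -> R, forall k, is_Ck k F & forall x, f x = F x.

Definition sobolev_norm2 (s : R) (f : sphere R -> R) : \bar R :=
  (\sum_(0 <= l <oo)
    ((1 + l%:R * (l%:R + 1)) `^ s
     * \sum_(k < (2 * l).+1) Normc.normc (sph_coef f l k 0%R) ^+ 2)%R%:E)%E.

(* The completion of the smooth functions for the Sobolev norm, realized
   inside L^2. As f is real, approximating by real smooth functions is enough:
   taking real parts does not increase the norm. *)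
Definition sobolev_space (s : R) : set (sphere R -> R) :=
  [set f | f \in Lfun (@surface_measure R) 2%:E /\
     forall e : R, 0 < e -> exists2 g, smooth_on_sphere g &
       (sobolev_norm2 s (fun x => f x - g x)%R <= e%:E)%E ].

Definition sobolev_ball (s r : R) : set (sphere R -> R) :=
  [set f | [/\ is_density (@surface_measure R) f, sobolev_space s f
     & (sobolev_norm2 s f <= ((4 * pi)^-1 + r ^+ 2)%:E)%E ] ].

Definition alternatives (s r rho : R) : set (sphere R -> R) :=
  [set f | sobolev_ball s r f /\
     (rho%:E <= Lnorm (@surface_measure R) 2%:E
                 (fun x => (f x - uniform_density x)%:E) ^+ 2)%E ].

End sobolev.

Section model.
Variable R : realType.
Local Open Scope complex_scope.

Section law.
Context d (Omega : measurableType d).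
Variables (eps : nat -> {mfun Omega >-> SO3 R})
  (X : nat -> {mfun Omega >-> sphere R}).

(* Under P the eps_i have density feps, the X_i have density f, and all the
   variables eps_0, X_0, eps_1, X_1, ... are mutually independent. *)
Definition noisy_model (haar : probability (SO3 R) R) (feps : SO3 R -> R)
    (f : sphere R -> R) (P : probability Omega R) : Prop :=
  [/\ forall i A, measurable A ->
        P (eps i @^-1` A) = (\int[haar]_(g in A) (feps g)%:E)%E,
      forall i B, measurable B ->
        P (X i @^-1` B) = (\int[@surface_measure R]_(x in B) (f x)%:E)%E
    & forall (n : nat) (A : nat -> set (SO3 R)) (B : nat -> set (sphere R)),
        (forall i, measurable (A i)) -> (forall i, measurable (B i)) ->
        P (\bigcap_(i < n) (eps i @^-1` A i `&` X i @^-1` B i)) =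
        (\prod_(i < n) (P (eps i @^-1` A i) * P (X i @^-1` B i)))%E ].

Definition observation (i : nat) (w : Omega) : sphere R :=
  rot_act (eps i w) (X i w).

End law.

Definition Phi (F : forall l, 'M[R[i]]_((2 * l).+1)) l (m : 'I_((2 * l).+1))
    (x : sphere R) : R[i] :=
  \sum_n invmx (F l) m n * (Ylm n x)^*.

Definition T_stat (F : forall l, 'M[R[i]]_((2 * l).+1)) (N : nat)
    (Z : nat -> sphere R) (L : nat) : R[i] :=
  \sum_(1 <= l < L.+1) \sum_(m < (2 * l).+1)
    2 / (N%:R * (N%:R - 1)) *
    \sum_(i2 < N) \sum_(i1 < i2) Phi F m (Z i1) * (Phi F m (Z i2))^*.

Definition t_sq (nu0 delta beta : R) (N L : nat) : R :=
  L%:R `^ (- 2 * nu0 + 1) * expR (2 * L%:R `^ beta / delta) / N%:R.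

(* truncn is the floor, its argument being nonnegative. *)
Definition L_star (delta beta : R) (N : nat) : nat :=
  Num.truncn ((delta * ln N%:R / 8) `^ beta^-1).

Definition psi (s beta : R) (N : nat) : R := ln N%:R `^ (- 2 * s / beta).

Definition test (F : forall l, 'M[R[i]]_((2 * l).+1)) (nu0 delta beta K0 : R)
    (N : nat) (Z : nat -> sphere R) : bool :=
  let L := L_star delta beta N in
  K0 < Normc.normc (T_stat F N Z L) / t_sq nu0 delta beta N L.

End model.

(* Main.v *)
Require Import Defs.
From HB Require Import structures.
From mathcomp Require Import all_boot all_order all_algebra.
From mathcomp Require Import all_classical all_reals all_analysis.
From mathcomp Require Import measurable_realfun complex.
From mathcomp Require Import zify ring lra.

Import Order.TTheory GRing.Theory Num.Theory.
Import numFieldNormedType.Exports.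

Local Open Scope classical_set_scope.
Local Open Scope ring_scope.

Set Implicit Arguments.
Unset Strict Implicit.
Unset Printing Implicit Defensive.

(** The statistic is a U-statistic. With [phi] running over the functions [Phi] of degrees 1 to L,
    T_L is the average over pairs i < j of [kern phi (Z i) (Z j)] ([T_statE]). A rotation acts on
    the harmonics of degree l through the matrix D^l, so averaging over the noise multiplies the
    coefficients of f by the Fourier matrix, and the inverse matrix in [Phi] undoes this
    ([mean_Phi]). Hence T_L is an unbiased estimator of b, the energy of f in degrees 1 to L, that
    is, the squared distance to the uniform density truncated at L. Both errors are then bounded by
    Chebyshev's inequality.

    Under the uniform density every phi_a has mean zero. The U-statistic is degenerate: different
    pairs are uncorrelated, and the variance is of order N^-2 times the sum of the squared
    covariances of the phi_a ([ustat_degenerate]). A rotated uniform point is uniform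
    ([mean_uniform]), so these covariances are Gram matrices of the inverse Fourier matrices, up to
    (4 pi)^-1. Their sum is at most a constant times the sum over l <= L of l^(1 - 4 nu0) exp(4
    l^beta / delta). On the other side, N^2 t_L^4 equals L^(2 - 4 nu0) exp(4 L^beta / delta), which
    is larger by an unbounded factor, because the exponential concentrates the sum on a vanishing
    fraction of the degrees, next to L ([weighted_sum_negligible]). So the first error vanishes for
    every K0 > 0.

    Under an alternative, Parseval and the Sobolev bound give C psi_N <= b + L^(-2s) ((4 pi)^-1 +
    R^2) ([alternatives_energy]). At L = L*, eventually L^(-2s) <= (delta/16)^(-2s/beta) psi_N, and
    exp(2 L^beta / delta) <= N^(1/4), so that t^2 is N^(-3/4) up to logarithms and falls below
    psi_N. Accepting then forces |T - b| >= k psi_N, where k > 0 is the gap in the assumption on C.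
    A crude variance bound suffices: pairs without a common index are uncorrelated
    ([ustat_variance]), and the addition theorem bounds the kernel by N^(1/4) up to logarithms, so
    the variance is N^(-1/2) up to logarithms, negligible against psi_N^2 ([near_type2_bound]). All
    bounds are uniform over the Sobolev ball.

    The harmonic analysis is built on the way: orthonormality from Rodrigues' formula, density of
    polynomials in L^2, unitarity of D, the addition theorem. On the probabilistic side,
    independence is given on measurable rectangles; it reaches polynomials in Z = eps X, which are
    finite sums of products a(eps) b(X), by uniform approximation with indicators. *)

Notation normc := Normc.normc.
(* In [ring_scope] the notation [^*] denotes [Num.conj], which is only
   convertible to [conjc]. *)
Notation "z ^†" := (conjc z) (at level 1, left associativity, format "z ^†").

(** * Complex numbers: real and imaginary parts, conjugation, modulus *)

Section complex_modulus.
Variable R : realType.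
Local Open Scope complex_scope.
Implicit Types (x y z : R[i]) (r : R).

Lemma cReD x y : complex.Re (x + y) = complex.Re x + complex.Re y.
Proof. by case: x y => [? ?] [? ?]. Qed.

Lemma cImD x y : complex.Im (x + y) = complex.Im x + complex.Im y.
Proof. by case: x y => [? ?] [? ?]. Qed.

Lemma cReM x y :
  complex.Re (x * y) = complex.Re x * complex.Re y - complex.Im x * complex.Im y.
Proof. by case: x y => [? ?] [? ?]. Qed.

Lemma cImM x y :
  complex.Im (x * y) = complex.Re x * complex.Im y + complex.Im x * complex.Re y.
Proof. by case: x y => [? ?] [? ?]. Qed.

Lemma cReJ x : complex.Re x^† = complex.Re x.
Proof. by case: x. Qed.

Lemma cImJ x : complex.Im x^† = - complex.Im x.
Proof. by case: x. Qed.

Lemma cRe_sum (I : Type) (s : seq I) (P : pred I) (F : I -> R[i]) :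
  complex.Re (\sum_(i <- s | P i) F i) = \sum_(i <- s | P i) complex.Re (F i).
Proof. exact: (big_morph _ cReD). Qed.

Lemma cIm_sum (I : Type) (s : seq I) (P : pred I) (F : I -> R[i]) :
  complex.Im (\sum_(i <- s | P i) F i) = \sum_(i <- s | P i) complex.Im (F i).
Proof. exact: (big_morph _ cImD). Qed.

Lemma complex_eq x y :
  complex.Re x = complex.Re y -> complex.Im x = complex.Im y -> x = y.
Proof. by case: x y => [? ?] [? ?] /= -> ->. Qed.

Lemma normc_ge0 x : 0 <= normc x.
Proof. by case: x => a b; exact: sqrtr_ge0. Qed.

Lemma normc_real r : normc r%:C = `|r|.
Proof. by rewrite /= expr0n /= addr0 sqrtr_sqr. Qed.

Lemma normc_conj x : normc x^† = normc x.
Proof. by case: x => a b /=; rewrite sqrrN. Qed.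

Lemma normc_triangle x y : normc (x + y) <= normc x + normc y.
Proof. exact: le_normcD. Qed.

Lemma normc_opp x : normc (- x) = normc x.
Proof. by case: x => a b /=; rewrite !sqrrN. Qed.

Lemma normc_distC x y : normc (x - y) = normc (y - x).
Proof. by rewrite -normc_opp opprB. Qed.

Lemma normc_sqr x : normc x ^+ 2 = complex.Re x ^+ 2 + complex.Im x ^+ 2.
Proof. by case: x => a b /=; rewrite sqr_sqrtr// addr_ge0// sqr_ge0. Qed.

Lemma mul_conj x : x * x^† = (normc x ^+ 2)%:C.
Proof.
by apply: complex_eq; rewrite ?cReM ?cImM cReJ cImJ ?normc_sqr /=; ring.
Qed.

Lemma Re_le_normc x : `|complex.Re x| <= normc x.
Proof.
rewrite -[leRHS]ger0_norm ?normc_ge0// -ler_sqr ?nnegrE ?normr_ge0//.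
by rewrite -!normrX !ger0_norm ?sqr_ge0// normc_sqr lerDl sqr_ge0.
Qed.

Lemma Im_le_normc x : `|complex.Im x| <= normc x.
Proof.
rewrite -[leRHS]ger0_norm ?normc_ge0// -ler_sqr ?nnegrE ?normr_ge0//.
by rewrite -!normrX !ger0_norm ?sqr_ge0// normc_sqr lerDr sqr_ge0.
Qed.

Lemma normc_le_ReIm x : normc x <= `|complex.Re x| + `|complex.Im x|.
Proof.
rewrite -ler_sqr ?nnegrE ?addr_ge0 ?normc_ge0 ?normr_ge0//.
rewrite normc_sqr sqrrD !real_normK ?num_real//.
by rewrite addrAC lerDl mulrn_wge0// mulr_ge0.
Qed.

Lemma normc_sum (I : Type) (s : seq I) (P : pred I) (F : I -> R[i]) :
  normc (\sum_(i <- s | P i) F i) <= \sum_(i <- s | P i) normc (F i).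
Proof.
elim/big_rec2 : _ => [|i y x _ xy]; first by rewrite Normc.normc0.
by apply: le_trans (normc_triangle _ _) _; rewrite lerD2l.
Qed.

Lemma sqr_normc_sumE (I : finType) (F : I -> R[i]) :
  (normc (\sum_i F i) ^+ 2)%:C = \sum_i \sum_j F i * (F j)^†.
Proof.
rewrite -mul_conj rmorph_sum mulr_suml; apply: eq_bigr => i _.
by rewrite mulr_sumr.
Qed.

Lemma conjE x : Num.conj x = x^†.
Proof. by []. Qed.

Lemma conjcM x y : (x * y)^† = x^† * y^†.
Proof. exact: rmorphM. Qed.

Lemma conjcD x y : (x + y)^† = x^† + y^†.
Proof. exact: rmorphD. Qed.

Lemma conjcX x n : (x ^+ n)^† = x^† ^+ n.
Proof. exact: rmorphXn. Qed.

Lemma conjc_sum (I : Type) (s : seq I) (P : pred I) (F : I -> R[i]) :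
  (\sum_(i <- s | P i) F i)^† = \sum_(i <- s | P i) (F i)^†.
Proof. exact: rmorph_sum. Qed.

Lemma real_complexX r n : (r ^+ n)%:C = r%:C ^+ n.
Proof. exact: rmorphXn. Qed.

Lemma real_complexM r r' : (r * r')%:C = r%:C * r'%:C.
Proof. by rewrite rmorphM. Qed.

End complex_modulus.

(** * Linear spans of complex functions and their uniform closure *)

Section linear_span.
Context (R : realType) (T : Type).
Implicit Types (B : (T -> R[i]) -> Prop) (u v : T -> R[i]).

(** The span is an inductive predicate, one generator being added at a time, so that identities
    linear in the function are proved by induction on it. *)
Inductive lin B : (T -> R[i]) -> Prop :=
| lin0 : lin B (fun=> 0)
| linS c b u : B b -> lin B u -> lin B (fun x => c * b x + u x).

Lemma linZ B c u : lin B u -> lin B (fun x => c * u x).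
Proof.
elim=> [|c' b v Bb _ ih].
  by under eq_fun do rewrite mulr0; exact: lin0.
by under eq_fun do rewrite mulrDr mulrA; exact: linS.
Qed.

Lemma linD B u v : lin B u -> lin B v -> lin B (fun x => u x + v x).
Proof.
move=> + Bv; elim=> [|c' b w Bb _ ih].
  by under eq_fun do rewrite add0r.
by under eq_fun do rewrite -addrA; exact: linS.
Qed.

Lemma linB B u v : lin B u -> lin B v -> lin B (fun x => u x - v x).
Proof.
move=> Bu /(linZ (-1)) Bv; under eq_fun do rewrite -mulN1r.
exact: linD.
Qed.

Lemma lin_gen B b : B b -> lin B b.
Proof.
move=> Bb; rewrite (_ : b = fun x => 1 * b x + 0).
  by apply: linS => //; exact: lin0.
by apply/funext => x; rewrite mul1r addr0.
Qed.

Lemma lin_sum B (I : Type) (s : seq I) (F : I -> T -> R[i]) :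
  (forall i, lin B (F i)) -> lin B (fun x => \sum_(i <- s) F i x).
Proof.
move=> BF; elim: s => [|i s ih].
  by under eq_fun do rewrite big_nil; exact: lin0.
by under eq_fun do rewrite big_cons; exact: linD.
Qed.

Lemma lin_sub B B' u : (forall b, B b -> lin B' b) -> lin B u -> lin B' u.
Proof.
move=> BB'; elim=> [|c b v Bb _ ih]; first exact: lin0.
by apply: linD => //; exact/linZ/BB'.
Qed.

Lemma lin_mul B1 B2 B3 u v :
  (forall b1 b2, B1 b1 -> B2 b2 -> lin B3 (fun x => b1 x * b2 x)) ->
  lin B1 u -> lin B2 v -> lin B3 (fun x => u x * v x).
Proof.
move=> B123; elim=> [|c b w Bb _ ih] Bv.
  by under eq_fun do rewrite mul0r; exact: lin0.
under eq_fun do rewrite mulrDl -mulrA.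
apply: linD; last exact: ih.
apply: linZ; elim: Bv => [|c' b' w' Bb' _ ih'].
  by under eq_fun do rewrite mulr0; exact: lin0.
under eq_fun do rewrite mulrDr mulrCA.
by apply: linD => //; exact/linZ/B123.
Qed.

Definition uniform_lin B u := forall e : R, 0 < e ->
  exists2 v, lin B v & forall x, normc (u x - v x) <= e.

Lemma uniform_lin_sub B B' u :
  (forall b, B b -> lin B' b) -> uniform_lin B u -> uniform_lin B' u.
Proof.
by move=> BB' Bu e /Bu[v Bv uv]; exists v => //; exact: lin_sub Bv.
Qed.

Lemma uniform_linS B u : lin B u -> uniform_lin B u.
Proof.
move=> Bu e e0; exists u => // x; rewrite subrr Normc.normc0; exact: ltW.
Qed.

Lemma uniform_lin_lim B u :
  (forall e, 0 < e -> exists2 v, uniform_lin B v & forall x, normc (u x - v x) <= e) ->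
  uniform_lin B u.
Proof.
move=> Bu e e0; have e20 : 0 < e / 2 by rewrite divr_gt0.
have [v Bv uv] := Bu _ e20; have [w Bw vw] := Bv _ e20.
exists w => // x; rewrite -(subrK (v x) (u x)) -addrA.
by rewrite (le_trans (normc_triangle _ _))// [e]splitr lerD.
Qed.

Lemma uniform_linD B u v : uniform_lin B u -> uniform_lin B v ->
  uniform_lin B (fun x => u x + v x).
Proof.
move=> Bu Bv e e0; have e20 : 0 < e / 2 by rewrite divr_gt0.
have [u' Bu' uu'] := Bu _ e20; have [v' Bv' vv'] := Bv _ e20.
exists (fun x => u' x + v' x); first exact: linD.
by move=> x; rewrite opprD addrACA (le_trans (normc_triangle _ _))// [e]splitr lerD.
Qed.

Lemma uniform_linZ B c u : uniform_lin B u -> uniform_lin B (fun x => c * u x).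
Proof.
move=> Bu e e0; have c0 : 0 < normc c + 1 by rewrite ltr_wpDl ?normc_ge0.
have [u' Bu' uu'] := Bu _ (divr_gt0 e0 c0).
exists (fun x => c * u' x); first exact: linZ.
move=> x; rewrite -mulrBr Normc.normcM.
rewrite (@le_trans _ _ ((normc c + 1) * (e / (normc c + 1))))//.
  by apply: ler_pM; rewrite ?normc_ge0// lerDl.
by rewrite mulrC divfK// gt_eqF.
Qed.

End linear_span.

(** * Bounded measurable functions and their approximation by indicators *)

Section bounded_measurable.
Context d (T : measurableType d) (R : realType).
Local Open Scope complex_scope.
Implicit Types (f : T -> R) (u v : T -> R[i]).

(** Boundedness is part of the class so that it is stable under products and integrable for every
    finite measure. *)
Definition bmeas u := [/\ measurable_fun setT (fun x => complex.Re (u x)),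
  measurable_fun setT (fun x => complex.Im (u x)) &
  exists M, forall x, normc (u x) <= M].

Lemma bmeas_cst c : bmeas (fun=> c).
Proof. by split; [exact: measurable_cst|exact: measurable_cst|exists (normc c)]. Qed.

Lemma bmeasD u v : bmeas u -> bmeas v -> bmeas (fun x => u x + v x).
Proof.
move=> [mu1 mu2 [M uM]] [mv1 mv2 [K vK]]; split.
- by under eq_fun do rewrite cReD; exact: measurable_funD.
- by under eq_fun do rewrite cImD; exact: measurable_funD.
- by exists (M + K) => x; rewrite (le_trans (normc_triangle _ _))// lerD.
Qed.

Lemma bmeasM u v : bmeas u -> bmeas v -> bmeas (fun x => u x * v x).
Proof.
move=> [mu1 mu2 [M uM]] [mv1 mv2 [K vK]]; split.
- by under eq_fun do rewrite cReM; apply: measurable_funB; exact: measurable_funM.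
- by under eq_fun do rewrite cImM; apply: measurable_funD; exact: measurable_funM.
- by exists (M * K) => x; rewrite Normc.normcM ler_pM// normc_ge0.
Qed.

Lemma bmeasZ c u : bmeas u -> bmeas (fun x => c * u x).
Proof. by apply: bmeasM; exact: bmeas_cst. Qed.

Lemma bmeasB u v : bmeas u -> bmeas v -> bmeas (fun x => u x - v x).
Proof.
move=> bu /(bmeasZ (-1)) bv; under eq_fun do rewrite -mulN1r.
exact: bmeasD.
Qed.

Lemma bmeasJ u : bmeas u -> bmeas (fun x => (u x)^†).
Proof.
move=> [mu1 mu2 [M uM]]; split.
- by under eq_fun do rewrite cReJ.
- by under eq_fun do rewrite cImJ; exact: measurableT_comp.
- by exists M => x; rewrite normc_conj.
Qed.

Lemma bmeas_sum (I : Type) (s : seq I) (P : pred I) (F : I -> T -> R[i]) :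
  (forall i, bmeas (F i)) -> bmeas (fun x => \sum_(i <- s | P i) F i x).
Proof.
move=> BF; elim: s => [|i s ih].
  by under eq_fun do rewrite big_nil; exact: bmeas_cst.
under eq_fun do rewrite big_cons; case: (P i) => //; exact: bmeasD.
Qed.

Lemma bmeas_prod (I : Type) (s : seq I) (P : pred I) (F : I -> T -> R[i]) :
  (forall i, P i -> bmeas (F i)) -> bmeas (fun x => \prod_(i <- s | P i) F i x).
Proof.
move=> BF; elim: s => [|i s ih].
  by under eq_fun do rewrite big_nil; exact: bmeas_cst.
under eq_fun do rewrite big_cons; case Pi : (P i) => //; apply: bmeasM => //.
exact: BF.
Qed.

Lemma bmeas_real f M : measurable_fun setT f -> (forall x, `|f x| <= M) ->
  bmeas (fun x => (f x)%:C).
Proof.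
by move=> mf fM; split => //; exists M => x; rewrite normc_real.
Qed.

Lemma bmeas_lin (B : (T -> R[i]) -> Prop) u :
  (forall b, B b -> bmeas b) -> lin B u -> bmeas u.
Proof.
move=> Bb; elim=> [|c b v b1 _ ih]; first exact: bmeas_cst.
by apply: bmeasD => //; exact/bmeasZ/Bb.
Qed.

Definition indicators u := exists2 A, measurable A & u = fun x => (\1_A x)%:C.

Lemma bmeas_indicators u : indicators u -> bmeas u.
Proof.
move=> [A mA ->]; apply: (@bmeas_real _ 1); first exact: measurable_indic.
by move=> x; rewrite indicE; case: (_ \in _); rewrite ?normr1// normr0.
Qed.

(** [f + M] takes values in [0, 2M] and is rounded down to a multiple of e by stacking n layers of
    height e, each an indicator of a superlevel set. *)
Lemma real_uniform_lin_indicators f M :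
  measurable_fun setT f -> (forall x, `|f x| <= M) ->
  uniform_lin indicators (fun x => (f x)%:C).
Proof.
move=> mf fM e e0.
have [n nM] : exists n : nat, M + M <= n%:R * e.
  exists (Num.truncn ((M + M) / e)).+1.
  by rewrite -ler_pdivrMr//; apply/ltW/truncnS_gt.
pose s n x : R := \sum_(k < n) e * \1_[set x | k.+1%:R * e <= f x + M] x.
(* After k layers, either all of them are full, or the value has been passed and the error lies in
   [0, e]. At k = n the first case forces [f x = M], with no error, since n e >= 2M. *)
have sP k x : k%:R * e <= f x + M /\ s k x = k%:R * e \/
    f x + M < k%:R * e /\ 0 <= f x + M - s k x <= e.
  elim: k => [|k ih].
    left; rewrite /s big_ord0 mul0r; split => //.
    by have := fM x; rewrite ler_norml -lerBlDr sub0r => /andP[].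
  rewrite /s big_ord_recr /= -/(s k x) indicE.
  have [h|h] := leP (k.+1%:R * e) (f x + M).
    rewrite mem_set//; left; split => //; case: ih => [[_ ->]|[h2 _]].
      by rewrite mulr1 -natr1 mulrDl mul1r.
    exfalso; move: h; rewrite leNgt => /negP; apply; apply: lt_le_trans h2 _.
    by rewrite ler_pM2r// ler_nat.
  rewrite memNset/=; last by apply/negP; rewrite -ltNge.
  right; split => //; rewrite mulr0 addr0; case: ih => [[h2 ->]|[]//].
  by move: h h2; rewrite -natr1 mulrDl mul1r; set z := f x + M; lra.
exists (fun x => (s n x)%:C + - M%:C).
  rewrite /s; under eq_fun do rewrite rmorph_sum.
  apply: linB.
    apply: (@lin_sum _ _ _ _ _ (fun (k : 'I_n) x => (e * \1_[set x | k.+1%:R * e <= f x + M] x)%:C)) => k.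
    under eq_fun do rewrite real_complexM.
    apply/linZ/lin_gen; exists [set x | k.+1%:R * e <= f x + M] => //.
    rewrite -[X in measurable X]setTI.
    rewrite (_ : [set x | _] = (fun x => f x + M) @^-1` `[k.+1%:R * e, +oo[).
      by apply: measurable_funD => //; exact: measurable_cst.
    by apply/seteqP; split => x /=; rewrite in_itv /= andbT.
  rewrite (_ : (fun _ => _) = fun x => M%:C * (\1_setT x)%:C).
    by apply/linZ/lin_gen; exists setT.
  by apply/funext => x; rewrite indicE in_setT mulr1.
move=> x; rewrite (_ : _ - _ = (f x - (s n x - M))%:C) ?normc_real.
  2: by rewrite !rmorphB.
case: (sP n x) => [[h ->]|[_ /andP[h1 h2]]].
  have := fM x; rewrite ler_norml => /andP[h1 h2].
  have h3 : f x = M by apply/eqP; rewrite eq_le h2 /=; lra.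
  suff -> : f x - (n%:R * e - M) = 0 by rewrite normr0 ltW.
  by apply/eqP; rewrite eq_le; apply/andP; split; lra.
by rewrite ler_norml; apply/andP; split; lra.
Qed.

Lemma bmeas_uniform_lin u : bmeas u -> uniform_lin indicators u.
Proof.
move=> [mu1 mu2 [M uM]].
have -> : u = fun x => (complex.Re (u x))%:C + 'i * (complex.Im (u x))%:C.
  by apply/funext => x; exact: complexE.
apply: uniform_linD; last apply: uniform_linZ.
  apply: (@real_uniform_lin_indicators _ M) => // x.
  exact: le_trans (Re_le_normc _) (uM x).
apply: (@real_uniform_lin_indicators _ M) => // x.
exact: le_trans (Im_le_normc _) (uM x).
Qed.

(** Approximating u within e / (|K| + 1) bounds |F u| by e. With F the difference of the two sides
    of an identity, this carries the identity from indicators to all bounded measurable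
    functions. *)
Lemma uniform_lin_zero (F : (T -> R[i]) -> R[i]) (B : (T -> R[i]) -> Prop) (K : R) u :
  (forall c u v, bmeas u -> bmeas v -> F (fun x => c * u x + v x) = c * F u + F v) ->
  (forall u M, bmeas u -> (forall x, normc (u x) <= M) -> normc (F u) <= K * M) ->
  (forall b, B b -> bmeas b /\ F b = 0) ->
  bmeas u -> uniform_lin B u -> F u = 0.
Proof.
move=> Flin Fbnd FB bu Bu.
have F0 : F (fun=> 0) = 0.
  have := Flin (- 1) (fun=> 0) (fun=> 0) (bmeas_cst _) (bmeas_cst _).
  rewrite (_ : (fun _ => _) = fun=> 0).
    by move->; rewrite mulN1r addNr.
  by apply/funext => x; rewrite mulr0 addr0.
have FB0 v : lin B v -> bmeas v /\ F v = 0.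
  elim=> [|c b w Bb _ [bw Fw]]; first by split => //; exact: bmeas_cst.
  have [bb Fb] := FB _ Bb; split; first by apply: bmeasD => //; exact: bmeasZ.
  by rewrite Flin// Fb Fw mulr0 addr0.
apply: Normc.eq0_normc; apply/eqP; rewrite eq_le normc_ge0 andbT.
apply/ler_addgt0Pr => e e0; rewrite add0r.
have K0 : 0 < `|K| + 1 by rewrite ltr_wpDl.
have [v Bv uv] := Bu _ (divr_gt0 e0 K0); have [bv Fv] := FB0 _ Bv.
have -> : F u = F (fun x => - 1 * v x + u x).
  by rewrite Flin// Fv mulr0 add0r.
apply: (le_trans (Fbnd _ (e / (`|K| + 1)) _ _)).
- by apply: bmeasD => //; exact: bmeasZ.
- by move=> x; rewrite mulN1r addrC.
- rewrite mulrCA ler_piMr ?(ltW e0)// ler_pdivrMr// mul1r.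
  by rewrite (le_trans (ler_norm K))// lerDl.
Qed.

End bounded_measurable.

Lemma bmeas_comp d d' (T : measurableType d) (T' : measurableType d') (R : realType)
    (u : T' -> R[i]) (h : T -> T') :
  measurable_fun setT h -> bmeas u -> bmeas (fun x => u (h x)).
Proof.
move=> mh [mu1 mu2 [M uM]]; split; last by exists M.
  exact: (measurableT_comp mu1).
exact: (measurableT_comp mu2).
Qed.

(** * Complex integrals of bounded functions over a finite measure *)

Section bounded_integral.
Context d (T : measurableType d) (R : realType).
Variable mu : {measure set T -> \bar R}.
Hypothesis mu_fin : (mu setT < +oo)%E.
Local Open Scope complex_scope.
Implicit Types (f : T -> R) (u v : T -> R[i]).

Lemma bounded_integrable f M : measurable_fun setT f ->
  (forall x, `|f x| <= M) -> mu.-integrable setT (EFin \o f).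
Proof.
move=> mf fM; apply: measurable_bounded_integrable => //.
by exists M; split; rewrite ?num_real// => K MK x _ /=; rewrite (le_trans (fM x))// ltW.
Qed.

Lemma bmeas_integrable u : bmeas u ->
  mu.-integrable setT (fun x => (complex.Re (u x))%:E) /\
  mu.-integrable setT (fun x => (complex.Im (u x))%:E).
Proof.
move=> [mu1 mu2 [M uM]]; split.
  apply: (@bounded_integrable _ M) => // x.
  exact: le_trans (Re_le_normc _) (uM x).
apply: (@bounded_integrable _ M) => // x.
exact: le_trans (Im_le_normc _) (uM x).
Qed.

Lemma cintegralD u v : bmeas u -> bmeas v ->
  cintegral mu (fun x => u x + v x) = cintegral mu u + cintegral mu v.
Proof.
move=> /bmeas_integrable[u1 u2] /bmeas_integrable[v1 v2].
rewrite /cintegral; apply: complex_eq => /=.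
  rewrite -RintegralD//; apply: eq_Rintegral => x _; exact: cReD.
rewrite -RintegralD//; apply: eq_Rintegral => x _; exact: cImD.
Qed.

Lemma cintegralZ c u : bmeas u ->
  cintegral mu (fun x => c * u x) = c * cintegral mu u.
Proof.
move=> bu; have [u1 u2] := bmeas_integrable bu.
have h k (f : T -> R) : mu.-integrable setT (EFin \o f) ->
    mu.-integrable setT (EFin \o (fun x => k * f x)).
  by move=> fi; apply: eq_integrable (integrableZl measurableT k fi).
rewrite /cintegral; apply: complex_eq; rewrite ?cReM ?cImM /=.
  rewrite -!RintegralZl// -RintegralB//; [|exact: h|exact: h].
  by apply: eq_Rintegral => x _; rewrite cReM.
rewrite -!RintegralZl// -RintegralD//; [|exact: h|exact: h].
by apply: eq_Rintegral => x _; rewrite cImM.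
Qed.

Lemma cintegralZr c u : bmeas u ->
  cintegral mu (fun x => u x * c) = cintegral mu u * c.
Proof. by move=> bu; under eq_fun do rewrite mulrC; rewrite cintegralZ// mulrC. Qed.

Lemma cintegralB u v : bmeas u -> bmeas v ->
  cintegral mu (fun x => u x - v x) = cintegral mu u - cintegral mu v.
Proof.
move=> bu bv; rewrite -mulN1r -cintegralZ// -cintegralD//; last exact: bmeasZ.
by under [in RHS]eq_fun do rewrite mulN1r.
Qed.

Lemma cintegralJ u : bmeas u ->
  cintegral mu (fun x => (u x)^†) = (cintegral mu u)^†.
Proof.
move=> bu; have [u1 u2] := bmeas_integrable bu.
rewrite /cintegral; apply: complex_eq => /=.
  by apply: eq_Rintegral => x _; rewrite cReJ.
rewrite -mulN1r -RintegralZl//; apply: eq_Rintegral => x _.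
by rewrite cImJ mulN1r.
Qed.

Lemma cintegral_sum (I : Type) (s : seq I) (P : pred I) (F : I -> T -> R[i]) :
  (forall i, bmeas (F i)) ->
  cintegral mu (fun x => \sum_(i <- s | P i) F i x) =
  \sum_(i <- s | P i) cintegral mu (F i).
Proof.
move=> BF; elim: s => [|i s ih].
  under eq_fun do rewrite big_nil; rewrite big_nil /cintegral.
  by apply: complex_eq; rewrite /= Rintegral_cst// mul0r.
rewrite big_cons -ih; case Pi : (P i).
  rewrite -cintegralD//; last exact: bmeas_sum.
  by congr cintegral; apply/funext => x; rewrite big_cons Pi.
by congr cintegral; apply/funext => x; rewrite big_cons Pi.
Qed.

Lemma cintegral_cst c : cintegral mu (fun=> c) = c * (fine (mu setT))%:C.
Proof.
apply: complex_eq; rewrite ?cReM ?cImM /= Rintegral_cst//; ring.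
Qed.

Lemma cintegral_real f : cintegral mu (fun x => (f x)%:C) = (\int[mu]_x f x)%:C.
Proof. by apply: complex_eq => //=; rewrite Rintegral_cst// mul0r. Qed.

(** Real and imaginary parts are bounded separately, whence the factor 2; it is harmless wherever
    the bound is used. *)
Lemma cintegral_bound u M : bmeas u -> (forall x, normc (u x) <= M) ->
  normc (cintegral mu u) <= 2 * fine (mu setT) * M.
Proof.
move=> bu uM; have [u1 u2] := bmeas_integrable bu.
have h (f : T -> R) : mu.-integrable setT (EFin \o f) -> (forall x, `|f x| <= M) ->
    `|\int[mu]_x f x| <= fine (mu setT) * M.
  move=> fi fM; apply: (le_trans (le_normr_Rintegral _ _)) => //.
  rewrite mulrC -Rintegral_cst//; apply: le_Rintegral => //.
    exact: (integrable_abse fi).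
  apply: (@bounded_integrable _ `|M|) => //.
apply: (le_trans (normc_le_ReIm _)); rewrite -mulrA mulr_natl mulr2n; apply: lerD.
  by apply: h => // x; rewrite (le_trans (Re_le_normc _)).
by apply: h => // x; rewrite (le_trans (Im_le_normc _)).
Qed.

Lemma Re_cintegral_ge0 u : (forall x, 0 <= complex.Re (u x)) ->
  0 <= complex.Re (cintegral mu u).
Proof. by move=> u0; apply: Rintegral_ge0. Qed.

Lemma cintegral_indic A : measurable A ->
  cintegral mu (fun x => (\1_A x)%:C) = (fine (mu A))%:C.
Proof.
move=> mA; rewrite cintegral_real; congr (_%:C).
by rewrite /Rintegral integral_indic// setIT.
Qed.

End bounded_integral.

(** * Integration against an integrable weight, and change of variables *)

Section weighted_integral.
Context d (T : measurableType d) (R : realType) (mu : {measure set T -> \bar R}).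
Variables (f : T -> R) (fi : mu.-integrable setT (EFin \o f)).
Local Open Scope complex_scope.
Implicit Types u v : T -> R[i].

Lemma weighted_integrable u : bmeas u ->
  mu.-integrable setT (fun x => (f x * complex.Re (u x))%:E) /\
  mu.-integrable setT (fun x => (f x * complex.Im (u x))%:E).
Proof.
have h (g : T -> R) (M : R) : measurable_fun setT g -> (forall x, `|g x| <= M) ->
    mu.-integrable setT (fun x => (f x * g x)%:E).
  move=> mg gM; rewrite (_ : (fun _ => _) = ((EFin \o f) \* (EFin \o g))%E).
    apply: integrableMl => //.
    by exists M; split; rewrite ?num_real// => K MK x _ /=; rewrite (le_trans (gM x))// ltW.
  by apply/funext => x /=; rewrite EFinM.
move=> [mu1 mu2 [M uM]]; split.
  by apply: (h _ M) => // x; rewrite (le_trans (Re_le_normc _)).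
by apply: (h _ M) => // x; rewrite (le_trans (Im_le_normc _)).
Qed.

Lemma cRe_realM (r : R) z : complex.Re (r%:C * z) = r * complex.Re z.
Proof. by rewrite cReM /= mul0r subr0. Qed.

Lemma cIm_realM (r : R) z : complex.Im (r%:C * z) = r * complex.Im z.
Proof. by rewrite cImM /= mul0r addr0. Qed.

Lemma weighted_cintegralP u c v : bmeas u -> bmeas v ->
  cintegral mu (fun x => (f x)%:C * (c * u x + v x)) =
  c * cintegral mu (fun x => (f x)%:C * u x) + cintegral mu (fun x => (f x)%:C * v x).
Proof.
move=> bu bv.
have [u1 u2] := weighted_integrable bu; have [v1 v2] := weighted_integrable bv.
have h k (g : T -> R) : mu.-integrable setT (EFin \o g) ->
    mu.-integrable setT (EFin \o (fun x => k * g x)).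
  by move=> gi; apply: eq_integrable (integrableZl measurableT k gi).
have hD (g1 g2 : T -> R) : mu.-integrable setT (EFin \o g1) ->
    mu.-integrable setT (EFin \o g2) ->
    mu.-integrable setT (EFin \o (fun x => g1 x + g2 x)).
  by move=> i1 i2; apply: eq_integrable (integrableD measurableT i1 i2).
have hB (g1 g2 : T -> R) : mu.-integrable setT (EFin \o g1) ->
    mu.-integrable setT (EFin \o g2) ->
    mu.-integrable setT (EFin \o (fun x => g1 x - g2 x)).
  by move=> i1 i2; apply: eq_integrable (integrableB measurableT i1 i2).
rewrite /cintegral; under [X in Complex X]eq_Rintegral do rewrite cRe_realM.
under [X in Complex _ X]eq_Rintegral do rewrite cIm_realM.
under [X in _ * Complex X _]eq_Rintegral do rewrite cRe_realM.
under [X in _ * Complex _ X]eq_Rintegral do rewrite cIm_realM.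
under [X in _ + Complex X _]eq_Rintegral do rewrite cRe_realM.
under [X in _ + Complex _ X]eq_Rintegral do rewrite cIm_realM.
apply: complex_eq; rewrite ?cReD ?cImD ?cReM ?cImM /=.
  rewrite -!RintegralZl// -RintegralB//; [|exact: h|exact: h].
  rewrite -RintegralD//; last by apply: hB; exact: h.
  by apply: eq_Rintegral => x _; rewrite cReD cReM; ring.
rewrite -!RintegralZl// -RintegralD//; [|exact: h|exact: h].
rewrite -RintegralD//; last by apply: hD; exact: h.
by apply: eq_Rintegral => x _; rewrite cImD cImM; ring.
Qed.

Lemma weighted_cintegral_bound u M : bmeas u -> (forall x, normc (u x) <= M) ->
  normc (cintegral mu (fun x => (f x)%:C * u x)) <= 2 * (\int[mu]_x `|f x|) * M.
Proof.
move=> bu uM; have [u1 u2] := weighted_integrable bu.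
have h (g : T -> R) : mu.-integrable setT (fun x => (f x * g x)%:E) ->
    (forall x, `|g x| <= M) ->
    `|\int[mu]_x (f x * g x)| <= (\int[mu]_x `|f x|) * M.
  move=> gi gM; apply: (le_trans (le_normr_Rintegral _ _)) => //.
  rewrite mulrC -RintegralZl//; last exact: (integrable_abse fi).
  apply: le_Rintegral => //.
  - exact: (integrable_abse gi).
  - by apply: eq_integrable (integrableZl measurableT M (integrable_abse fi)).
  - by move=> x _; rewrite normrM mulrC ler_wpM2r.
rewrite /cintegral; under eq_Rintegral do rewrite cRe_realM.
under [X in Complex _ X]eq_Rintegral do rewrite cIm_realM.
apply: (le_trans (normc_le_ReIm _)); rewrite -mulrA mulr_natl mulr2n; apply: lerD => /=.
  by apply: h => // x; rewrite (le_trans (Re_le_normc _)).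
by apply: h => // x; rewrite (le_trans (Im_le_normc _)).
Qed.

(** Both sides are linear and bounded in u, and the hypothesis on [nu] is the case of indicators, so
    [uniform_lin_zero] applies. This one formula serves for spherical coordinates and for the laws
    of [eps] and [X]. *)
Lemma cintegral_density d' (T' : measurableType d') (nu : {measure set T' -> \bar R})
    (h : T -> T') (u : T' -> R[i]) :
  (forall x, 0 <= f x) -> measurable_fun setT h ->
  (forall A, measurable A -> nu A = \int[mu]_(x in h @^-1` A) (f x)%:E)%E ->
  bmeas u -> cintegral nu u = cintegral mu (fun x => (f x)%:C * u (h x)).
Proof.
move=> f0 mh nuE bu.
have mf : measurable_fun setT f by apply/measurable_EFinP; exact: measurable_int fi.
have nufin : (nu setT < +oo)%E.
  by rewrite nuE// preimage_setT; case/integrableP : fi => _;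
    apply: le_lt_trans; apply: ge0_le_integral => //=;
    [move=> x _; rewrite lee_fin|exact/measurable_EFinP|do 2 apply: measurableT_comp => //
    |move=> x _; rewrite lee_fin ler_norm].
apply/eqP; rewrite -subr_eq0; apply/eqP.
pose F (v : T' -> R[i]) := cintegral nu v - cintegral mu (fun x => (f x)%:C * v (h x)).
apply: (@uniform_lin_zero _ _ _ F (@indicators _ _ _)
  (2 * fine (nu setT) + 2 * \int[mu]_x `|f x|)) => //.
- move=> c v w bv bw; rewrite /F cintegralD ?cintegralZ//; last exact: bmeasZ.
  rewrite weighted_cintegralP; [ring|exact: bmeas_comp bv|exact: bmeas_comp bw].
- move=> v M bv vM; rewrite /F mulrDl (le_trans (normc_triangle _ _))// lerD//.
    exact: cintegral_bound.
  rewrite normc_opp; apply: (@weighted_cintegral_bound (fun x => v (h x)) M) => //.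
  exact: bmeas_comp bv.
- move=> b ib; split; first exact: bmeas_indicators.
  case: ib => A mA ->; rewrite /F cintegral_indic// nuE//.
  rewrite (_ : (fun x => _) = fun x => (f x * \1_A (h x))%:C); last first.
    by apply/funext => x; rewrite real_complexM.
  rewrite cintegral_real /Rintegral; apply/eqP; rewrite subr_eq0; apply/eqP.
  congr (_%:C); congr fine; rewrite integral_mkcond; apply: eq_integral => x _.
  rewrite patchE indicE.
  have -> : (x \in h @^-1` A) = (h x \in A) by apply/idP/idP; rewrite !inE.
  by case: (_ \in _); rewrite ?mulr1 ?mulr0.
- exact: bmeas_uniform_lin.
Qed.

End weighted_integral.

(** * Multiplicativity of expectations: from generators to their uniform closure *)

Section product_expectation.
Context d (Omega : measurableType d) (R : realType).
Variable P : probability Omega R.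
Local Open Scope complex_scope.

Lemma probability_lty : (P setT < +oo)%E.
Proof. by rewrite probability_setT ltry. Qed.

Let Pfin := probability_lty.

Lemma fine_probability_setT : fine (P setT) = 1.
Proof. by rewrite probability_setT. Qed.

(** The identity is linear in each factor, so the factors are upgraded from generators to uniform
    limits one at a time; k counts those already upgraded. *)
Lemma prod_expectation_uniform_lin (n : nat) (B : nat -> (Omega -> R[i]) -> Prop) :
  (forall i b, B i b -> bmeas b) ->
  (forall W : nat -> Omega -> R[i], (forall i, (i < n)%N -> B i (W i)) ->
    cintegral P (fun w => \prod_(i < n) W i w) = \prod_(i < n) cintegral P (W i)) ->
  forall W : nat -> Omega -> R[i],
    (forall i, (i < n)%N -> bmeas (W i) /\ uniform_lin (B i) (W i)) ->
    cintegral P (fun w => \prod_(i < n) W i w) = \prod_(i < n) cintegral P (W i).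
Proof.
move=> Bb BW.
suff H k : (k <= n)%N -> forall W : nat -> Omega -> R[i],
    (forall i, (i < n)%N -> bmeas (W i) /\
      (if (i < k)%N then uniform_lin (B i) (W i) else B i (W i))) ->
    cintegral P (fun w => \prod_(i < n) W i w) = \prod_(i < n) cintegral P (W i).
  by move=> W WB; apply: (H n) => // i ni; rewrite ni; exact: WB.
elim: k => [_ W WB|k ih kn W WB]; first by apply: BW => i /WB[].
pose k0 := Ordinal kn.
pose V w := \prod_(i < n | i != k0) W i w.
pose c := \prod_(i < n | i != k0) cintegral P (W i).
have bV : bmeas V by apply: bmeas_prod => i _; have [] := WB i (ltn_ord i).
have [bWk Wk] := WB k kn; rewrite ltnSn in Wk.
(* The defect of multiplicativity as a functional of the factor in slot k, the others being frozen.
   It vanishes on generators by the induction hypothesis. *)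
pose F u := cintegral P (fun w => u w * V w) - cintegral P u * c.
suff F0 : F (W k) = 0.
  rewrite (bigD1 k0)//= -/c; move/eqP : F0; rewrite /F subr_eq0 => /eqP <-.
  by congr cintegral; apply/funext => w; rewrite (bigD1 k0).
have [_ _ [M VM]] := bV.
apply: (@uniform_lin_zero _ _ _ F (B k) (2 * `|M| + 2 * normc c)) => //.
- move=> a u v bu bv; rewrite /F cintegralD ?cintegralZ//; last exact: bmeasZ.
  under eq_fun do rewrite mulrDl -mulrA.
  rewrite cintegralD ?cintegralZ//; last 3 first.
  + exact: bmeasM.
  + by apply: bmeasZ; exact: bmeasM.
  + exact: bmeasM.
  ring.
- move=> u K bu uK; rewrite /F mulrDl (le_trans (normc_triangle _ _))// lerD//.
    have := @cintegral_bound _ _ _ P Pfin (fun w => u w * V w) (`|M| * K).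
    rewrite fine_probability_setT mulr1 mulrA; apply; first exact: bmeasM.
    move=> x; rewrite Normc.normcM mulrC ler_pM ?normc_ge0//.
    by rewrite (le_trans (VM x))// ler_norm.
  have := cintegral_bound Pfin bu uK; rewrite fine_probability_setT mulr1 => uK'.
  by rewrite normc_opp Normc.normcM mulrC -mulrA mulrCA ler_wpM2l ?normc_ge0.
- move=> b Bkb; split; first exact: Bb Bkb.
  pose W' i := if i == k then b else W i.
  have W'E (i : 'I_n) : i != k0 -> W' i = W i.
    by move=> ik; rewrite /W'; case: eqP => // ik'; case/eqP : ik; apply: val_inj.
  have W'B i : (i < n)%N -> bmeas (W' i) /\
      (if (i < k)%N then uniform_lin (B i) (W' i) else B i (W' i)).
    move=> ni; rewrite /W'; case: eqP => [->|/eqP ik].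
      by rewrite ltnn; split => //; exact: Bb Bkb.
    by have := WB i ni; rewrite ltnS leq_eqVlt (negbTE ik).
  have W'k : W' k = b by rewrite /W' eqxx.
  apply/eqP; rewrite /F subr_eq0; apply/eqP.
  transitivity (cintegral P (fun w => \prod_(i < n) W' i w)).
    congr cintegral; apply/funext => w; rewrite (bigD1 k0)//= W'k.
    by congr (_ * _); apply: eq_bigr => i ik; rewrite W'E.
  rewrite (ih (ltnW kn) W' W'B) (bigD1 k0)//= W'k.
  by congr (_ * _); apply: eq_bigr => i ik; rewrite W'E.
Qed.

End product_expectation.

(** * Legendre polynomials: orthogonality and norms by formal integration *)

Section legendre_orthogonality.
Variable R : realType.
Implicit Types p q r : {poly R}.

Definition poly_primitive p : {poly R} :=
  \poly_(i < (size p).+1) (p`_i.-1 / i%:R).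

Lemma poly_primitiveK p : (poly_primitive p)^`() = p.
Proof.
apply/polyP => i; rewrite coef_deriv coef_poly ltnS.
have [ip|pi] := ltnP i (size p).
  by rewrite /= -[LHS]mulr_natr divfK// pnatr_eq0.
by rewrite mul0rn nth_default.
Qed.

(* The integral of p over [-1, 1], computed algebraically. *)
Definition poly_int p : R := (poly_primitive p).[1] - (poly_primitive p).[-1].

Lemma poly_int_deriv q : poly_int q^`() = q.[1] - q.[-1].
Proof.
have h : (q - poly_primitive q^`())^`() = 0 by rewrite derivB poly_primitiveK subrr.
have [c cE] : exists c, q - poly_primitive q^`() = c%:P.
  exists (q - poly_primitive q^`())`_0; apply/polyP => -[|i]; rewrite coefC//=.
  move/polyP/(_ i) : h; rewrite coef_deriv coef0 => /eqP.
  by rewrite mulrn_eq0 /= => /eqP.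
have E : q = c%:P + poly_primitive q^`() by rewrite -cE subrK.
by rewrite /poly_int [in RHS]E !hornerE; ring.
Qed.

Lemma poly_intZD c p q : poly_int (c *: p + q) = c * poly_int p + poly_int q.
Proof.
rewrite -{1}[p]poly_primitiveK -{1}[q]poly_primitiveK -derivZ -derivD poly_int_deriv.
by rewrite /poly_int !(hornerD, hornerZ); ring.
Qed.

Lemma poly_int0 : poly_int 0 = 0.
Proof. by rewrite -[X in poly_int X](@derivC _ 0) poly_int_deriv !hornerC subrr. Qed.

Lemma poly_intZ c p : poly_int (c *: p) = c * poly_int p.
Proof. by rewrite -[X in poly_int X]addr0 poly_intZD poly_int0 addr0. Qed.

Lemma poly_intD p q : poly_int (p + q) = poly_int p + poly_int q.
Proof. by rewrite -[X in X + q]scale1r poly_intZD mul1r. Qed.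

Lemma poly_intN p : poly_int (- p) = - poly_int p.
Proof. by rewrite -scaleN1r poly_intZ mulN1r. Qed.

Let W : {poly R} := 'X^2 - 1.

Lemma W_1 : W.[1] = 0.
Proof. by rewrite /W !(hornerD, hornerN, hornerXn, hornerC) expr1n subrr. Qed.

Lemma W_N1 : W.[-1] = 0.
Proof. by rewrite /W !(hornerD, hornerN, hornerXn, hornerC) sqrrN expr1n subrr. Qed.

Lemma derivW n r : (W ^+ n.+1 * r)^`() = W ^+ n * ('X *+ 2 * r *+ n.+1 + W * r^`()).
Proof.
rewrite derivM deriv_exp exprS /= derivB derivC subr0 derivXn /=; ring.
Qed.

(** Each derivative lowers the power of [W] in [W ^+ k * r] by only one ([derivW]), so a factor [W],
    which vanishes at both endpoints, kills every boundary term as long as j <= k. *)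
Lemma poly_int_parts k j p r : (j <= k)%N ->
  poly_int (p^`(j) * (W ^+ k * r)) = (-1) ^+ j * poly_int (p * (W ^+ k * r)^`(j)).
Proof.
elim: j k r => [k r _|j ih [//|k] r jk].
  by rewrite derivn0 derivn0 expr0 mul1r.
have : poly_int (p^`(j.+1) * (W ^+ k.+1 * r)) =
    - poly_int (p^`(j) * (W ^+ k.+1 * r)^`()).
  apply/eqP; rewrite -subr_eq0 opprK -poly_intD derivnS -derivM poly_int_deriv.
  by rewrite !hornerM !horner_exp W_1 W_N1 !exprS !(mul0r, mulr0, subrr).
move=> ->; by rewrite derivW ih// -derivW -derivSn [(-1) ^+ j.+1]exprS -mulrA mulN1r.
Qed.

Lemma poly_intW l :
  poly_int (W ^+ l) = (-1) ^+ l * (2 ^+ (2 * l).+1 * l`!%:R ^+ 2 / ((2 * l).+1)`!%:R).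
Proof.
elim: l => [|l ih].
  rewrite expr0 -[X in poly_int X](derivX R) poly_int_deriv !hornerE /= fact0.
  by rewrite factS fact0 expr1; field.
(* The recursion in l is the integral of the derivative of [W ^+ l.+1 * 'X], which vanishes at 1 and
   -1. *)
have : (2 * l + 3)%:R * poly_int (W ^+ l.+1) + (2 * l + 2)%:R * poly_int (W ^+ l) = 0.
  rewrite -!poly_intZ -poly_intD.
  have -> : (2 * l + 3)%:R *: W ^+ l.+1 + (2 * l + 2)%:R *: W ^+ l = (W ^+ l.+1 * 'X)^`().
    by rewrite derivW derivX mulr1 exprS -!mul_polyC !polyC_natr /W; ring.
  by rewrite poly_int_deriv !hornerM !horner_exp W_1 W_N1 !exprS !(mul0r, mulr0, subrr).
rewrite ih => h; have h3 : (2 * l + 3)%:R != 0 :> R by rewrite pnatr_eq0 addn3.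
apply: (mulfI h3); move/eqP : h; rewrite addr_eq0 => /eqP ->.
have -> : ((2 * l.+1).+1 = (2 * l).+3)%N by rewrite mulnS.
rewrite (factS (2 * l).+2) (factS (2 * l).+1) (factS l) !exprS -[(2 * l).+3]addn3.
have := fact_gt0 (2 * l).+1; rewrite lt0n -(pnatr_eq0 R).
move: ((2 * l).+1`!) (l`!) => F G F0.
rewrite -[(2 * l).+2]addn2 -[l.+1]addn1 !(natrM, natrD) !expr0.
have : (l%:R : R) >= 0 by [].
move: l%:R => x x0; field; rewrite F0 /=.
by apply/andP; split; rewrite gt_eqF//; lra.
Qed.

Lemma derivn_top n p : (size p <= n.+1)%N -> p^`(n) = (n`!%:R * p`_n)%:P.
Proof.
move=> sp; apply/polyP => i; rewrite coef_derivn coefC.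
case: i => [|i] /=; first by rewrite addn0 ffactnn mulr_natl.
by rewrite nth_default ?mul0rn// (leq_trans sp)// addnS ltnS leq_addr.
Qed.

Lemma size_W n : size (W ^+ n) = (2 * n).+1.
Proof.
have mW : W \is monic by rewrite monicE lead_coefDl ?lead_coefXn// size_polyXn size_polyN size_poly1.
have sW : size W = 3 by rewrite size_polyDl ?size_polyXn// size_polyN size_poly1.
elim: n => [|n ih]; first by rewrite expr0 size_poly1.
by rewrite exprS size_monicM ?monic_neq0 ?monic_exp// ih sW mulnS.
Qed.

Lemma monic_W n : W ^+ n \is monic.
Proof.
apply: monic_exp; rewrite monicE lead_coefDl ?lead_coefXn//.
by rewrite size_polyXn size_polyN size_poly1.
Qed.

Lemma coef_W n : (W ^+ n)`_(2 * n) = 1.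
Proof. by have := monic_W n; rewrite monicE lead_coefE size_W /= => /eqP. Qed.

Definition leg_cst l : R := (2 ^+ l * l`!%:R)^-1.

Lemma leg_cst_neq0 l : leg_cst l != 0.
Proof.
by rewrite invr_eq0 mulf_neq0 ?expf_neq0// pnatr_eq0 -lt0n fact_gt0.
Qed.

Lemma legendreE l : legendre R l = leg_cst l *: (W ^+ l)^`(l).
Proof. by []. Qed.

Definition dlegendre l m : {poly R} := (legendre R l)^`(m).

Lemma coef_dlegendre l m : (m <= l)%N ->
  (dlegendre l m)`_(l - m) = leg_cst l * ((2 * l) ^_ l)%:R * (l ^_ m)%:R.
Proof.
move=> ml; rewrite /dlegendre coef_derivn subnKC// legendreE coefZ coef_derivn.
by rewrite addnn -mul2n coef_W [in RHS]mulr_natr.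
Qed.

Lemma size_dlegendre l m : (m <= l)%N -> size (dlegendre l m) = (l - m).+1.
Proof.
move=> ml; apply/eqP; rewrite eqn_leq; apply/andP; split.
  apply/leq_sizeP => j lj; rewrite /dlegendre coef_derivn legendreE coefZ coef_derivn.
  rewrite nth_default ?mul0rn ?mulr0 ?mul0rn// size_W mul2n -addnn.
  by rewrite ltn_add2l -(subnKC ml) ltn_add2l.
rewrite ltnNge; apply/negP => /leq_sizeP/(_ _ (leqnn _)); rewrite coef_dlegendre//.
move/eqP; rewrite !mulf_eq0 (negbTE (leg_cst_neq0 l)) !pnatr_eq0 /= !eqn0Ngt !ffact_gt0.
by rewrite ml leq_pmull.
Qed.

(** By Rodrigues' formula the derivative of order m + l of [W ^+ l] is moved onto [W ^+ m * q] in
    two batches: m integrations by parts protected by the factor [W ^+ m], then l protected by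
    [W ^+ l]. *)
Lemma legendre_parts l m q :
  poly_int ((1 - 'X^2) ^+ m * dlegendre l m * q) =
  (-1) ^+ l * leg_cst l * poly_int (W ^+ l * (W ^+ m * q)^`(m + l)).
Proof.
have sgn n : (-1) ^+ n * (-1) ^+ n = 1 :> R by rewrite -exprMn mulrNN mulr1 expr1n.
have -> : (1 - 'X^2) ^+ m * dlegendre l m * q = (-1) ^+ m *: (dlegendre l m * (W ^+ m * q)).
  have -> : 1 - 'X^2 = - W by rewrite opprB.
  have -> : (-1 : R) ^+ m *: (dlegendre l m * (W ^+ m * q)) =
      (-1) ^+ m * (dlegendre l m * (W ^+ m * q)).
    by rewrite -mul_polyC rmorphXn /= polyCN polyC1.
  by rewrite [(- W) ^+ m]exprNn; ring.
rewrite poly_intZ poly_int_parts// mulrA sgn mul1r legendreE -scalerAl poly_intZ.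
have := @poly_int_parts l l ((W ^+ m * q)^`(m)) 1 (leqnn l).
have -> : (W ^+ m * q)^`(m)^`(l) = (W ^+ m * q)^`(m + l).
  by rewrite /derivn -iterD addnC.
rewrite !mulr1 [_ * (W ^+ l)^`(l)]mulrC [_ * W ^+ l]mulrC.
move=> /(congr1 (fun z => (-1) ^+ l * z)); rewrite mulrA sgn mul1r => <-.
by rewrite mulrCA mulrA.
Qed.

(** Here [W ^+ m * q] has degree below m + l, so its derivative of order m + l is zero. *)
Lemma legendre_orthogonal l m q : (m <= l)%N -> (size q <= l - m)%N ->
  poly_int ((1 - 'X^2) ^+ m * dlegendre l m * q) = 0.
Proof.
move=> ml sq; rewrite legendre_parts derivn_poly0 ?mulr0 ?poly_int0 ?mulr0//.
rewrite (leq_trans (size_polyMleq _ _))// size_W /=.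
by rewrite (leq_trans (leq_add (leqnn _) sq))// mul2n -addnn -addnA subnKC.
Qed.

(** Now [W ^+ m * q] has degree exactly m + l: the derivative is a constant given by the leading
    coefficient, and [poly_intW] evaluates what remains. *)
Lemma legendre_norm l m : (m <= l)%N ->
  poly_int ((1 - 'X^2) ^+ m * dlegendre l m * dlegendre l m) =
  2 / (2 * l + 1)%:R * ((l + m)`!%:R / (l - m)`!%:R).
Proof.
move=> ml; rewrite legendre_parts derivn_top; last first.
  rewrite (leq_trans (size_polyMleq _ _))// size_W size_dlegendre//= addnS ltnS.
  by rewrite mul2n -addnn -addnA subnKC.
have -> : (W ^+ m * dlegendre l m)`_(m + l) = (dlegendre l m)`_(l - m).
  have d0 : dlegendre l m != 0 by rewrite -size_poly_gt0 size_dlegendre.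
  have := lead_coef_Mmonic (dlegendre l m) (monic_W m).
  rewrite !lead_coefE size_Mmonic ?monic_W// size_W size_dlegendre//= [_ * W ^+ m]mulrC => <-.
  by congr (_`_ _); move: ml; lia.
rewrite mulrC [W ^+ l * _]mulrC mul_polyC poly_intZ poly_intW coef_dlegendre//.
have -> : (-1) ^+ l * leg_cst l = leg_cst l * (-1) ^+ l by rewrite mulrC.
have sgn n : (-1) ^+ n * (-1) ^+ n = 1 :> R by rewrite -exprMn mulrNN mulr1 expr1n.
have l2 : (l <= 2 * l)%N by rewrite leq_pmull.
have ff n k : (k <= n)%N -> (n ^_ k)%:R = n`!%:R / (n - k)`!%:R :> R.
  by move=> kn; rewrite -(ffact_fact kn) natrM mulfK// pnatr_eq0 -lt0n fact_gt0.
rewrite !ff//.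
have -> : (2 * l - l = l)%N by rewrite mul2n -addnn addnK.
rewrite /leg_cst addnC factS natrM exprS mul2n -addnn exprD.
set e := (-1) ^+ l; have ee : e * e = 1 by exact: sgn.
have f0 n : n`!%:R != 0 :> R by rewrite pnatr_eq0 -lt0n fact_gt0.
have := f0 (l - m)%N; have := f0 l; have := f0 (l + l)%N; have := f0 (l + m)%N.
move: (l - m)`! (l`!) (l + l)`! (l + m)`! => a b c0 k k0 c1 b0 a0.
have t0 : 2 ^+ l != 0 :> R by rewrite expf_neq0.
move: (2 ^+ l) t0 => t t0; rewrite addn1; have := pnatr_eq0 R (l + l).+1.
move: (l + l).+1%:R => z /= z0.
rewrite [X in X = _](_ : _ = e * e * (2 / z * (k%:R / a%:R))); first by rewrite ee mul1r.
by field; rewrite z0 c1 b0 a0 t0.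
Qed.

End legendre_orthogonality.

(** * One-variable integrals and integrals of product functions *)

Section calculus.
Variable R : realType.
Local Notation leb := (@lebesgue_measure R).

Lemma derive_FTC (F f : R -> R) (a b : R) : a < b ->
  (forall x, is_derive x (1 : R) F (f x)) -> continuous f ->
  \int[leb]_(x in `[a, b]) f x = F b - F a.
Proof.
move=> ab dF cf.
have cF : continuous F.
  by move=> x; apply: differentiable_continuous; apply/derivable1_diffP; have [] := dF x.
rewrite /Rintegral (@continuous_FTC2 _ f F a b)//.
- by apply: continuous_subspaceT.
- split=> [x _||].
  + by have [] := dF x.
  + exact/cvg_at_right_filter/cF.
  + exact/cvg_at_left_filter/cF.
- by move=> x _; rewrite derive1E; have [_] := dF x.
Qed.

Lemma itv_integrable (f : R -> R) (a b : R) : continuous f ->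
  leb.-integrable `[a, b] (EFin \o f).
Proof.
move=> cf; apply: continuous_compact_integrable; first exact: segment_compact.
exact: continuous_subspaceT.
Qed.

Lemma is_derive_dilate (f f' : R -> R) (c x : R) :
  (forall t, is_derive t (1 : R) f (f' t)) ->
  is_derive x (1 : R) (fun t => f (c * t)) (c * f' (c * x)).
Proof.
move=> df; have dc : is_derive x (1 : R) (fun t : R => c * t) c.
  have := @is_deriveZ R R R id c x 1 1 (is_derive_id _ _).
  by rewrite -[c *: 1]/(c * 1) mulr1.
have h := @is_derive1_comp R f (fun t => c * t) x (f' (c * x)) c (df _) dc.
by rewrite mulrC.
Qed.

Lemma continuous_dilate (f : R -> R) (c : R) : continuous f ->
  continuous (fun t => f (c * t)).
Proof.
by move=> cf x; apply: continuous_comp; [exact: mulrl_continuous|exact: cf].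
Qed.

Lemma cos_sin_periodic k : cos (k.+1%:R * (2 * pi)) = 1 :> R /\ sin (k.+1%:R * (2 * pi)) = 0 :> R.
Proof.
have -> : k.+1%:R * (2 * pi) = 0 + pi *+ 2 *+ k.+1 :> R.
  by rewrite add0r -[in RHS]mulr_natl -[X in _ = _ * X]mulr_natl.
by rewrite (periodicn (@cosD2pi R)) (periodicn (@sinD2pi R)) cos0 sin0.
Qed.

Lemma pi2_gt0 : 0 < 2 * pi :> R.
Proof. by rewrite mulr_gt0// pi_gt0. Qed.

Lemma integral_cosn k : \int[leb]_(x in `[0, 2 * pi]) cos (k.+1%:R * x) = 0.
Proof.
have k0 : k.+1%:R != 0 :> R by rewrite pnatr_eq0.
have dF (x : R) : is_derive x (1 : R) (k.+1%:R^-1 \*: (fun t => sin (k.+1%:R * t)))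
    (cos (k.+1%:R * x)).
  have := is_derive_dilate k.+1%:R x (@is_derive_sin R).
  by move=> /(@is_deriveZ _ _ _ _ k.+1%:R^-1); rewrite -[_ *: _]/(_ * _) mulKf.
rewrite (derive_FTC pi2_gt0 dF); last exact/continuous_dilate/continuous_cos.
by rewrite /GRing.scale_fun /= !(cos_sin_periodic k).2 mulr0 sin0 subrr.
Qed.

Lemma integral_sinn k : \int[leb]_(x in `[0, 2 * pi]) sin (k.+1%:R * x) = 0.
Proof.
have k0 : k.+1%:R != 0 :> R by rewrite pnatr_eq0.
have dF (x : R) : is_derive x (1 : R) ((- k.+1%:R^-1) \*: (fun t => cos (k.+1%:R * t)))
    (sin (k.+1%:R * x)).
  have := is_derive_dilate k.+1%:R x (@is_derive_cos R).
  by move=> /(@is_deriveZ _ _ _ _ (- k.+1%:R^-1)); rewrite -[_ *: _]/(_ * _) !mulrN mulNr opprK mulKf.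
rewrite (derive_FTC pi2_gt0 dF); last exact/continuous_dilate/continuous_sin.
by rewrite /GRing.scale_fun /= !(cos_sin_periodic k).1 mulr0 cos0 subrr.
Qed.

Lemma integral_itv_cst (a b c : R) : a < b -> \int[leb]_(x in `[a, b]) c = c * (b - a).
Proof.
by move=> ab; rewrite Rintegral_cst//= lebesgue_measure_itv/= lte_fin ab.
Qed.

Lemma integral_sin_poly (p : {poly R}) :
  \int[leb]_(x in `[0, pi]) (sin x * p.[cos x]) = poly_int p.
Proof.
have dF (x : R) : is_derive x (1 : R) (- (horner (poly_primitive p) \o @cos R))
    (sin x * p.[cos x]).
  have := @is_derive1_comp R (horner (poly_primitive p)) (@cos R) x _ _
    (is_derive_poly _ _) (is_derive_cos _).
  by move=> /is_deriveN; rewrite poly_primitiveK mulrN opprK mulrC.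
rewrite (derive_FTC (pi_gt0 R) dF).
  rewrite -[_ pi]/(- (poly_primitive p).[cos pi]) -[(- _) 0]/(- (poly_primitive p).[cos 0]).
  by rewrite cospi cos0 opprK addrC.
move=> x; apply: cvgM; first exact: continuous_sin.
by apply: continuous_comp; [exact: continuous_cos|exact: continuous_horner].
Qed.

Lemma integral_prod (G K : R -> R) : leb.-integrable setT (EFin \o G) ->
  leb.-integrable setT (EFin \o K) ->
  (leb \x leb)%E.-integrable setT (fun a => (G a.1 * K a.2)%:E) /\
  \int[(leb \x leb)%E]_a (G a.1 * K a.2) = (\int[leb]_x G x) * (\int[leb]_x K x).
Proof.
move=> Gi Ki.
have mG : measurable_fun setT G by apply/measurable_EFinP; exact: measurable_int Gi.
have mK : measurable_fun setT K by apply/measurable_EFinP; exact: measurable_int Ki.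
have mGK : measurable_fun setT (fun a : measurableTypeR R * measurableTypeR R => (G a.1 * K a.2)%:E).
  apply/measurable_EFinP; apply: measurable_funM.
    exact: measurableT_comp mG measurable_fst.
  exact: measurableT_comp mK measurable_snd.
have GKi : (leb \x leb)%E.-integrable setT (fun a => (G a.1 * K a.2)%:E).
  apply/integrable12ltyP => //.
  have [_ Gf] := integrableP _ _ _ Gi; have [_ Kf] := integrableP _ _ _ Ki.
  under eq_integral => x _.
    under eq_integral => y _ do rewrite /= normrM EFinM.
    rewrite ge0_integralZl//=; last exact/measurable_EFinP/measurableT_comp.
    over.
  rewrite ge0_integralZr//=; [|exact/measurable_EFinP/measurableT_comp|exact: integral_ge0].
  apply: lte_mul_pinfty => //; first exact: integral_ge0.
  by rewrite ge0_fin_numE//; exact: integral_ge0.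
split => //.
rewrite /Rintegral -integral12_prod_meas1//.
have FE x : fubini_F leb (fun a => (G a.1 * K a.2)%:E) x =
    ((G x)%:E * \int[leb]_y (K y)%:E)%E.
  rewrite /fubini_F /=; under eq_integral do rewrite EFinM.
  by rewrite integralZl.
transitivity (fine (\int[leb]_x ((G x)%:E * \int[leb]_y (K y)%:E))%E).
  by congr fine; apply: eq_integral => x _; exact: FE.
have Kfin : (\int[leb]_y (K y)%:E)%E \is a fin_num.
  exact: (integrable_fin_num measurableT Ki).
rewrite -(fineK Kfin) integralZr// fineM//.
exact: (integrable_fin_num measurableT Gi).
Qed.

End calculus.

(** * The surface measure in spherical coordinates *)

Section sphere_integrals.
Variable R : realType.
Local Notation leb := (@lebesgue_measure R).
Local Notation sigma := (@surface_measure R).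
Local Open Scope complex_scope.

(** In spherical coordinates this is sin(s) e^(it), while [height] is cos(s). *)
Definition zeta (x : sphere R) : R[i] := x (inord 0) 0 +i* x (inord 1) 0.
Definition height (x : sphere R) : R := x (inord 2) 0.

Lemma ord3_cases (i : 'I_3) : [\/ i = inord 0, i = inord 1 | i = inord 2].
Proof.
case: i => [[|[|[|//]]] h]; [constructor 1|constructor 2|constructor 3];
  by apply: val_inj; rewrite /= inordK.
Qed.

Lemma sum_ord3 (V : nmodType) (F : 'I_3 -> V) :
  \sum_i F i = F (inord 0) + F (inord 1) + F (inord 2).
Proof.
rewrite !big_ord_recr big_ord0 /= add0r.
by congr (F _ + F _ + F _); apply: val_inj; rewrite /= inordK.
Qed.

Lemma sphere_eq (x : sphere R) :
  x (inord 0) 0 ^+ 2 + x (inord 1) 0 ^+ 2 + x (inord 2) 0 ^+ 2 = 1.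
Proof. by have /eqP := sphereP x; rewrite sum_ord3. Qed.

Lemma zeta_conj x : zeta x * (zeta x)^† = (1 - height x ^+ 2)%:C.
Proof.
rewrite mul_conj normc_sqr /=; congr (_%:C).
by rewrite /height -(sphere_eq x); ring.
Qed.

Lemma coord_le1 (x : sphere R) i : `|x i 0| <= 1.
Proof.
rewrite -(@expr_le1 _ 2)// real_normK ?num_real// -(eqP (sphereP x)) (bigD1 i)//= lerDl.
by apply: sumr_ge0 => j _; exact: sqr_ge0.
Qed.

Lemma measurable_coord i : measurable_fun setT (fun x : sphere R => x i 0).
Proof.
move=> _ A mA; rewrite setTI; apply: sub_sigma_algebra; exists i.
by exists A => //; rewrite setTI.
Qed.

Lemma bmeas_coord i : bmeas (fun x : sphere R => (x i 0)%:C).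
Proof.
apply: (@bmeas_real _ _ _ _ 1); [exact: measurable_coord|].
by move=> x; exact: coord_le1.
Qed.

Lemma zetaE x : zeta x = (x (inord 0) 0)%:C + 'i * (x (inord 1) 0)%:C.
Proof. exact: (complexE (zeta x)). Qed.

Lemma bmeas_zeta : bmeas zeta.
Proof.
rewrite (_ : zeta = fun x => (x (inord 0) 0)%:C + 'i * (x (inord 1) 0)%:C).
  by apply: bmeasD; [|apply: bmeasZ]; exact: bmeas_coord.
by apply/funext => x; exact: zetaE.
Qed.

Lemma bmeasX d (T : measurableType d) (u : T -> R[i]) n :
  bmeas u -> bmeas (fun x => u x ^+ n).
Proof.
move=> bu; elim: n => [|n ih]; first by under eq_fun do rewrite expr0; exact: bmeas_cst.
by under eq_fun do rewrite exprS; exact: bmeasM.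
Qed.

Lemma bmeas_horner (q : {poly R}) : bmeas (fun x => (q.[height x])%:C).
Proof.
elim/poly_ind: q => [|q c ih].
  by under eq_fun do rewrite horner0; exact: bmeas_cst.
under eq_fun do rewrite hornerMXaddC rmorphD rmorphM.
by apply: bmeasD; [apply: bmeasM => //; exact: bmeas_coord|exact: bmeas_cst].
Qed.

(** A family closed under products and conjugation, containing every spherical harmonic ([YlmE]),
    and whose integrals are explicit ([integral_mono]). *)
Definition mono a b (q : {poly R}) x : R[i] :=
  zeta x ^+ a * (zeta x)^† ^+ b * (q.[height x])%:C.

Lemma bmeas_mono a b q : bmeas (mono a b q).
Proof.
apply: bmeasM; last exact: bmeas_horner.
apply: bmeasM; first exact/bmeasX/bmeas_zeta.
exact/bmeasX/bmeasJ/bmeas_zeta.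
Qed.

(** The indicators of the angle box are absorbed in the density, so that the weight lives on the
    whole plane and splits as a product. *)
Let wgt (a : R * R) : R := (sin a.1 * \1_`[0, pi] a.1) * \1_`[0, 2 * pi] a.2.

Lemma indic_integrable (g : R -> R) (a b : R) : continuous g ->
  leb.-integrable setT (EFin \o (fun x => g x * \1_`[a, b] x)) /\
  \int[leb]_x (g x * \1_`[a, b] x) = \int[leb]_(x in `[a, b]) g x.
Proof.
move=> cg; have gi := @itv_integrable R g a b cg.
have E : EFin \o (fun x => g x * \1_`[a, b] x) = ((EFin \o g) \_ `[a, b]%classic).
  apply/funext => x /=; rewrite patchE indicE; case: ifP => _ /=; by rewrite ?mulr1 ?mulr0.
split; first by rewrite E; apply: (integrable_mkcond _ _).1 gi => //; exact: measurable_itv.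
by rewrite /Rintegral; congr fine; rewrite [RHS]integral_mkcond -E.
Qed.

Lemma wgt_integrable : (leb \x leb)%E.-integrable setT (EFin \o wgt).
Proof.
have [i1 _] := @indic_integrable (@sin R) 0 pi (@continuous_sin R).
have [i2 _] := @indic_integrable (cst 1) 0 (2 * pi) (@cst_continuous _ _ _).
have [i3 _] := integral_prod i1 i2.
by apply: eq_integrable i3 => // a _ /=; rewrite mul1r.
Qed.

Lemma wgt_ge0 a : 0 <= wgt a.
Proof.
rewrite /wgt mulr_ge0//.
rewrite indicE; have [|_] := boolP (a.1 \in `[0, pi]%classic); last by rewrite mulr0.
by rewrite inE /= in_itv /= => h; rewrite mulr1 sin_ge0_pi.
Qed.

Lemma surface_wgtE A : measurable A ->
  sigma A = (\int[leb \x leb]_(a in @sph_point R @^-1` A) (wgt a)%:E)%E.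
Proof.
move=> mA; rewrite /= /surface_measure.
rewrite integral_mkcondr; apply: eq_integral => a _; rewrite patchE.
rewrite /wgt !indicE /angles.
have -> : (a \in `[0%R, pi] `*` `[0%R, 2 * pi]) =
    (a.1 \in `[0%R, pi]%classic) && (a.2 \in `[0%R, 2 * pi]%classic).
  by apply/idP/andP; rewrite !inE.
case: (a.1 \in _); case: (a.2 \in _); rewrite /= ?(mulr1, mulr0)//.
Qed.

Lemma surface_integral (u : sphere R -> R[i]) : bmeas u ->
  cintegral sigma u = cintegral (leb \x leb)%E (fun a => (wgt a)%:C * u (sph_point a)).
Proof.
move=> bu.
apply: (cintegral_density wgt_integrable wgt_ge0 (@measurable_sph_point R)) => // A mA.
exact: surface_wgtE.
Qed.

Lemma surface_integral_split (u : sphere R -> R[i]) (G : R -> R) (K : R -> R[i]) :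
  bmeas u -> continuous G -> continuous (fun t => complex.Re (K t)) ->
  continuous (fun t => complex.Im (K t)) ->
  (forall s t, u (sph_point (s, t)) = (G s)%:C * K t) ->
  cintegral sigma u = (\int[leb]_(x in `[0, pi]) (sin x * G x))%:C *
    (\int[leb]_(x in `[0, 2 * pi]) complex.Re (K x) +i*
     \int[leb]_(x in `[0, 2 * pi]) complex.Im (K x)).
Proof.
move=> bu cG cK1 cK2 uE; rewrite surface_integral//.
have csG : continuous (fun x => sin x * G x).
  by move=> x; apply: cvgM; [exact: continuous_sin|exact: cG].
have [i1 e1] := @indic_integrable _ 0 pi csG.
have [i2 e2] := @indic_integrable _ 0 (2 * pi) cK1.
have [i3 e3] := @indic_integrable _ 0 (2 * pi) cK2.
have [_ E1] := integral_prod i1 i2.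
have [_ E2] := integral_prod i1 i3.
apply: complex_eq; rewrite ?cRe_realM ?cIm_realM /=.
  rewrite -e1 -e2 -E1; apply: eq_Rintegral => -[s t] _.
  by rewrite uE !cRe_realM /wgt /=; ring.
rewrite -e1 -e3 -E2; apply: eq_Rintegral => -[s t] _.
by rewrite uE !cIm_realM /wgt /=; ring.
Qed.

Definition cis (t : R) : R[i] := cos t +i* sin t.

Lemma cisX t n : cis t ^+ n = cos (n%:R * t) +i* sin (n%:R * t).
Proof.
elim: n => [|n ih]; first by rewrite expr0 mul0r cos0 sin0.
rewrite exprS ih -natr1 mulrDl mul1r; apply: complex_eq; rewrite ?cReM ?cImM /=.
  by rewrite cosD; ring.
by rewrite sinD; ring.
Qed.

Lemma cis_conj t : cis t * (cis t)^† = 1.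
Proof. by rewrite mul_conj normc_sqr /= cos2Dsin2. Qed.

Lemma zeta_sph_point s t : zeta (sph_point (s, t)) = (sin s)%:C * cis t.
Proof.
rewrite /zeta /= !mxE !inordK//=.
by apply: complex_eq; rewrite ?cRe_realM ?cIm_realM.
Qed.

Lemma height_sph_point s t : height (sph_point (s, t)) = cos s.
Proof. by rewrite /height /= !mxE inordK. Qed.

Lemma cis_powers a b t : cis t ^+ a * (cis t)^† ^+ b =
  if (b <= a)%N then cis t ^+ (a - b) else (cis t ^+ (b - a))^†.
Proof.
case: leqP => [ba|/ltnW ab].
  by rewrite -{1}(subnK ba) exprD -mulrA -exprMn cis_conj expr1n mulr1.
by rewrite -{1}(subnK ab) exprD mulrCA -exprMn cis_conj expr1n mulr1 rmorphXn.
Qed.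

Lemma integral_cis a b :
  (\int[leb]_(x in `[0, 2 * pi]) complex.Re (cis x ^+ a * (cis x)^† ^+ b) +i*
   \int[leb]_(x in `[0, 2 * pi]) complex.Im (cis x ^+ a * (cis x)^† ^+ b)) =
  if a == b then (2 * pi)%:C else 0.
Proof.
under eq_Rintegral do rewrite cis_powers.
under [X in _ +i* X]eq_Rintegral do rewrite cis_powers.
have int0 : \int[leb]_(x in `[0, 2 * pi]) (0 : R) = 0 by rewrite Rintegral_cst// mul0r.
case: (ltngtP a b) => ab.
- have [k ->] : exists k, (b - a = k.+1)%N.
    by exists (b - a).-1; rewrite prednK// subn_gt0.
  under eq_Rintegral do rewrite cReJ cisX /=.
  under [X in _ +i* X]eq_Rintegral do rewrite cImJ cisX /= -mulN1r.
  rewrite integral_cosn RintegralZl//= ?integral_sinn ?mulr0//.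
  exact/itv_integrable/continuous_dilate/continuous_sin.
- have [k ->] : exists k, (a - b = k.+1)%N.
    by exists (a - b).-1; rewrite prednK// subn_gt0.
  under eq_Rintegral do rewrite cisX /=.
  under [X in _ +i* X]eq_Rintegral do rewrite cisX /=.
  by rewrite integral_cosn integral_sinn.
- rewrite ab subnn.
  under eq_Rintegral do rewrite expr0 /=.
  under [X in _ +i* X]eq_Rintegral do rewrite expr0 /=.
  by rewrite int0 integral_itv_cst ?pi2_gt0// mul1r subr0.
Qed.

(** The longitude contributes the integral of e^(i(a-b)t), zero unless a = b. In that case sin^(2a)
    = (1 - cos^2)^a, and substituting the cosine turns the colatitude integral into a polynomial
    one. *)
Lemma integral_mono a b (q : {poly R}) : cintegral sigma (mono a b q) =
  if a == b then (2 * pi * poly_int ((1 - 'X^2) ^+ a * q))%:C else 0.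
Proof.
rewrite (@surface_integral_split _ (fun s => sin s ^+ (a + b) * q.[cos s])
    (fun t => cis t ^+ a * (cis t)^† ^+ b)).
- rewrite integral_cis; case: eqP => [<-|_]; last by rewrite mulr0.
  rewrite -integral_sin_poly mulrC [in RHS]rmorphM; congr (_ * _%:C).
  apply: eq_Rintegral => x _; congr (_ * _).
  rewrite hornerM horner_exp !(hornerD, hornerN, hornerC, hornerXn) -sin2cos2.
  by rewrite addnn -mul2n exprM.
- exact: bmeas_mono.
- move=> x; apply: cvgM; last first.
    by apply: continuous_comp; [exact: continuous_cos|exact: continuous_horner].
  apply: (continuous_comp (f := @sin R) (g := fun t => t ^+ (a + b))).
    exact: continuous_sin.
  exact: exprn_continuous.
- rewrite (_ : (fun t => _) = fun t =>
      if (b <= a)%N then cos ((a - b)%:R * t) else cos ((b - a)%:R * t)).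
    by case: (b <= a)%N; exact/continuous_dilate/continuous_cos.
  by apply/funext => t; rewrite cis_powers; case: ifP => _; rewrite ?cReJ cisX.
- rewrite (_ : (fun t => _) = fun t =>
      if (b <= a)%N then sin ((a - b)%:R * t) else - sin ((b - a)%:R * t)).
    case: (b <= a)%N; first exact/continuous_dilate/continuous_sin.
    by move=> x; apply: cvgN; exact/continuous_dilate/continuous_sin.
  by apply/funext => t; rewrite cis_powers; case: ifP => _; rewrite ?cImJ cisX.
- move=> s t; rewrite /mono zeta_sph_point height_sph_point conjcM conjc_real.
  by rewrite real_complexM real_complexX !exprMn exprD; ring.
Qed.

Lemma surface_lty : (sigma setT < +oo)%E.
Proof.
rewrite surface_wgtE// preimage_setT.
have := integrable_fin_num measurableT wgt_integrable.
by rewrite ge0_fin_numE//; apply: integral_ge0 => a _; rewrite lee_fin wgt_ge0.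
Qed.

Lemma surface_total : fine (sigma setT) = 4 * pi.
Proof.
have := integral_mono 0 0 1; rewrite /mono eqxx expr0 mul1r.
under eq_fun do rewrite !expr0 !mul1r hornerC.
rewrite cintegral_real Rintegral_cst// mul1r => /complexI ->.
have -> : (1 : {poly R}) = ('X)^`() by rewrite derivX.
by rewrite poly_int_deriv !hornerX; ring.
Qed.

End sphere_integrals.

(** * Spherical harmonics: orthonormality and the algebra they span *)

Section harmonics_basis.
Variable R : realType.
Local Notation sigma := (@surface_measure R).
Local Open Scope complex_scope.

Definition harm_cst (l m : nat) : R :=
  Num.sqrt ((2 * l + 1)%:R / (4 * pi) * ((l - m)`!%:R / (l + m)`!%:R)).

Lemma harm_cst_gt0 l m : 0 < harm_cst l m.
Proof.
rewrite sqrtr_gt0 mulr_gt0// divr_gt0 ?ltr0n ?fact_gt0// ?addn1//.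
by rewrite mulr_gt0 ?pi_gt0.
Qed.

Lemma harm_cst_sqr l m : harm_cst l m ^+ 2 =
  (2 * l + 1)%:R / (4 * pi) * ((l - m)`!%:R / (l + m)`!%:R).
Proof.
rewrite sqr_sqrtr// mulr_ge0// divr_ge0// ?ler0n// mulr_ge0// pi_ge0//.
Qed.

(* The zonal factor of the harmonic stored in position k, of order k - l. *)
Definition Ylm_poly l k : {poly R} :=
  let m := ((k - l) + (l - k))%N in
  ((if (l <= k)%N then (-1) ^+ m else 1) * harm_cst l m) *: dlegendre R l m.

(** Truncated subtraction treats both signs of the order k - l at once: one of [k - l] and [l - k]
    is 0, and their sum is the absolute value of the order. For negative orders the two factors
    (-1)^m cancel. *)
Lemma YlmE l (k : 'I_((2 * l).+1)) :
  Ylm k = mono (k - l) (l - k) (Ylm_poly l k) :> (sphere R -> R[i]).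
Proof.
apply/funext => x; rewrite /Ylm /mono /Ylm_poly.
have nnegE m : sph_harm_nneg l m x =
    zeta x ^+ m * (((-1) ^+ m * harm_cst l m) *: dlegendre R l m).[height x]%:C.
  by rewrite /sph_harm_nneg mulrC hornerZ.
case: leqP => lk.
  rewrite subzn//= nnegE (_ : (l - k = 0)%N) ?addn0 ?expr0 ?mulr1//.
  by apply/eqP; rewrite subn_eq0.
have -> : k%:Z - l%:Z = Negz (l - k).-1.
  by rewrite NegzE prednK ?subn_gt0// -subzn ?(ltnW lk)// opprB.
rewrite /sph_harm nnegE prednK ?subn_gt0// conjE conjcM conjcX conjc_real.
have -> : (k - l = 0)%N by apply/eqP; rewrite subn_eq0 ltnW.
rewrite expr0 mul1r add0n mulrCA; congr (_ * _).
rewrite !hornerZ -mulrA rmorphM mulrA rmorphXn rmorphN1 /=.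
by rewrite -exprMn mulrNN mulr1 expr1n !mul1r.
Qed.

Lemma bmeas_Ylm l (k : 'I_((2 * l).+1)) : bmeas (@Ylm R l k).
Proof. by rewrite YlmE; exact: bmeas_mono. Qed.

Lemma mono_conj a b (q : {poly R}) x : (mono a b q x)^† = mono b a q x.
Proof.
by rewrite /mono !conjcM !conjcX conjc_real conjcK [_ ^+ a * _]mulrC.
Qed.

Lemma monoM a b a' b' (q q' : {poly R}) x :
  mono a b q x * mono a' b' q' x = mono (a + a') (b + b') (q * q') x.
Proof. by rewrite /mono !exprD hornerM real_complexM; ring. Qed.

Lemma order_le l (k : 'I_((2 * l).+1)) : ((k - l) + (l - k) <= l)%N.
Proof. have := ltn_ord k; lia. Qed.

(** The longitude separates different orders. For a common order m, Legendre orthogonality separates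
    the degrees, and [harm_cst] is the inverse of the remaining norm. *)
Theorem Ylm_orthonormal l l' (k : 'I_((2 * l).+1)) (k' : 'I_((2 * l').+1)) :
  cintegral sigma (fun x => Ylm k x * (Ylm k' x)^†) =
  ((l == l') && (k == k' :> nat))%:R.
Proof.
rewrite !YlmE; under eq_fun do rewrite mono_conj monoM.
rewrite integral_mono; case: eqP => [h|h]; last first.
  case: eqP => // ll'; case: eqP => // kk'; exfalso; apply: h; subst l'.
  by rewrite kk' addnC.
have ml := order_le k; have ml' := order_le k'.
have mm' : ((k' - l') + (l' - k') = (k - l) + (l - k))%N by move: h; lia.
have -> : (k - l + (l' - k') = (k - l) + (l - k))%N by move: h; lia.
rewrite /Ylm_poly mm'.
move: ml ml'; rewrite mm'; set m := ((k - l) + (l - k))%N => ml ml'.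
set e := _ * harm_cst l m; set e' := _ * harm_cst l' m.
have -> : (1 - 'X^2) ^+ m * (e *: dlegendre R l m * (e' *: dlegendre R l' m)) =
    (e * e') *: ((1 - 'X^2) ^+ m * dlegendre R l m * dlegendre R l' m).
  by rewrite -!mul_polyC (polyCM e e'); ring.
rewrite poly_intZ; case: (ltngtP l l') => ll' /=.
- rewrite [X in poly_int X]mulrAC legendre_orthogonal ?mulr0// size_dlegendre//.
  by move: ll' ml; lia.
- rewrite legendre_orthogonal ?mulr0// size_dlegendre//.
  by move: ll' ml'; lia.
- have kk' : k = k' :> nat by move: h ll'; rewrite /m; lia.
  rewrite kk' eqxx; subst l'; rewrite legendre_norm//.
  have -> : e * e' = harm_cst l m ^+ 2.
    rewrite /e /e' kk'; case: ifP => _; last by rewrite !mul1r.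
    by rewrite mulrACA -exprMn mulrNN mulr1 expr1n mul1r.
  rewrite harm_cst_sqr; congr (_%:C).
  have f0 n : n`!%:R != 0 :> R by rewrite pnatr_eq0 -lt0n fact_gt0.
  have pi0 := pi_gt0 R; have := f0 (l - m)%N; have := f0 (l + m)%N.
  have : (2 * l + 1)%:R != 0 :> R by rewrite addn1.
  move: (2 * l + 1)%:R ((l - m)`!%:R) ((l + m)`!%:R) => u v w u0 w0 v0.
  move: (pi : R) pi0 => p p0; field; rewrite u0 v0 w0 gt_eqF//.
Qed.

Definition is_sph_harm (u : sphere R -> R[i]) := exists l, exists k, u = @Ylm R l k.

(* Polynomial functions on the sphere. *)
Definition spoly := lin is_sph_harm.

Lemma spoly_cast u v : spoly u -> v =1 u -> spoly v.
Proof. by move=> + /funext ->. Qed.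

(** If q has degree d, the harmonic of degree a + b + d and order a - b is [mono a b] of a
    polynomial of degree exactly d. Subtracting a multiple of it lowers the degree of q. *)
Lemma spoly_mono0 a b (q : {poly R}) : (a = 0 \/ b = 0)%N -> spoly (mono a b q).
Proof.
move=> ab0; have [n] := ubnP (size q); elim: n q => // n ih q; rewrite ltnS => qn.
have [->|q0] := eqVneq q 0.
  rewrite (_ : mono a b 0 = fun=> 0); first exact: lin0.
  by apply/funext => x; rewrite /mono horner0 mulr0.
pose d := (size q).-1; pose l := (a + b + d)%N; pose m := (a + b)%N.
have ml : (m <= l)%N by rewrite leq_addr.
(* Position l + a - b stores the order a - b, of absolute value a + b since a or b is 0. *)
have kl : (l + a - b < (2 * l).+1)%N by rewrite /l; lia.
pose k := Ordinal kl.
have mE : ((k - l) + (l - k) = m)%N by rewrite /= /m /l; case: ab0 => ->; lia.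
have lmE : (l - m = d)%N by rewrite addKn.
have yE : (@Ylm R l k) = mono a b (Ylm_poly l k).
  rewrite YlmE; congr (mono _ _ _); rewrite /= /l; case: ab0 => ->; lia.
have [e e0 eE] : exists2 e, e != 0 & Ylm_poly l k = e *: dlegendre R l m.
  rewrite /Ylm_poly mE; eexists; last by [].
  rewrite mulf_neq0//; last by rewrite gt_eqF// harm_cst_gt0.
  by case: ifP => _; rewrite ?oner_eq0// expf_neq0// oppr_eq0 oner_eq0.
pose y := Ylm_poly l k; have sy : size y = d.+1.
  by rewrite /y eE size_scale// size_dlegendre// lmE.
have sq : size q = d.+1 by rewrite prednK// size_poly_gt0.
pose c := lead_coef q / lead_coef y.
have ly0 : lead_coef y != 0 by rewrite lead_coef_eq0 -size_poly_eq0 sy.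
have : spoly (fun x => c%:C * mono a b y x + mono a b (q - c *: y) x).
  apply: linD.
    by apply/linZ/lin_gen; exists l, k; rewrite yE.
  apply: ih; apply: leq_trans qn; rewrite sq ltnS.
  apply/leq_sizeP => j dj; rewrite coefB coefZ.
  case: (ltngtP d j) dj => // [dj _|<- _].
    by rewrite !nth_default ?mulr0 ?subr0// ?sy ?sq.
  have -> : q`_d = lead_coef q by rewrite lead_coefE sq.
  have -> : y`_d = lead_coef y by rewrite lead_coefE sy.
  by rewrite /c divfK// subrr.
move/spoly_cast; apply => x.
have hh (p r : {poly R}) (t z : R) : ((p - t *: r).[z])%:C = p.[z]%:C - t%:C * r.[z]%:C.
  by rewrite hornerD hornerN hornerZ rmorphB rmorphM.
by rewrite /mono hh; ring.
Qed.

(** On the sphere [zeta] times its conjugate is 1 - [height]^2, so both exponents can be lowered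
    together until one is 0. *)
Lemma spoly_mono a b (q : {poly R}) : spoly (mono a b q).
Proof.
elim: a b q => [|a ih] [|b] q; [|by apply: spoly_mono0; right + left..|].
  by apply: spoly_mono0; left.
apply: spoly_cast (ih b ((1 - 'X^2) * q)) _ => x.
have hh (z : R) : (((1 - 'X^2) * q).[z])%:C = (1 - z ^+ 2)%:C * q.[z]%:C.
  by rewrite hornerM hornerD hornerN hornerXn -[1]/(1%:P) hornerC rmorphM.
by rewrite /mono hh -zeta_conj !exprS; ring.
Qed.

Lemma spolyM u v : spoly u -> spoly v -> spoly (fun x => u x * v x).
Proof.
apply: lin_mul => _ _ [l [k ->]] [l' [k' ->]].
rewrite !YlmE; under eq_fun do rewrite monoM.
exact: spoly_mono.
Qed.

Lemma spolyJ u : spoly u -> spoly (fun x => (u x)^†).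
Proof.
elim=> [|c _ v [l [k ->]] _ ih].
  by apply: spoly_cast (lin0 _) _ => x; rewrite conjc0.
under eq_fun do rewrite conjcD conjcM.
apply: linD => //; apply: linZ; rewrite YlmE.
under eq_fun do rewrite mono_conj; exact: spoly_mono.
Qed.

Lemma spoly_cst c : spoly (fun=> c).
Proof.
apply: spoly_cast (linZ c (spoly_mono 0 0 1)) _ => x.
by rewrite /mono !expr0 hornerC !mulr1.
Qed.

Lemma spolyX u n : spoly u -> spoly (fun x => u x ^+ n).
Proof.
move=> su; elim: n => [|n ih]; first by under eq_fun do rewrite expr0; exact: spoly_cst.
by under eq_fun do rewrite exprS; exact: spolyM.
Qed.

Lemma spoly_zeta : spoly (@zeta R).
Proof.
apply: spoly_cast (spoly_mono 1 0 1) _ => x.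
by rewrite /mono expr1 expr0 hornerC !mulr1.
Qed.

Lemma spoly_coord i : spoly (fun x => (x i 0)%:C).
Proof.
case: (ord3_cases i) => ->.
- apply: spoly_cast (linZ 2^-1 (linD spoly_zeta (spolyJ spoly_zeta))) _ => x.
  by rewrite mulrC -ReJ_add.
- apply: spoly_cast (linZ ('i / 2) (linB (spolyJ spoly_zeta) spoly_zeta)) _ => x.
  by rewrite -[x _ _]/(complex.Im (zeta x)) ImJ_sub -mulrA mulrC [2^-1 * _]mulrC.
- apply: spoly_cast (spoly_mono 0 0 'X) _ => x.
  by rewrite /mono !expr0 hornerX !mul1r.
Qed.

Lemma spoly_rot (g : SO3 R) u : spoly u -> spoly (fun x => u (rot_act g x)).
Proof.
have rc i : spoly (fun x => (rot_act g x i 0)%:C).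
  apply: (@spoly_cast (fun x => \sum_j (g i j)%:C * (x j 0)%:C)).
    by apply: lin_sum => j; exact/linZ/spoly_coord.
  by move=> x; rewrite /= mxE rmorph_sum; apply: eq_bigr => j _; rewrite rmorphM.
have rz : spoly (fun x => zeta (rot_act g x)).
  under eq_fun do rewrite zetaE; exact: linD (rc _) (linZ 'i (rc _)).
elim=> [|c _ v [l [k ->]] _ ih]; first exact: lin0.
apply: linD => //; apply: linZ; rewrite YlmE /mono.
apply: spolyM.
  by apply: spolyM; apply: spolyX => //; exact: spolyJ.
elim/poly_ind: (Ylm_poly l k) => [|q e ihq].
  by under eq_fun do rewrite horner0; exact: lin0.
under eq_fun do rewrite hornerMXaddC rmorphD rmorphM /=.
exact: linD (spolyM ihq (rc (inord 2))) (spoly_cst _).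
Qed.

Lemma bmeas_spoly u : spoly u -> bmeas u.
Proof. by apply: bmeas_lin => _ [l [k ->]]; exact: bmeas_Ylm. Qed.

End harmonics_basis.

(** * Rotations acting on polynomial functions; transitivity on the sphere *)

Section rotation_action.
Variable R : realType.
Local Notation sigma := (@surface_measure R).
Local Open Scope complex_scope.

Lemma measurable_rot_entry i j : measurable_fun setT (fun g : SO3 R => g i j).
Proof.
move=> _ A mA; rewrite setTI; apply: sub_sigma_algebra; exists i, j.
by exists A => //; rewrite setTI.
Qed.

Lemma rot_entry_le1 (g : SO3 R) i j : `|g i j| <= 1.
Proof.
have /andP[/eqP/matrixP/(_ j j) + _] := rotP g.
rewrite !mxE eqxx mulr1n (bigD1 i)//= mxE => h.
rewrite -(@expr_le1 _ 2)// real_normK ?num_real// -h expr2 lerDl.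
by apply: sumr_ge0 => k _; rewrite mxE -expr2 sqr_ge0.
Qed.

Lemma bmeas_rot_entry i j : bmeas (fun g : SO3 R => (g i j)%:C).
Proof.
by apply: (@bmeas_real _ _ _ _ 1); [exact: measurable_rot_entry|move=> g; exact: rot_entry_le1].
Qed.

(** For polynomial u, u(g x) is a finite sum of such products ([tensor_rot]). Expectations of u(eps
    X) thus reduce to products of expectations in [eps] and [X], without any joint law on the
    product space. *)
Definition tensor (w : SO3 R * sphere R -> R[i]) := exists a, exists b,
  [/\ bmeas a, bmeas b & w = fun p => a p.1 * b p.2].

Lemma tensorM w w' : lin tensor w -> lin tensor w' ->
  lin tensor (fun p => w p * w' p).
Proof.
apply: lin_mul => _ _ [a [b [ba bb ->]]] [a' [b' [ba' bb' ->]]]; apply: lin_gen.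
exists (fun g => a g * a' g), (fun x => b x * b' x); split; [exact: bmeasM|exact: bmeasM|].
by apply/funext => p; ring.
Qed.

Lemma tensorJ w : lin tensor w -> lin tensor (fun p => (w p)^†).
Proof.
elim=> [|c _ v [a [b [ba bb ->]]] _ ih].
  by under eq_fun do rewrite conjc0; exact: lin0.
under eq_fun do rewrite conjcD !conjcM.
apply: linD => //; apply/linZ/lin_gen.
exists (fun g => (a g)^†), (fun x => (b x)^†).
by split => //; exact: bmeasJ.
Qed.

Lemma tensor_cst c : lin tensor (fun=> c).
Proof.
apply: lin_gen; exists (fun=> c), (fun=> 1); split; [exact: bmeas_cst|exact: bmeas_cst|].
by apply/funext => p; rewrite mulr1.
Qed.

Lemma tensorX w n : lin tensor w -> lin tensor (fun p => w p ^+ n).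
Proof.
move=> sw; elim: n => [|n ih].
  by under eq_fun do rewrite expr0; exact: tensor_cst.
by under eq_fun do rewrite exprS; exact: tensorM.
Qed.

Lemma tensor_rot u : spoly u ->
  lin tensor (fun p => u (rot_act p.1 p.2)).
Proof.
have rc i : lin tensor (fun p => (rot_act p.1 p.2 i 0)%:C).
  rewrite (_ : (fun _ => _) = fun p : SO3 R * sphere R => \sum_j (p.1 i j)%:C * (p.2 j 0)%:C).
    apply: lin_sum => j; apply: lin_gen.
    exists (fun g : SO3 R => (g i j)%:C), (fun x : sphere R => (x j 0)%:C).
    by split => //; [exact: bmeas_rot_entry|exact: bmeas_coord].
  apply/funext => p; rewrite /= mxE rmorph_sum; apply: eq_bigr => j _.
  by rewrite rmorphM.
have rz : lin tensor (fun p => zeta (rot_act p.1 p.2)).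
  under eq_fun do rewrite zetaE; exact: linD (rc _) (linZ 'i (rc _)).
elim=> [|c _ v [l [k ->]] _ ih]; first exact: lin0.
apply: linD => //; apply: linZ; rewrite YlmE /mono.
apply: tensorM.
  apply: tensorM; apply: tensorX; first exact: rz.
  exact: tensorJ rz.
elim/poly_ind: (Ylm_poly R l k) => [|q e ihq].
  by under eq_fun do rewrite horner0; exact: lin0.
under eq_fun do rewrite hornerMXaddC rmorphD rmorphM /=.
exact: linD (tensorM ihq (rc (inord 2))) (tensor_cst _).
Qed.

Lemma bmeas_tensor_integral w : lin tensor w ->
  (forall g, bmeas (fun x => w (g, x))) /\
  bmeas (fun g => cintegral sigma (fun x => w (g, x))).
Proof.
elim=> [|c _ v [a [b [ba bb ->]]] _ [ih1 ih2]].
  split => [g|]; first exact: bmeas_cst.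
  rewrite (_ : (fun _ => _) = fun=> 0); first exact: bmeas_cst.
  apply/funext => g; rewrite cintegral_cst mul0r//.
split => [g|].
  exact: bmeasD (bmeasZ c (bmeasZ (a g) bb)) (ih1 g).
rewrite (_ : (fun g => _) = fun g =>
    c * (cintegral sigma b * a g) + cintegral sigma (fun x => v (g, x))).
  by apply: bmeasD => //; apply: bmeasZ; exact: bmeasZ.
apply/funext => g; have fin := surface_lty R.
have bab := bmeasZ (a g) bb.
transitivity (cintegral sigma (fun x => c * (a g * b x) + v (g, x))) => //.
by rewrite (cintegralD fin (bmeasZ c bab) (ih1 g)) !cintegralZ// [a g * _]mulrC.
Qed.

Lemma det3 (A : 'M[R]_3) : \det A =
  A (inord 0) (inord 0) * (A (inord 1) (inord 1) * A (inord 2) (inord 2)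
                         - A (inord 1) (inord 2) * A (inord 2) (inord 1))
  - A (inord 0) (inord 1) * (A (inord 1) (inord 0) * A (inord 2) (inord 2)
                         - A (inord 1) (inord 2) * A (inord 2) (inord 0))
  + A (inord 0) (inord 2) * (A (inord 1) (inord 0) * A (inord 2) (inord 1)
                         - A (inord 1) (inord 1) * A (inord 2) (inord 0)).
Proof.
pose M (i j : nat) := A (inord i) (inord j).
have AE (i j : 'I_3) : A i j = M i j by rewrite /M !inord_val.
rewrite (expand_det_row _ ord0) !big_ord_recl big_ord0 /cofactor.
rewrite !(expand_det_row _ ord0) !big_ord_recl !big_ord0 /cofactor !det_mx11 !mxE !AE /=.
rewrite /bump /= !(inordK (n' := 2))// ?(addn0, add0n) -[(1 + 1)%N]/2%N.
by move: M AE => M _; rewrite ?(expr0, expr1) sqrrN expr1n; ring.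
Qed.

Definition north : sphere R := sph_point (0, 0).

Lemma northE i : north i 0 = (i == inord 2)%:R.
Proof.
by case: (ord3_cases i) => ->; rewrite /north /= mxE -val_eqE /= !inordK//= ?sin0 ?cos0 ?mul0r.
Qed.

Lemma sphere_ext (x y : sphere R) : (forall i, x i 0 = y i 0) -> x = y.
Proof. by move=> xy; apply/val_inj/matrixP => i j; rewrite ord1; exact: xy. Qed.

Lemma rot_north (g : SO3 R) (x : sphere R) : (forall i, g i (inord 2) = x i 0) ->
  rot_act g north = x.
Proof.
move=> gx; apply: sphere_ext => i; rewrite /= mxE (bigD1 (inord 2))//= northE eqxx mulr1.
rewrite big1 ?addr0// => j j2; by rewrite northE (negbTE j2) mulr0.
Qed.

(* The rotation by [pi] about [x + north] exchanges [north] and [x]. *)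
Lemma rot_transitive (x : sphere R) : exists g, rot_act g north = x.
Proof.
have := sphere_eq x.
set a := x (inord 0) 0; set b := x (inord 1) 0; set c := x (inord 2) 0 => abc.
have mk (F : nat -> nat -> R) (A := \matrix_(i < 3, j < 3) F i j) :
    (forall i j, (i < 3)%N -> (j < 3)%N ->
       F 0%N i * F 0%N j + F 1%N i * F 1%N j + F 2%N i * F 2%N j = (i == j)%:R) ->
    F 0 0 * (F 1 1 * F 2 2 - F 1 2 * F 2 1) - F 0 1 * (F 1 0 * F 2 2 - F 1 2 * F 2 0)
      + F 0 2 * (F 1 0 * F 2 1 - F 1 1 * F 2 0) = 1 :> R ->
    F 0%N 2%N = a -> F 1%N 2%N = b -> F 2%N 2%N = c -> exists g, rot_act g north = x.
  move=> Fo Fd Fa Fb Fc.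
  have h : (A^T *m A == 1%:M) && (\det A == 1).
    apply/andP; split; last by rewrite det3 !mxE !inordK// Fd.
    apply/eqP/matrixP => i j; rewrite !mxE sum_ord3 !mxE !inordK// Fo//.
  exists (Rotation h); apply: rot_north => i; rewrite /= mxE inordK//.
  by case: (ord3_cases i) => ->; rewrite inordK.
(* At the south pole the axis x + north degenerates to 0; diag(1, -1, -1) is used instead. *)
have [c1|c1] := eqVneq c (-1).
  have [a0 b0] : a = 0 /\ b = 0.
    have : a ^+ 2 + b ^+ 2 == 0 by apply/eqP; move: abc; rewrite c1; lra.
    by rewrite paddr_eq0 ?sqr_ge0// !sqrf_eq0 => /andP[/eqP -> /eqP ->].
  apply: (mk (fun i j => if i == j then if i == 0%N then 1 else -1 else 0)) => //=.
  - by move=> [|[|[|//]]] [|[|[|//]]] _ _ /=; ring.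
  - by ring.
have t0 : 1 + c != 0 by rewrite addrC addr_eq0.
pose t := 1 + c.
(* w is the axis x + north scaled by 1 / t, so that t |w|^2 = 2 and the half-turn about it is t w
   w^T - 1. *)
pose w (i : nat) : R := (if i == 0%N then a else if i == 1%N then b else t) / t.
have w2 : w 2 = 1 by rewrite /w /= divff.
have ww : t * (w 0 * w 0 + w 1 * w 1 + w 2 * w 2) = 2.
  rewrite /w /= -[2]/(2%:R).
  have -> : t * (a / t * (a / t) + b / t * (b / t) + t / t * (t / t)) =
    (a ^+ 2 + b ^+ 2 + t ^+ 2) / t by field.
  have -> : a ^+ 2 + b ^+ 2 + t ^+ 2 = 2 * t by rewrite /t; move: abc; lra.
  by rewrite mulfK.
apply: (mk (fun i j => t * w i * w j - (i == j)%:R)).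
- have key i j x0 y0 x1 y1 x2 y2 : x0 * w 0 + x1 * w 1 + x2 * w 2 = w i ->
      y0 * w 0 + y1 * w 1 + y2 * w 2 = w j ->
      (t * w 0 * w i - x0) * (t * w 0 * w j - y0) + (t * w 1 * w i - x1) * (t * w 1 * w j - y1)
      + (t * w 2 * w i - x2) * (t * w 2 * w j - y2) = x0 * y0 + x1 * y1 + x2 * y2.
    move=> xi yj.
    transitivity (t * (w 0 * w 0 + w 1 * w 1 + w 2 * w 2) * (t * w i * w j)
      - t * w i * (y0 * w 0 + y1 * w 1 + y2 * w 2)
      - t * w j * (x0 * w 0 + x1 * w 1 + x2 * w 2) + (x0 * y0 + x1 * y1 + x2 * y2)).
      by ring.
    by rewrite ww xi yj; ring.
  move=> [|[|[|//]]] [|[|[|//]]] _ _ /=; rewrite key ?(mulr1n, mulr0n); ring.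
- transitivity (t * (w 0 * w 0 + w 1 * w 1 + w 2 * w 2) - 1); last by rewrite ww; ring.
  by rewrite /= ?(mulr1n, mulr0n); ring.
- by rewrite w2 /= mulr1 subr0 /w /= mulrC divfK.
- by rewrite w2 /= mulr1 subr0 /w /= mulrC divfK.
- by rewrite w2 /= !mulr1 /t addrC addKr.
Qed.

End rotation_action.

(** * Unitarity of the rotational harmonics and the addition theorem *)

Section rotational_harmonics.
Variables (R : realType) (D : forall l, SO3 R -> 'M[R[i]]_((2 * l).+1)).
Hypothesis D_rot : is_rotational_harmonics D.
Local Notation sigma := (@surface_measure R).
Local Open Scope complex_scope.

Let sigma_fin := surface_lty R.

Lemma Ylm_rot_conj l (m : 'I_((2 * l).+1)) g x :
  (Ylm m (rot_act g x))^† = \sum_n D l g m n * (Ylm n x)^†.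
Proof. exact: D_rot. Qed.

Lemma Ylm_rot l (m : 'I_((2 * l).+1)) g x :
  Ylm m (rot_act g x) = \sum_n (D l g m n)^† * Ylm n x.
Proof.
rewrite -[LHS]conjcK Ylm_rot_conj conjc_sum; apply: eq_bigr => n _.
by rewrite conjcM conjcK.
Qed.

Lemma Y00_cst : exists2 c : R[i], c != 0 & forall x, @Ylm R 0 ord0 x = c.
Proof.
have [e eE] : exists e : R, Ylm_poly R 0 0 = e%:P.
  exists (Ylm_poly R 0 0)`_0; apply: size1_polyC.
  by apply: leq_trans (size_scale_leq _ _) _; rewrite size_dlegendre.
have YE x : @Ylm R 0 ord0 x = e%:C.
  by rewrite YlmE /mono !expr0 !mul1r eE hornerC.
exists e%:C => //; apply/eqP => e0.
have := @Ylm_orthonormal R 0 0 ord0 ord0; rewrite !eqxx /=.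
under eq_fun do rewrite YE e0 mul0r.
by rewrite cintegral_cst mul0r => /eqP; rewrite eq_sym oner_eq0.
Qed.

Lemma integral_Ylm_gt0 l (k : 'I_((2 * l).+1)) : (0 < l)%N ->
  cintegral sigma (Ylm k) = 0.
Proof.
move=> l0; have [c c0 cE] := Y00_cst.
have := @Ylm_orthonormal R l 0 k ord0; rewrite (gtn_eqF l0) andFb.
under eq_fun do rewrite cE.
rewrite cintegralZr//; last exact: bmeas_Ylm.
by move/eqP; rewrite mulf_eq0 conjc_eq0 (negbTE c0) orbF => /eqP.
Qed.

(** Rotation invariance is read off the harmonics: rotating one of positive degree gives a
    combination of harmonics of the same degree, all of integral zero, and degree 0 is constant. *)
Lemma integral_rot g u : spoly u ->
  cintegral sigma (fun x => u (rot_act g x)) = cintegral sigma u.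
Proof.
elim=> [//|c _ v [l [k ->]] sv ih].
have bY := @bmeas_Ylm R l k; have bv := bmeas_spoly sv.
have bYg : bmeas (fun x => Ylm k (rot_act g x)).
  by apply/bmeas_spoly/spoly_rot/lin_gen; exists l, k.
rewrite cintegralD//; last 2 first.
- exact: bmeasZ.
- exact/bmeas_spoly/spoly_rot.
rewrite [in RHS]cintegralD//; last exact: bmeasZ.
rewrite ih (cintegralZ sigma_fin c bYg) (cintegralZ sigma_fin c bY).
suff -> : cintegral sigma (fun x => Ylm k (rot_act g x)) = cintegral sigma (Ylm k) by [].
case: l k bY bYg => [|l] k bY bYg.
  have [e _ eE] := Y00_cst.
  by have -> : k = ord0 by [apply: val_inj; case: k {bY bYg} => -[]]; 
     congr cintegral; apply/funext => x; rewrite !eE.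
rewrite integral_Ylm_gt0//; under eq_fun do rewrite Ylm_rot.
rewrite cintegral_sum//; last by move=> i; apply/bmeasZ/bmeas_Ylm.
rewrite big1// => i _; rewrite cintegralZ ?integral_Ylm_gt0 ?mulr0//.
exact: bmeas_Ylm.
Qed.

(** Orthonormality extracts the matrix entries. The formula shows that D is bounded and measurable
    in g ([D_bmeas]) and serves to compute the products in [D_unitary]. *)
Lemma integral_Ylm_rot l (m m' : 'I_((2 * l).+1)) g :
  D l g m m' = cintegral sigma (fun x => (Ylm m (rot_act g x))^† * Ylm m' x).
Proof.
under eq_fun do rewrite Ylm_rot_conj mulr_suml.
rewrite cintegral_sum//; last first.
  move=> i; apply: bmeasM; last exact: bmeas_Ylm.
  exact/bmeasZ/bmeasJ/bmeas_Ylm.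
rewrite (bigD1 m')//= big1 => [|i im].
  under eq_fun do rewrite -mulrA [_^† * _]mulrC.
  rewrite cintegralZ//; last exact/bmeasM/bmeasJ/bmeas_Ylm/bmeas_Ylm.
  by rewrite Ylm_orthonormal !eqxx mulr1 addr0.
under eq_fun do rewrite -mulrA [_^† * _]mulrC.
rewrite cintegralZ//; last exact/bmeasM/bmeasJ/bmeas_Ylm/bmeas_Ylm.
rewrite Ylm_orthonormal eqxx /= [m' == i :> nat]eq_sym.
by rewrite [(_ == _ :> nat)](negbTE im) mulr0.
Qed.

Lemma D_bmeas l (m m' : 'I_((2 * l).+1)) : bmeas (fun g => D l g m m').
Proof.
under eq_fun do rewrite integral_Ylm_rot.
pose w (p : SO3 R * sphere R) := (Ylm m (rot_act p.1 p.2))^† * Ylm m' p.2.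
have [|_ //] := @bmeas_tensor_integral R w.
apply: tensorM.
  apply/tensorJ/tensor_rot/lin_gen; by exists l, m.
apply: lin_gen; exists (fun=> 1), (Ylm m'); split; [exact: bmeas_cst|exact: bmeas_Ylm|].
by apply/funext => p; rewrite mul1r.
Qed.

(** The inner product of two harmonics is unchanged when both are rotated; expanding one of them
    yields the rows of D. *)
Lemma D_unitary l g (m m' : 'I_((2 * l).+1)) :
  \sum_n D l g m n * (D l g m' n)^† = (m == m')%:R.
Proof.
have := @Ylm_orthonormal R l l m' m; rewrite eqxx /= [m' == m :> nat]eq_sym.
rewrite -[(_ == _ :> nat)]/(m == m') => <-.
rewrite -(@integral_rot g); last first.
  by apply: spolyM; [|apply: spolyJ]; apply: lin_gen; eexists; eexists.
under [in RHS]eq_fun do rewrite Ylm_rot_conj mulr_sumr.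
rewrite cintegral_sum//; last first.
  move=> n; apply: bmeasM; last exact/bmeasZ/bmeasJ/bmeas_Ylm.
  by apply/bmeas_spoly/spoly_rot/lin_gen; exists l, m'.
apply: eq_bigr => n _.
under [in RHS]eq_fun do rewrite mulrCA.
rewrite cintegralZ; last 2 first.
- exact: sigma_fin.
- apply: bmeasM; last exact/bmeasJ/bmeas_Ylm.
  by apply/bmeas_spoly/spoly_rot/lin_gen; exists l, m'.
congr (_ * _); rewrite integral_Ylm_rot -cintegralJ//.
  by congr cintegral; apply/funext => x; rewrite conjcM conjcK.
apply: bmeasM; last exact: bmeas_Ylm.
by apply/bmeasJ/bmeas_spoly/spoly_rot/lin_gen; exists l, m'.
Qed.

(** The sum is the squared length of the vector of harmonics of degree l, which a rotation
    multiplies by a unitary matrix. *)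
Lemma addition_rot l (g : SO3 R) (x : sphere R) : \sum_(m < (2 * l).+1) normc (Ylm m (rot_act g x)) ^+ 2 =
  \sum_(m < (2 * l).+1) normc (Ylm m x) ^+ 2.
Proof.
pose A := D l g; pose B := \matrix_(i < (2 * l).+1, j < (2 * l).+1) ((A j i)^†).
have AB : A *m B = 1%:M.
  apply/matrixP => i j; rewrite !mxE -(D_unitary g); apply: eq_bigr => n _.
  by rewrite mxE.
(* Unitarity was obtained on the rows; the columns are needed here. *)
have BA := mulmx1C AB.
apply: complexI; rewrite !rmorph_sum /=.
under eq_bigr do rewrite -mul_conj Ylm_rot_conj Ylm_rot mulr_suml.
under eq_bigr => m _ do under eq_bigr => n _ do rewrite mulr_sumr.
rewrite exchange_big /=; under [in RHS]eq_bigr do rewrite -mul_conj.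
apply: eq_bigr => n _; rewrite exchange_big /=.
transitivity (\sum_n' (B n n') * 0 + Ylm n x * (Ylm n x)^†); last first.
  by under eq_bigr do rewrite mulr0; rewrite big1// add0r.
under [in RHS]eq_bigr do rewrite mulr0; rewrite [in RHS]big1// add0r.
transitivity (\sum_n' (B *m A) n n' * (Ylm n x * (Ylm n' x)^†)).
  apply: eq_bigr => n' _; rewrite mxE mulr_suml; apply: eq_bigr => m _.
  by rewrite mxE /A; ring.
rewrite BA (bigD1 n)//= mxE eqxx mul1r big1 ?addr0// => n' nn'.
by rewrite mxE eq_sym (negbTE nn') mul0r.
Qed.

(** By transitivity the sum does not depend on x, so it equals its integral 2l + 1 divided by the
    total mass. *)
Lemma addition_theorem l (x : sphere R) :
  \sum_(m < (2 * l).+1) normc (@Ylm R l m x) ^+ 2 = (2 * l + 1)%:R / (4 * pi).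
Proof.
pose c := \sum_(m < (2 * l).+1) normc (@Ylm R l m (north R)) ^+ 2.
have cE y : \sum_(m < (2 * l).+1) normc (@Ylm R l m y) ^+ 2 = c.
  by have [g <-] := rot_transitive y; rewrite addition_rot.
rewrite cE; have pi4 : 4 * pi != 0 :> R by rewrite mulf_neq0// gt_eqF// pi_gt0.
apply: (mulIf pi4); rewrite divfK//.
rewrite -(surface_total R); apply: complexI; rewrite rmorphM /= -cintegral_cst.
transitivity (cintegral sigma (fun x =>
    \sum_(m < (2 * l).+1) (normc (@Ylm R l m x) ^+ 2)%:C)).
  by congr cintegral; apply/funext => y; rewrite -(cE y) rmorph_sum.
have bb m : bmeas (fun x => (normc (@Ylm R l m x) ^+ 2)%:C).
  by under eq_fun do rewrite -mul_conj; apply/bmeasM/bmeasJ/bmeas_Ylm/bmeas_Ylm.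
rewrite cintegral_sum//.
under eq_bigr => m _.
  under eq_fun do rewrite -mul_conj.
  rewrite Ylm_orthonormal !eqxx /=; over.
by rewrite sumr_const card_ord addn1 rmorph_nat.
Qed.

End rotational_harmonics.

(** * Polynomials converging to a step function *)

Section threshold_polynomials.
Variable R : realType.
Implicit Types (x s u : R) (n : nat).

Lemma bernoulli_ineq n x : -1 <= x -> 1 + n%:R * x <= (1 + x) ^+ n.
Proof.
move=> x1; elim: n => [|n ih]; first by rewrite mul0r addr0 expr0.
have x10 : 0 <= 1 + x by rewrite -lerBlDl sub0r.
rewrite exprS; apply: le_trans (ler_wpM2l x10 ih).
rewrite -subr_ge0 -natr1 (_ : _ - _ = n%:R * x ^+ 2); first by rewrite mulr_ge0 ?sqr_ge0.
ring.
Qed.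

(** With y the square root of x, one factor y^n keeps n y^n below 1 / (1 - y) by Bernoulli, and the
    other tends to 0. *)
Lemma cvg_natX x : 0 <= x < 1 -> n%:R * x ^+ n @[n --> \oo] --> (0 : R).
Proof.
move=> /andP[x0 x1]; pose y := Num.sqrt x.
have yx : y ^+ 2 = x by rewrite sqr_sqrtr.
have y0 : 0 <= y by exact: sqrtr_ge0.
have y1 : y < 1 by rewrite -(@expr_lt1 _ 2)// yx.
have h n : n%:R * y ^+ n <= (1 - y)^-1.
  have [->|yn0] := eqVneq y 0.
    rewrite subr0 invr1; case: n => [|n]; first by rewrite mul0r.
    by rewrite expr0n mulr0.
  have yp : 0 < y by rewrite lt_def yn0.
  have yV : 0 <= y^-1 - 1 by rewrite subr_ge0 -[leLHS]invr1 lef_pV2 ?posrE// ltW.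
  have := @bernoulli_ineq n (y^-1 - 1); rewrite subrKC => /(_ (le_trans (lerN10 _) yV)).
  move=> b; rewrite -[leRHS]mul1r ler_pdivlMr ?subr_gt0//.
  have : n%:R * (y^-1 - 1) <= y^-1 ^+ n by apply: le_trans b; rewrite lerDr.
  rewrite exprVn -[leRHS]mul1r ler_pdivlMr ?exprn_gt0// mulrAC => h.
  apply: le_trans (_ : y <= 1); last exact: ltW.
  rewrite (_ : n%:R * y ^+ n * (1 - y) = n%:R * y ^+ n * (y^-1 - 1) * y).
    by rewrite -[leRHS]mul1r ler_wpM2r.
  by field.
have cv : y ^+ n * (1 - y)^-1 @[n --> \oo] --> (0 : R).
  rewrite -[X in _ --> X](mul0r (1 - y)^-1); apply: cvgM; last exact: cvg_cst.
  by apply: cvg_expr; rewrite ger0_norm.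
apply: (squeeze_cvgr _ (@cvg_cst _ (0 : R) _ _ _) cv); near=> n.
rewrite mulr_ge0 ?exprn_ge0//= -yx -exprM mulnC exprM expr2 mulrA [leRHS]mulrC.
by rewrite ler_wpM2r ?exprn_ge0.
Unshelve. all: by end_near. Qed.

Definition step n s : R := (1 - s ^+ n) ^+ (n * 2 ^ n).

Lemma step_itv n s : 0 <= s <= 1 -> 0 <= step n s <= 1.
Proof.
move=> /andP[s0 s1]; have /andP[a b] : 0 <= s ^+ n <= 1 by rewrite exprn_ge0 ?exprn_ile1.
by rewrite /step exprn_ge0 ?subr_ge0// exprn_ile1 ?subr_ge0// lerBlDr lerDl.
Qed.

(** Put u = s^n and M = n 2^n, so that M u = n (2s)^n. Below 1/2, Bernoulli gives (1 - u)^M >= 1 - M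
    u, which tends to 1. From 1/2 on, M u >= n, and (1 - u)^M <= 1 / (1 + u)^M <= 1 / (1 + n). *)
Lemma step_cvg s : 0 <= s <= 1 -> step n s @[n --> \oo] --> ((s < 2^-1)%R%:R : R).
Proof.
move=> s01; have /andP[s0 s1] := s01; case: (ltP s 2^-1) => h.
  have s2 : 0 <= 2 * s < 1 by rewrite mulr_ge0//= mulrC -ltr_pdivlMr// mul1r.
  have cv : 1 - n%:R * (2 * s) ^+ n @[n --> \oo] --> (1 : R).
    rewrite -[X in _ --> X]subr0; apply: cvgB; [exact: cvg_cst|exact: cvg_natX].
  apply: (squeeze_cvgr _ cv (@cvg_cst _ (1 : R) _ _ _)); near=> n.
  have /andP[_ ->] := step_itv n s01; rewrite andbT /step.
  have := @bernoulli_ineq (n * 2 ^ n) (- s ^+ n); rewrite mulrN natrM natrX exprMn mulrA.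
  by apply; rewrite lerN2 exprn_ile1.
have cv : (n.+1%:R)^-1 @[n --> \oo] --> (0 : R) by exact: cvg_harmonic.
apply: (squeeze_cvgr _ (@cvg_cst _ (0 : R) _ _ _) cv); near=> n.
have /andP[-> _] := step_itv n s01; rewrite /= /step.
set u := s ^+ n; set N := (n * 2 ^ n)%N.
have [u0 u1] : 0 <= u /\ u <= 1 by rewrite /u exprn_ge0 ?exprn_ile1.
have Nu : n%:R <= N%:R * u.
  rewrite /N /u natrM -mulrA ler_peMr// natrX -exprMn exprn_ege1//.
  by rewrite mulrC -ler_pdivrMr// mul1r.
rewrite -[leRHS]mul1r ler_pdivlMr//.
have h1 : n.+1%:R <= (1 + u) ^+ N.
  apply: le_trans (@bernoulli_ineq N u _); first by rewrite -natr1 addrC lerD2l.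
  exact: le_trans (lerN10 _) u0.
apply: le_trans (_ : (1 - u) ^+ N * (1 + u) ^+ N <= 1).
  by rewrite ler_wpM2l ?exprn_ge0 ?subr_ge0.
rewrite -exprMn (_ : _ * _ = 1 - u ^+ 2); last by ring.
by rewrite exprn_ile1 ?subr_ge0 ?exprn_ile1// lerBlDr lerDl sqr_ge0.
Unshelve. all: by end_near. Qed.

End threshold_polynomials.

(** * Density of polynomial functions in L^2 of the sphere *)

Section square_approximation.
Variable R : realType.
Local Notation sigma := (@surface_measure R).
Local Open Scope complex_scope.
Implicit Types u v w p : sphere R -> R[i].

Let sigma_fin := surface_lty R.

Definition cmeas u := measurable_fun setT (fun x => complex.Re (u x)) /\
  measurable_fun setT (fun x => complex.Im (u x)).

Lemma bmeas_cmeas u : bmeas u -> cmeas u.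
Proof. by case. Qed.

Lemma cmeasZD c u v : cmeas u -> cmeas v -> cmeas (fun x => c * u x + v x).
Proof.
move=> [u1 u2] [v1 v2]; split.
  under eq_fun do rewrite cReD cReM.
  by apply: measurable_funD => //; apply: measurable_funB; apply: measurable_funM => //;
     exact: measurable_cst.
under eq_fun do rewrite cImD cImM.
by apply: measurable_funD => //; apply: measurable_funD; apply: measurable_funM => //;
   exact: measurable_cst.
Qed.

Definition dist2 u v := (\int[sigma]_x (normc (u x - v x) ^+ 2)%:E)%E.

Lemma measurable_dist2 u v : cmeas u -> cmeas v ->
  measurable_fun setT (fun x => normc (u x - v x) ^+ 2).
Proof.
move=> cu cv; have [m1 m2] := cmeasZD (-1) cv cu.
rewrite (_ : (fun _ => _) = fun x => complex.Re (-1 * v x + u x) ^+ 2 +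
    complex.Im (-1 * v x + u x) ^+ 2); last first.
  by apply/funext => x; rewrite normc_sqr mulN1r ![- v x + u x]addrC.
by apply: measurable_funD; exact: measurable_funX.
Qed.

Lemma dist2_ge0 u v : (0 <= dist2 u v)%E.
Proof. by apply: integral_ge0 => x _; rewrite lee_fin sqr_ge0. Qed.

Lemma sqr_normc_add (x y : R[i]) : normc (x + y) ^+ 2 <= 2 * normc x ^+ 2 + 2 * normc y ^+ 2.
Proof.
rewrite !normc_sqr cReD cImD; case: x y => [a b] [c e] /=.
rewrite -subr_ge0 (_ : _ - _ = (a - c) ^+ 2 + (b - e) ^+ 2); last by ring.
by rewrite addr_ge0 ?sqr_ge0.
Qed.

Lemma dist2_triangle u v w : cmeas u -> cmeas v -> cmeas w ->
  (dist2 u w <= 2%:E * dist2 u v + 2%:E * dist2 v w)%E.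
Proof.
move=> cu cv cw.
have muv := measurable_dist2 cu cv; have mvw := measurable_dist2 cv cw.
have muw := measurable_dist2 cu cw.
have g0 a b : forall x : sphere R, (0 <= (normc (a x - b x : R[i]) ^+ 2)%:E)%E.
  by move=> x; rewrite lee_fin sqr_ge0.
rewrite /dist2 -!ge0_integralZl//; [|exact/measurable_EFinP..].
rewrite -ge0_integralD//; last 4 first.
- by move=> x _; rewrite mule_ge0// lee_fin.
- by apply/measurable_EFinP; apply: measurable_funM => //; exact: measurable_cst.
- by move=> x _; rewrite mule_ge0// lee_fin.
- by apply/measurable_EFinP; apply: measurable_funM => //; exact: measurable_cst.
apply: ge0_le_integral => //.
- exact/measurable_EFinP.
- by apply: emeasurable_funD; apply/measurable_EFinP; apply: measurable_funM => //;
     exact: measurable_cst.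
- move=> x _; rewrite -!EFinM -EFinD lee_fin.
  by have := sqr_normc_add (u x - v x) (v x - w x); rewrite addrA subrK.
Qed.

Definition approx w := cmeas w /\
  forall e : R, 0 < e -> exists2 p, spoly p & (dist2 w p <= e%:E)%E.

Lemma spoly_cmeas p : spoly p -> cmeas p.
Proof. by move=> /bmeas_spoly/bmeas_cmeas. Qed.

Lemma dist2xx u : dist2 u u = 0%E.
Proof.
rewrite /dist2; under eq_integral do rewrite subrr Normc.normc0 expr0n /=.
exact: integral0.
Qed.

Lemma approx_spoly p : spoly p -> approx p.
Proof.
move=> sp; split; first exact: spoly_cmeas.
by move=> e e0; exists p => //; rewrite dist2xx lee_fin ltW.
Qed.

Lemma approx_limit w : cmeas w ->
  (forall e : R, 0 < e -> exists2 v, approx v & (dist2 w v <= e%:E)%E) -> approx w.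
Proof.
move=> cw aw; split => // e e0; have e4 : 0 < e / 4 by rewrite divr_gt0.
have [v [cv av] wv] := aw _ e4; have [p sp vp] := av _ e4; exists p => //.
apply: le_trans (dist2_triangle cw cv (spoly_cmeas sp)) _.
apply: (@le_trans _ _ (2%:E * (e / 4)%:E + 2%:E * (e / 4)%:E)%E).
  by apply: leeD; apply: lee_wpmul2l => //; rewrite lee_fin.
by rewrite -!EFinM -EFinD lee_fin; lra.
Qed.

Lemma approxZD c u v : approx u -> approx v -> approx (fun x => c * u x + v x).
Proof.
move=> [cu au] [cv av]; split; first exact: cmeasZD.
move=> e e0; pose k := normc c ^+ 2 + 1; have k0 : 0 < k by rewrite ltr_wpDl ?sqr_ge0.
have e4 : 0 < e / 4 by rewrite divr_gt0.
have [p sp up] := au _ (divr_gt0 e4 k0); have [q sq vq] := av _ e4.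
exists (fun x => c * p x + q x); first by apply: linD => //; exact: linZ.
have cp := spoly_cmeas sp; have cq := spoly_cmeas sq.
have cm := cmeasZD c cp cv.
apply: le_trans (dist2_triangle (cmeasZD c cu cv) cm (cmeasZD c cp cq)) _.
have -> : dist2 (fun x => c * p x + v x) (fun x => c * p x + q x) = dist2 v q.
  by apply: eq_integral => x _; rewrite opprD addrACA subrr add0r.
have -> : dist2 (fun x => c * u x + v x) (fun x => c * p x + v x) =
    ((normc c ^+ 2)%:E * dist2 u p)%E.
  rewrite /dist2 -ge0_integralZl//.
  - apply: eq_integral => x _; rewrite opprD addrACA subrr addr0 -mulrBr.
    by rewrite Normc.normcM exprMn EFinM.
  - by apply/measurable_EFinP; exact: (measurable_dist2 cu cp).
  - by move=> x _; rewrite lee_fin sqr_ge0.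
  - by rewrite lee_fin sqr_ge0.
apply: (@le_trans _ _ (2%:E * ((normc c ^+ 2)%:E * (e / 4 / k)%:E) + 2%:E * (e / 4)%:E)%E).
  apply: leeD; apply: lee_wpmul2l => //; rewrite ?lee_fin//.
  by apply: lee_wpmul2l => //; rewrite lee_fin sqr_ge0.
rewrite -!EFinM -EFinD lee_fin mulrCA mulrA.
have : normc c ^+ 2 * (e / 4 / k) <= e / 4.
  by rewrite mulrCA ler_piMr ?(ltW e4)// ler_pdivrMr// mul1r lerDl.
lra.
Qed.

(** Dominated convergence for the squared distance. It closes each stage of the density argument:
    octants, monotone unions, truncation. *)
Lemma approx_dominated w (w_ : nat -> sphere R -> R[i]) (g : sphere R -> R) :
  cmeas w -> (forall n, approx (w_ n)) ->
  (forall x, normc (w x - w_ n x) ^+ 2 @[n --> \oo] --> (0 : R)) ->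
  sigma.-integrable setT (EFin \o g) ->
  (forall n x, normc (w x - w_ n x) ^+ 2 <= g x) -> approx w.
Proof.
move=> cw aw cvg gi bnd; apply: approx_limit => // e e0.
pose f_ n x := (normc (w x - w_ n x) ^+ 2)%:E.
have mf n : measurable_fun setT (f_ n).
  by apply/measurable_EFinP; apply: measurable_dist2 => //; case: (aw n).
have := @dominated_cvg _ _ _ sigma setT measurableT f_ (fun=> 0%E) (EFin \o g) mf.
rewrite integral0 => h.
have {}h : dist2 w (w_ n) @[n --> \oo] --> 0%E.
  apply: h => //.
  - by move=> x _; apply: cvg_EFin; [exact: nearW|exact: cvg].
  - by move=> n x _; rewrite /f_ /= ger0_norm ?sqr_ge0// lee_fin.
have /fine_cvgP[fn hf] := h.
have lt : \forall n \near \oo, fine (dist2 w (w_ n)) < e by apply: (cvgr_lt _ hf).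
have [n [h1 h2]] := filter_ex (filterI fn lt).
by exists (w_ n) => //; rewrite -(fineK h1) lee_fin ltW.
Qed.

Lemma spoly_coord_horner i (q : {poly R}) : spoly (fun x : sphere R => (q.[x i 0])%:C).
Proof.
elim/poly_ind: q => [|q c ih].
  by under eq_fun do rewrite horner0; exact: lin0.
under eq_fun do rewrite hornerMXaddC rmorphD rmorphM /=.
exact: linD (spolyM ih (spoly_coord R i)) (spoly_cst _).
Qed.

Definition octant (a : R * R * R) : set (sphere R) := [set x |
  [/\ a.1.1 < x (inord 0) 0, a.1.2 < x (inord 1) 0 & a.2 < x (inord 2) 0]].

(** An affine change of variable sending [-1, 1] into [0, 1] and the ray t > a to values below 1/2,
    so that [step] composed with it approximates the indicator of the ray. *)
Definition ray_arg (a t : R) : R := 2^-1 - (t - a) / (2 * (1 + `|a|)).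

Lemma ray_arg_itv a t : `|t| <= 1 -> 0 <= ray_arg a t <= 1.
Proof.
move=> t1; have k0 : 0 < 2 * (1 + `|a|) by rewrite mulr_gt0// ltr_wpDr.
have : `|(t - a) / (2 * (1 + `|a|))| <= 2^-1.
  rewrite normrM normfV (gtr0_norm k0) ler_pdivrMr// mulrA mulVf// mul1r.
  by rewrite (le_trans (ler_normB _ _))// lerD2r.
by rewrite ler_norml /ray_arg; lra.
Qed.

Lemma ray_arg_lt a t : (ray_arg a t < 2^-1) = (a < t).
Proof.
have k0 : 0 < 2 * (1 + `|a|) by rewrite mulr_gt0// ltr_wpDr.
by rewrite /ray_arg ltrBlDr ltrDl pmulr_lgt0 ?invr_gt0// subr_gt0.
Qed.

Definition ray_poly (a : R) n : {poly R} :=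
  (1 - ((2^-1 + a / (2 * (1 + `|a|)))%:P - (2 * (1 + `|a|))^-1 *: 'X) ^+ n) ^+ (n * 2 ^ n).

Lemma ray_polyE a n t : (ray_poly a n).[t] = step n (ray_arg a t).
Proof.
rewrite /ray_poly /step !(horner_exp, hornerD, hornerN, hornerC, hornerZ, hornerX).
congr ((1 - _ ^+ _) ^+ _); rewrite /ray_arg; ring.
Qed.

Lemma measurable_octant a : measurable (octant a).
Proof.
rewrite (_ : octant a = (fun x => x (inord 0) 0) @^-1` `]a.1.1, +oo[ `&`
    ((fun x => x (inord 1) 0) @^-1` `]a.1.2, +oo[ `&`
    (fun x => x (inord 2) 0) @^-1` `]a.2, +oo[)).
  by do !apply: measurableI; rewrite -[X in measurable X]setTI;
     apply: measurable_coord => //; exact: measurable_itv.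
apply/seteqP; split => x /=; rewrite !in_itv /= !andbT; first by case.
by case=> ? [].
Qed.

Lemma approx_octant a : approx (fun x => (\1_(octant a) x)%:C).
Proof.
pose w_ n (x : sphere R) := ((ray_poly a.1.1 n).[x (inord 0) 0])%:C *
  (((ray_poly a.1.2 n).[x (inord 1) 0])%:C * ((ray_poly a.2 n).[x (inord 2) 0])%:C).
have bi : bmeas (fun x : sphere R => (\1_(octant a) x : R)%:C).
  by apply: bmeas_indicators; exists (octant a) => //; exact: measurable_octant.
pose r_ n (x : sphere R) := step n (ray_arg a.1.1 (x (inord 0) 0)) *
  (step n (ray_arg a.1.2 (x (inord 1) 0)) * step n (ray_arg a.2 (x (inord 2) 0))).
have wE n (x : sphere R) : w_ n x = (r_ n x)%:C by rewrite /w_ !ray_polyE -!rmorphM.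
have rI n (x : sphere R) : 0 <= r_ n x <= 1.
  have h b i : 0 <= step n (ray_arg b (x i 0)) <= 1.
    exact/step_itv/ray_arg_itv/coord_le1.
  have /andP[? ?] := h a.1.1 (inord 0); have /andP[? ?] := h a.1.2 (inord 1).
  have /andP[? ?] := h a.2 (inord 2).
  by rewrite /r_ !mulr_ge0//= !mulr_ile1 ?mulr_ge0// .
apply: (@approx_dominated _ w_ (fun=> 1)).
- exact: bmeas_cmeas.
- by move=> n; apply: approx_spoly; do !apply: spolyM; exact: spoly_coord_horner.
- move=> x.
  have h : \1_(octant a) x - r_ n x @[n --> \oo] --> (0 : R).
    rewrite -[X in _ --> X](subrr (\1_(octant a) x : R)).
    apply: cvgB; first exact: cvg_cst.
    have -> : \1_(octant a) x = (ray_arg a.1.1 (x (inord 0) 0) < 2^-1)%R%:R *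
       ((ray_arg a.1.2 (x (inord 1) 0) < 2^-1)%R%:R *
        (ray_arg a.2 (x (inord 2) 0) < 2^-1)%R%:R) :> R.
      rewrite !ray_arg_lt indicE -!natrM !mulnb; congr (_%:R).
      by congr nat_of_bool; apply/idP/and3P; rewrite inE.
    by apply: cvgM; [|apply: cvgM]; apply/step_cvg/ray_arg_itv/coord_le1.
  rewrite (_ : (fun n => _) = fun n => (\1_(octant a) x - r_ n x) * (\1_(octant a) x - r_ n x)).
    by have := cvgM h h; rewrite (mulr0 (0 : R)); exact.
  by apply/funext => n; rewrite wE -expr2 -rmorphB normc_real real_normK ?num_real.
- apply: (bounded_integrable sigma_fin (M := 1)); [exact: measurable_cst|by move=> x; rewrite normr1].
- move=> n x; rewrite wE -rmorphB normc_real real_normK ?num_real//.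
  have /andP[? ?] := rI n x; rewrite indicE; case: (_ \in _) => /=; nra.
Qed.

(** Pi-lambda argument: octants are stable under intersection and generate the Borel sets, and the
    sets with an approximable indicator form a lambda-system. *)
Lemma approx_indicator A : measurable A -> approx (fun x => (\1_A x)%:C).
Proof.
have bi B : measurable B -> bmeas (fun x : sphere R => (\1_B x : R)%:C).
  by move=> mB; apply: bmeas_indicators; exists B.
pose G := range octant.
pose H := [set A : set (sphere R) | measurable A /\ approx (fun x => (\1_A x : R)%:C)].
have GI : setI_closed G.
  move=> _ _ [a _ <-] [b _ <-].
  exists (Num.max a.1.1 b.1.1, Num.max a.1.2 b.1.2, Num.max a.2 b.2) => //.
  apply/seteqP; split => x; rewrite /octant /= !gt_max; first by move=> [/andP[? ?] /andP[? ?] /andP[? ?]].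
  by move=> [[? ? ?] [? ? ?]]; split; apply/andP.
have HG : G `<=` H.
  by move=> _ [a _ <-]; split; [exact: measurable_octant|exact: approx_octant].
have HL : lambda_system setT H.
  split => //.
  - split => //; apply: approx_spoly; apply: spoly_cast (spoly_cst 1) _ => x.
    by rewrite indicE in_setT.
  - move=> E B BE [mE aE] [mB aB]; split; first exact: measurableD.
    rewrite (_ : (fun _ => _) = fun x => -1 * (\1_B x)%:C + (\1_E x)%:C); first exact: approxZD.
    apply/funext => x; rewrite mulN1r addrC -rmorphB; congr (_%:C).
    rewrite !indicE; have [xB|xB] := boolP (x \in B).
      have -> : x \in E by rewrite inE; apply: BE; rewrite inE in xB.
      by rewrite memNset ?subrr//; case=> _; rewrite inE in xB.
    rewrite subr0; congr (_%:R); congr nat_of_bool; apply/idP/idP; rewrite !inE => //; first by case.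
    by move=> Ex; split => //; rewrite notin_setE in xB.
  - move=> F ndF HF; split; first by apply: bigcupT_measurable => n; case: (HF n).
    apply: (@approx_dominated _ (fun n x => (\1_(F n) x)%:C) (fun=> 1)).
    + by apply/bmeas_cmeas/bi/bigcupT_measurable => n; case: (HF n).
    + by move=> n; case: (HF n).
    + move=> x; have [[m _ Fmx]|nF] := pselect ((\bigcup_n F n) x).
        apply: cvg_near_cst; exists m => // n mn.
        have Fnx : F n x by move/subsetPset : (ndF _ _ mn); exact.
        rewrite !indicE !mem_set//; last by exists m.
        by rewrite -rmorphB normc_real subrr normr0 expr0n.
      apply: cvg_near_cst; apply: nearW => n; rewrite !indicE !memNset//.
        by rewrite -rmorphB normc_real subrr normr0 expr0n.
      by move=> Fnx; apply: nF; exists n.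
    + apply: (bounded_integrable sigma_fin (M := 1)); [exact: measurable_cst|by move=> x; rewrite normr1].
    + move=> n x; rewrite -rmorphB normc_real real_normK ?num_real// !indicE.
suff mG : measurable `<=` <<s G >>.
  by move=> /mG mA; have [] // := @lambda_system_subset _ _ GI setT _ HL HG _ _ mA.
apply: smallest_sub; first exact: smallest_sigma_algebra.
move=> _ [i [B mB <-]]; rewrite setTI.
suff /(_ measurableT B mB) : measurable_fun setT (fun x : g_sigma_algebraType G => x i 0).
  by rewrite setTI.
apply: (measurability _ (RGenOInfty.measurableE R)) => _ [_ [c ->] <-]; rewrite setTI.
(* Coordinates are at least -1, so the bound -2 imposes no constraint and the octant is a half-space
   in coordinate i. *)
pose a : R * R * R := (if i == inord 0 then c else -2, if i == inord 1 then c else -2,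
  if i == inord 2 then c else -2).
apply: sub_sigma_algebra; exists a => //; apply/seteqP; split => x /=.
  rewrite in_itv /= andbT.
  by case: (ord3_cases i) => ie; rewrite /octant /a ie eqxx /=; case.
rewrite in_itv /= andbT => cx; have gt2 j : -2 < x j 0.
  by have := coord_le1 x j; rewrite ler_norml => /andP[+ _]; apply: lt_le_trans; lra.
by rewrite /octant /a /=; split; case: eqP => // <-.
Qed.

Lemma approx_bmeas u : bmeas u -> approx u.
Proof.
have al v : lin (@indicators _ _ _) v -> approx v.
  elim=> [|c b w [A mA ->] _ ih]; first exact/approx_spoly/lin0.
  by apply: approxZD => //; exact: approx_indicator.
move=> bu; apply: approx_limit; first exact: bmeas_cmeas.
move=> e e0; pose k := Num.sqrt (e / (4 * pi + 1)).
have pi1 : 0 < 4 * pi + 1 :> R by rewrite ltr_wpDl// mulr_ge0// pi_ge0.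
have k0 : 0 < k by rewrite sqrtr_gt0 divr_gt0.
have [v lv uv] := bmeas_uniform_lin bu k0; exists v; first exact: al.
have bv := bmeas_lin (@bmeas_indicators _ _ _) lv.
apply: (@le_trans _ _ (\int[sigma]_(x in setT) (k ^+ 2)%:E)%E).
  apply: ge0_le_integral => //.
  - by move=> x _; rewrite lee_fin sqr_ge0.
  - by apply/measurable_EFinP; apply: measurable_dist2; exact: bmeas_cmeas.
  - by move=> x _; rewrite lee_fin ler_sqr ?nnegrE ?normc_ge0 ?(ltW k0).
have st : sigma setT = (4 * pi)%:E :> \bar R.
  by rewrite -(surface_total R) fineK// ge0_fin_numE.
have -> : (\int[sigma]_(x in setT) (k ^+ 2)%:E = (k ^+ 2 * (4 * pi))%:E)%E.
  by rewrite (EFinM (k ^+ 2)) -st; exact: integral_cst.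
rewrite lee_fin sqr_sqrtr ?divr_ge0 ?(ltW e0) ?(ltW pi1)//.
by rewrite -mulrA ler_piMr ?(ltW e0)// mulrC ler_pdivrMr// mul1r lerDl.
Qed.

(** The truncations min(f, n) are bounded and converge to f, with squared error dominated by f^2. *)
Lemma approx_square_integrable (f : sphere R -> R) : measurable_fun setT f ->
  (forall x, 0 <= f x) -> sigma.-integrable setT (fun x => (f x ^+ 2)%:E) ->
  approx (fun x => (f x)%:C).
Proof.
move=> mf f0 f2; pose g n x := Num.min (f x) n%:R.
have g0 n x : 0 <= g n x <= n%:R by rewrite le_min f0 ler0n /= ge_min lexx orbT.
have mg n : measurable_fun setT (g n).
  by apply: measurable_minr => //; exact: measurable_cst.
apply: (@approx_dominated _ (fun n x => (g n x)%:C) (fun x => f x ^+ 2)) => //.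
- move=> n; apply: approx_bmeas; apply: (@bmeas_real _ _ _ _ n%:R) => // x.
  by have /andP[h1 h2] := g0 n x; rewrite ger0_norm.
- move=> x; apply: cvg_near_cst; near=> n.
  rewrite /g min_l ?subrr ?Normc.normc0 ?expr0n//; near: n.
  exact: nbhs_infty_ger.
- move=> n x; rewrite -rmorphB normc_real real_normK ?num_real//.
  have /andP[h1 _] := g0 n x; have h2 : g n x <= f x by rewrite ge_min lexx.
  by rewrite ler_sqr ?nnegrE ?subr_ge0// lerBlDr lerDl.
Unshelve. all: by end_near. Qed.

End square_approximation.

(** * Parseval's inequality and the bias of the truncated energy *)

Section parseval.
Variable R : realType.
Local Notation sigma := (@surface_measure R).
Local Open Scope complex_scope.

Let sigma_fin := surface_lty R.

Definition harm_coef (p : sphere R -> R[i]) l (k : 'I_((2 * l).+1)) : R[i] :=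
  cintegral sigma (fun x => p x * (Ylm k x)^†).

Lemma spoly_expansion p : spoly p -> exists L0, forall L, (L0 <= L)%N ->
  forall x, p x = \sum_(l < L) \sum_(k < (2 * l).+1) harm_coef p k * Ylm k x.
Proof.
elim=> [|c _ v [l0 [k0 ->]] sv [L0 ih]].
  exists 0%N => L _ x; rewrite big1// => l _; rewrite big1// => k _.
  rewrite /harm_coef (_ : (fun _ => _) = fun=> 0).
    by rewrite cintegral_cst !mul0r.
  by apply/funext => y; rewrite mul0r.
exists (maxn L0 l0.+1) => L; rewrite geq_max => /andP[L0L l0L] x.
have bY l (k : 'I_((2 * l).+1)) := @bmeas_Ylm R l k.
have bv := bmeas_spoly sv.
have cE l (k : 'I_((2 * l).+1)) : harm_coef (fun x => c * Ylm k0 x + v x) k =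
    c * ((l0 == l) && (k0 == k :> nat))%:R + harm_coef v k.
  rewrite -Ylm_orthonormal /harm_coef; under eq_fun do rewrite mulrDl -mulrA.
  rewrite cintegralD ?cintegralZ//.
  - exact/bmeasM/bmeasJ/bY/bY.
  - exact/bmeasZ/bmeasM/bmeasJ/bY/bY.
  - exact/bmeasM/bmeasJ/bY.
under eq_bigr => l _ do under eq_bigr => k _ do rewrite cE mulrDl.
under eq_bigr => l _ do rewrite big_split.
rewrite big_split /= -(ih L L0L); congr (_ + _).
pose l1 := Ordinal l0L.
rewrite (bigD1 l1)//= [X in _ = _ + X]big1 ?addr0; last first.
  move=> l ll1; rewrite big1// => k _.
  have -> : (l0 == l) = false.
    by apply/eqP => E; case/eqP : ll1; apply: val_inj.
  by rewrite mulr0 mul0r.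
rewrite (bigD1 k0)//= !eqxx mulr1 big1 ?addr0// => k kk0.
have -> : (k0 == k :> nat) = false.
  by apply/eqP => E; case/eqP : kk0; exact: val_inj.
by rewrite andbF mulr0 mul0r.
Qed.

Section density_coefficients.
Variable f : sphere R -> R.
Hypothesis fi : sigma.-integrable setT (EFin \o f).
Hypothesis f0 : forall x, 0 <= f x.

Lemma sph_coefE l (k : 'I_((2 * l).+1)) :
  sph_coef f l k 0 = cintegral sigma (fun x => (f x)%:C * (Ylm k x)^†).
Proof. by rewrite mxE. Qed.

Lemma weighted_cintegral0 : cintegral sigma (fun x => (f x)%:C * 0) = 0.
Proof. by under eq_fun do rewrite mulr0; rewrite cintegral_cst mul0r. Qed.

Lemma weighted_cintegral_sum (I : Type) (s : seq I) (a : I -> R[i]) (F : I -> sphere R -> R[i]) :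
  (forall i, bmeas (F i)) ->
  cintegral sigma (fun x => (f x)%:C * \sum_(i <- s) a i * F i x) =
  \sum_(i <- s) a i * cintegral sigma (fun x => (f x)%:C * F i x).
Proof.
move=> bF; elim: s => [|i s ih].
  by under eq_fun do rewrite big_nil; rewrite big_nil weighted_cintegral0.
rewrite big_cons -ih -weighted_cintegralP//.
  by congr cintegral; apply/funext => x; rewrite big_cons.
by apply: bmeas_sum => j; exact: bmeasZ.
Qed.

Lemma weighted_cintegralJ u : bmeas u ->
  cintegral sigma (fun x => (f x)%:C * (u x)^†) =
  (cintegral sigma (fun x => (f x)%:C * u x))^†.
Proof.
move=> bu; have [u1 u2] := weighted_integrable fi bu.
rewrite /cintegral; apply: complex_eq => /=.
  by apply: eq_Rintegral => x _; rewrite !cRe_realM cReJ.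
rewrite -mulN1r -RintegralZl//.
  by apply: eq_Rintegral => x _; rewrite !cIm_realM cImJ; ring.
by apply: eq_integrable u2 => // x _ /=; rewrite cIm_realM.
Qed.

Hypothesis f2 : sigma.-integrable setT (fun x => (f x ^+ 2)%:E).

Lemma dist2_realE p : spoly p -> (dist2 (fun x => (f x)%:C) p =
  (\int[sigma]_x (f x ^+ 2)
   - 2 * complex.Re (cintegral sigma (fun x => (f x)%:C * p x))
   + complex.Re (cintegral sigma (fun x => p x * (p x)^†)))%:E)%E.
Proof.
move=> sp; have bp := bmeas_spoly sp.
have bpp : bmeas (fun x => p x * (p x)^†) by exact/bmeasM/bmeasJ.
have [p1 _] := weighted_integrable fi bp.
have [q1 _] := bmeas_integrable sigma_fin bpp.
have p1' : sigma.-integrable setT (EFin \o (fun x => 2 * (f x * complex.Re (p x)))).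
  by apply: eq_integrable (integrableZl measurableT 2 p1).
have i1 : sigma.-integrable setT (EFin \o (fun x => f x ^+ 2 - 2 * (f x * complex.Re (p x)))).
  by apply: eq_integrable (integrableB measurableT f2 p1').
have -> : complex.Re (cintegral sigma (fun x => (f x)%:C * p x)) =
    \int[sigma]_x (f x * complex.Re (p x)).
  by apply: eq_Rintegral => x _; rewrite cRe_realM.
rewrite /= -RintegralZl// -RintegralB// -RintegralD// fineK; last first.
  apply: (integrable_fin_num measurableT).
  exact: eq_integrable (integrableD measurableT i1 q1).
apply: eq_integral => x _; congr EFin.
rewrite normc_sqr cReD cImD mul_conj /= normc_sqr.
by case: (p x) => a b /=; ring.
Qed.

(** For a polynomial p within squared distance e of f, the integral of f^2 is at most 2 Re <f, p> -
    |p|^2 + e. Completing the square coefficient by coefficient bounds 2 Re <f, p> - |p|^2 by the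
    energy of f in the degrees of p. *)
Lemma parseval_le (e : R) : 0 < e -> exists L0, forall L, (L0 <= L)%N ->
  \int[sigma]_x (f x ^+ 2) <=
  \sum_(l < L) \sum_(k < (2 * l).+1) normc (sph_coef f l k 0) ^+ 2 + e.
Proof.
move=> e0.
have mf : measurable_fun setT f by apply/measurable_EFinP; exact: measurable_int fi.
have [_ /(_ e e0)[p sp]] := approx_square_integrable mf f0 f2.
rewrite dist2_realE// lee_fin => fp; have [L0 pE] := spoly_expansion sp.
exists L0 => L L0L; have {}pE := pE L L0L.
have bY l (k : 'I_((2 * l).+1)) := @bmeas_Ylm R l k.
have bp := bmeas_spoly sp.
have cfp : cintegral sigma (fun x => (f x)%:C * p x) =
    \sum_(l < L) \sum_(k < (2 * l).+1) harm_coef p k * (sph_coef f l k 0)^†.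
  under eq_fun do rewrite pE.
  transitivity (cintegral sigma (fun x => (f x)%:C * \sum_(l < L) 1 *
      \sum_(k < (2 * l).+1) harm_coef p k * Ylm k x)).
    congr cintegral; apply/funext => x; congr (_ * _); apply: eq_bigr => l _.
    by rewrite mul1r.
  rewrite weighted_cintegral_sum; last first.
    by move=> l; apply: bmeas_sum => k; exact/bmeasZ/bY.
  apply: eq_bigr => l _; rewrite mul1r weighted_cintegral_sum//.
  by apply: eq_bigr => k _; rewrite sph_coefE weighted_cintegralJ// conjcK.
have cpp : cintegral sigma (fun x => p x * (p x)^†) =
    \sum_(l < L) \sum_(k < (2 * l).+1) (normc (harm_coef p k) ^+ 2)%:C.
  transitivity (cintegral sigma (fun x => \sum_(l < L) \sum_(k < (2 * l).+1)
      (harm_coef p k)^† * (p x * (Ylm k x)^†))).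
    congr cintegral; apply/funext => x; rewrite {2}pE conjc_sum mulr_sumr.
    apply: eq_bigr => l _; rewrite conjc_sum mulr_sumr; apply: eq_bigr => k _.
    by rewrite conjcM mulrCA.
  have bpY l (k : 'I_((2 * l).+1)) : bmeas (fun x => p x * (Ylm k x)^†).
    exact/bmeasM/bmeasJ/bY.
  rewrite cintegral_sum//; last by move=> l; apply: bmeas_sum => k; exact: bmeasZ.
  apply: eq_bigr => l _; rewrite cintegral_sum//; last by move=> k; exact: bmeasZ.
  by apply: eq_bigr => k _; rewrite cintegralZ// mulrC mul_conj.
rewrite -lerBlDl; apply: le_trans fp.
rewrite -addrA lerD2l cfp cpp !cRe_sum lerNl opprD opprK.
rewrite mulr_sumr -sumrB; apply: ler_sum => l _.
rewrite !cRe_sum mulr_sumr -sumrB; apply: ler_sum => k _.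
rewrite !normc_sqr cReM cReJ cImJ.
move: (harm_coef p k) (sph_coef f l k 0) => [a b] [c g] /=.
have := sqr_ge0 (a - c); have := sqr_ge0 (b - g); rewrite !sqrrB; lra.
Qed.

End density_coefficients.

Lemma Y00_normc : exists2 c : R[i], normc c ^+ 2 = (4 * pi)^-1 &
  forall (k : 'I_((2 * 0).+1)) x, @Ylm R 0 k x = c.
Proof.
have [c _ cE] := Y00_cst R; exists c; last first.
  by move=> [[|//] k0] x; rewrite -(cE x); congr (Ylm _ x); exact: val_inj.
have := @Ylm_orthonormal R 0 0 ord0 ord0; rewrite !eqxx.
under eq_fun do rewrite cE mul_conj.
rewrite cintegral_real Rintegral_cst// surface_total => /complexI h.
have pi4 : 4 * pi != 0 :> R by rewrite mulf_neq0// gt_eqF// pi_gt0.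
by apply: (mulIf pi4); rewrite h mulVf.
Qed.

Lemma Rintegral_density (f : sphere R -> R) : is_density sigma f ->
  sigma.-integrable setT (EFin \o f) /\ \int[sigma]_x f x = 1.
Proof.
move=> [mf f0 f1]; split; last by rewrite /Rintegral f1.
apply/integrableP; split; first exact/measurable_EFinP.
under eq_integral do rewrite /= ger0_norm//.
by rewrite f1 ltry.
Qed.

Definition energy (f : sphere R -> R) l := \sum_(k < (2 * l).+1) normc (sph_coef f l k 0) ^+ 2.

Lemma energy_ge0 f l : 0 <= energy f l.
Proof. by apply: sumr_ge0 => k _; exact: sqr_ge0. Qed.

(** A density has integral 1 and [Ylm] of degree 0 is constant. This same term is subtracted in
    [dist_uniform], which is why the statistic starts at degree 1. *)
Lemma energy0 f : is_density sigma f -> energy f 0 = (4 * pi)^-1.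
Proof.
move=> df; have [fi f1] := Rintegral_density df; have [c <- cE] := Y00_normc.
rewrite /energy big_ord_recl big_ord0 addr0 sph_coefE.
under eq_fun do rewrite cE mulrC.
have -> : cintegral sigma (fun x => c^† * (f x)%:C) = c^†; last by rewrite normc_conj.
transitivity (cintegral sigma (fun x => (f x)%:C * (c^† * 1 + 0))).
  by congr cintegral; apply/funext => x; rewrite mulr1 addr0 mulrC.
rewrite (weighted_cintegralP fi _ (bmeas_cst _ 1) (bmeas_cst _ 0)) weighted_cintegral0 addr0.
transitivity (c^† * cintegral sigma (fun x => (f x)%:C)).
  by congr (_ * cintegral _ _); apply/funext => x; rewrite mulr1.
by rewrite cintegral_real f1 mulr1.
Qed.

Lemma Lnorm2_sqr (g : sphere R -> R) : sigma.-integrable setT (fun x => (g x ^+ 2)%:E) ->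
  (Lnorm sigma 2%:E (fun x => (g x)%:E) ^+ 2 = (\int[sigma]_x (g x ^+ 2))%:E)%E.
Proof.
move=> g2; rewrite Lnorm.unlock.
have -> : (\int[sigma]_x `|(g x)%:E| `^ 2 = (\int[sigma]_x (g x ^+ 2))%:E)%E.
  rewrite fineK; last exact: integrable_fin_num.
  apply: eq_integral => x _; rewrite poweR_EFin; congr EFin.
  by rewrite powR_mulrn// real_normK ?num_real.
have I0 : 0 <= \int[sigma]_x (g x ^+ 2) by apply: Rintegral_ge0 => x _; exact: sqr_ge0.
rewrite poweR_EFin powR12_sqrt// -EFin_expe; congr EFin; exact: sqr_sqrtr.
Qed.

Lemma dist_uniform (f : sphere R -> R) : is_density sigma f ->
  sigma.-integrable setT (fun x => (f x ^+ 2)%:E) ->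
  (Lnorm sigma 2%:E (fun x => (f x - uniform_density x)%:E) ^+ 2 =
   (\int[sigma]_x (f x ^+ 2) - (4 * pi)^-1)%:E)%E.
Proof.
move=> df f2; have [fi f1] := Rintegral_density df.
pose u : R := (4 * pi)^-1.
have cfi : sigma.-integrable setT (EFin \o (fun x => 2 * u * f x)).
  by apply: eq_integrable (integrableZl measurableT (2 * u) fi).
have ci : sigma.-integrable setT (EFin \o (fun=> u ^+ 2)).
  by apply: (bounded_integrable sigma_fin (M := `|u ^+ 2|)); [exact: measurable_cst|move=> x].
have di : sigma.-integrable setT (EFin \o (fun x => f x ^+ 2 - 2 * u * f x)).
  by apply: eq_integrable (integrableB measurableT f2 cfi).
have E x : (f x - uniform_density x) ^+ 2 = f x ^+ 2 - 2 * u * f x + u ^+ 2.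
  rewrite /uniform_density -/u; ring.
rewrite Lnorm2_sqr; last first.
  by apply: eq_integrable (integrableD measurableT di ci) => // x _ /=; rewrite E.
congr EFin; under eq_Rintegral do rewrite E.
rewrite RintegralD// RintegralB// RintegralZl// f1 Rintegral_cst// surface_total.
have pi4 : 4 * pi != 0 :> R by rewrite mulf_neq0// gt_eqF// pi_gt0.
have upi : u * (4 * pi) = 1 by rewrite mulVf.
have -> : u ^+ 2 * (4 * pi) = u by rewrite expr2 -mulrA upi mulr1.
by rewrite -/u; ring.
Qed.

(** Degree 0 cancels against the uniform density. Beyond L the Sobolev weights are at least L^(2s),
    so the remaining energy is at most L^(-2s) times the squared Sobolev norm. *)
Lemma alternatives_energy (s r rho : R) (f : sphere R -> R) (L : nat) :
  0 < s -> (0 < L)%N -> alternatives s r rho f ->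
  rho <= \sum_(1 <= l < L.+1) energy f l + L%:R `^ (- 2 * s) * ((4 * pi)^-1 + r ^+ 2).
Proof.
move=> s0 L0 [[df [fL2 _] fs] frho].
have f2 : sigma.-integrable setT (fun x => (f x ^+ 2)%:E) := Lfun2_integrable_sqr fL2.
rewrite dist_uniform// lee_fin lerBrDr in frho; apply/ler_addgt0Pr => e e0.
have [fi _] := Rintegral_density df; have [_ f0 _] := df.
have [L1 /(_ (maxn L1 L.+1) (leq_maxl _ _))] := parseval_le fi f0 f2 e0.
set L2 := maxn _ _ => pv.
have LL2 : (L.+1 <= L2)%N := leq_maxr _ _.
have {}pv : \int[sigma]_x (f x ^+ 2) <= (4 * pi)^-1 + \sum_(1 <= l < L.+1) energy f l +
    \sum_(L.+1 <= l < L2) energy f l + e.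
  rewrite -(energy0 df); apply: le_trans pv _; rewrite lerD2r.
  rewrite -(big_mkord xpredT (energy f)) (@big_cat_nat _ _ _ L.+1)//=.
  by rewrite big_ltn.
have L0' : 0 < L%:R :> R by rewrite ltr0n.
suff tail : \sum_(L.+1 <= l < L2) energy f l <= L%:R `^ (- 2 * s) * ((4 * pi)^-1 + r ^+ 2).
  by move: frho pv tail; lra.
pose w l : R := (1 + l%:R * (l%:R + 1)) `^ s.
have w0 l : 0 <= w l by exact: powR_ge0.
have tot : \sum_(L.+1 <= l < L2) w l * energy f l <= (4 * pi)^-1 + r ^+ 2.
  rewrite -lee_fin; apply: le_trans fs; rewrite /sobolev_norm2.
  apply: le_trans (@nneseries_lim_ge _ _ xpredT 0%N L2 _); last first.
    by move=> l _ _; rewrite lee_fin mulr_ge0 ?powR_ge0 ?energy_ge0.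
  rewrite sumEFin lee_fin [leRHS](@big_cat_nat _ _ _ L.+1)//= lerDr.
  by apply: sumr_ge0 => l _; rewrite mulr_ge0 ?powR_ge0 ?energy_ge0.
apply: le_trans (ler_wpM2l (powR_ge0 _ _) tot); rewrite mulr_sumr.
rewrite big_nat_cond [leRHS]big_nat_cond; apply: ler_sum => l; rewrite andbT => /andP[Ll _].
rewrite mulrA ler_peMl ?energy_ge0//.
have lw : L%:R `^ (2 * s) <= w l.
  rewrite powRrM powR_mulrn ?ler0n//; apply: ge0_ler_powR; rewrite ?nnegrE ?(ltW s0) ?sqr_ge0//.
  have : L%:R <= l%:R :> R by rewrite ler_nat ltnW.
  nra.
rewrite mulNr powRN mulrC ler_pdivlMr ?mul1r//.
exact: powR_gt0.
Qed.

End parseval.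

(** * Second moments of U-statistics of order two *)

Section second_moments.
Context d (Omega : measurableType d) (R : realType) (P : probability Omega R).
Local Open Scope complex_scope.
Implicit Types V : Omega -> R[i].

Let Pfin := @probability_lty _ _ _ P.

Lemma chebyshev_normc V (a : R) : bmeas V -> 0 < a ->
  fine (P [set w | a <= normc (V w)]) <=
  complex.Re (cintegral P (fun w => V w * (V w)^†)) / a ^+ 2.
Proof.
move=> bV a0; have bVV : bmeas (fun w => V w * (V w)^†) by exact/bmeasM/bmeasJ.
have [i1 _] := bmeas_integrable Pfin bVV; have [mVV _ _] := bVV.
have E w : complex.Re (V w * (V w)^†) = normc (V w) ^+ 2 by rewrite mul_conj.
have a2 : 0 < a ^+ 2 by rewrite exprn_gt0.
set A := [set w | _]; have mA : measurable A.
  rewrite (_ : A = (fun w => complex.Re (V w * (V w)^†)) @^-1` `[a ^+ 2, +oo[).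
    by rewrite -[X in measurable X]setTI; apply: mVV => //; exact: measurable_itv.
  apply/seteqP; split => w /=; rewrite in_itv /= andbT E ler_sqr ?nnegrE ?normc_ge0 ?(ltW a0)//.
have -> : fine (P A) = \int[P]_w \1_A w by rewrite /Rintegral integral_indic// setIT.
rewrite ler_pdivlMr// mulrC /= -RintegralZl//; last first.
  apply: (bounded_integrable Pfin (M := 1)); first exact: measurable_indic.
  by move=> w; rewrite indicE; case: (_ \in _); rewrite ?normr1 ?normr0.
apply: le_Rintegral => //.
  apply: (bounded_integrable Pfin (M := a ^+ 2)).
    by apply: measurable_funM; [exact: measurable_cst|exact: measurable_indic].
  move=> w; rewrite normrM ger0_norm ?(ltW a2)// ler_piMr ?(ltW a2)//.
  by rewrite indicE; case: (_ \in _); rewrite ?normr1 ?normr0.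
move=> w _; rewrite E indicE; have [|_] := boolP (w \in A); last by rewrite mulr0 sqr_ge0.
by rewrite inE /A /= mulr1 => aw; rewrite ler_sqr ?nnegrE ?normc_ge0 ?(ltW a0).
Qed.

Lemma second_moment_sum (I : finType) (Q : pred I) (W : I -> Omega -> R[i]) :
  (forall i, bmeas (W i)) ->
  cintegral P (fun w => (\sum_(i | Q i) W i w) * (\sum_(i | Q i) W i w)^†) =
  \sum_(i | Q i) \sum_(j | Q j) cintegral P (fun w => W i w * (W j w)^†).
Proof.
move=> bW.
transitivity (cintegral P (fun w => \sum_(i | Q i) \sum_(j | Q j) W i w * (W j w)^†)).
  congr cintegral; apply/funext => w; rewrite mulr_suml; apply: eq_bigr => i _.
  by rewrite conjc_sum mulr_sumr.
have bWW i j : bmeas (fun w => W i w * (W j w)^†) by exact/bmeasM/bmeasJ.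
rewrite cintegral_sum//; last by move=> i; exact: bmeas_sum.
by apply: eq_bigr => i _; rewrite cintegral_sum.
Qed.

Section iid_sample.
Variable Z : nat -> Omega -> sphere R.
Hypothesis Z_bmeas : forall i u, spoly u -> bmeas (fun w => u (Z i w)).

Definition mean (u : sphere R -> R[i]) : R[i] := cintegral P (fun w => u (Z 0 w)).

(** Independence and equality of laws in one formula, stated on polynomial functions, the class to
    which the kernels belong. *)
Hypothesis Z_iid : forall N (u : nat -> sphere R -> R[i]), (forall i, spoly (u i)) ->
  cintegral P (fun w => \prod_(i < N) u i (Z i w)) = \prod_(i < N) mean (u i).

Lemma mean_cst1 : mean (fun=> 1) = 1.
Proof. by rewrite /mean cintegral_cst mul1r fine_probability_setT. Qed.

Variable N : nat.

Definition at_index (t i : nat) (u : sphere R -> R[i]) x := if t == i then u x else 1.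

(** Padding each function with 1 at the other indices ([at_index]) turns the product of four terms
    into one over the whole sample; coinciding indices then merge inside a single mean. *)
Lemma expectation4 (i j k l : 'I_N) u1 u2 u3 u4 :
  spoly u1 -> spoly u2 -> spoly u3 -> spoly u4 ->
  cintegral P (fun w => u1 (Z i w) * u2 (Z j w) * (u3 (Z k w) * u4 (Z l w))) =
  \prod_(t < N) mean (fun x => at_index t i u1 x * at_index t j u2 x *
    (at_index t k u3 x * at_index t l u4 x)).
Proof.
move=> s1 s2 s3 s4.
have sa t i' u : spoly u -> spoly (at_index t i' u).
  by move=> su; rewrite /at_index; case: eqP => // _; exact: spoly_cst.
rewrite -(Z_iid N (u := fun t x => at_index t i u1 x * at_index t j u2 x *
    (at_index t k u3 x * at_index t l u4 x))); last first.
  by move=> t; do 2 apply: spolyM; exact: sa.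
congr cintegral; apply/funext => w.
have pick (i' : 'I_N) u : \prod_(t < N) at_index t i' u (Z t w) = u (Z i' w).
  rewrite (bigD1 i')//= /at_index eqxx big1 ?mulr1// => t ti.
  by case: eqP => // /val_inj E; rewrite E eqxx in ti.
by rewrite !big_split /= !pick.
Qed.

Lemma expectation4_single (i j k l : 'I_N) u1 u2 u3 u4 :
  spoly u1 -> spoly u2 -> spoly u3 -> spoly u4 ->
  i != j -> i != k -> i != l -> mean u1 = 0 ->
  cintegral P (fun w => u1 (Z i w) * u2 (Z j w) * (u3 (Z k w) * u4 (Z l w))) = 0.
Proof.
move=> s1 s2 s3 s4 ij ik il m1; rewrite expectation4// (bigD1 i)//=.
rewrite (_ : mean _ = 0) ?mul0r// -m1 /mean; congr cintegral; apply/funext => w.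
by rewrite /at_index eqxx !val_eqE (negbTE ij) (negbTE ik) (negbTE il) !mulr1.
Qed.

Lemma expectation4_distinct (i j k l : 'I_N) u1 u2 u3 u4 :
  spoly u1 -> spoly u2 -> spoly u3 -> spoly u4 ->
  uniq [:: i; j; k; l] ->
  cintegral P (fun w => u1 (Z i w) * u2 (Z j w) * (u3 (Z k w) * u4 (Z l w))) =
  mean u1 * mean u2 * (mean u3 * mean u4).
Proof.
move=> s1 s2 s3 s4 /=; rewrite !inE !negb_or => /and4P[/and3P[ij ik il] /andP[jk jl] kl _].
rewrite expectation4//.
have at1 (t i' : 'I_N) u : at_index t i' u = if t == i' then u else fun=> 1.
  by apply/funext => x; rewrite /at_index val_eqE; case: (t == i').
have ne (x y : 'I_N) : x != y -> ((x == y) = false) * ((y == x) = false).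
  by move=> xy; rewrite [y == x]eq_sym (negbTE xy).
have nes := (ne _ _ ij, ne _ _ ik, ne _ _ il, ne _ _ jk, ne _ _ jl, ne _ _ kl).
under eq_bigr do rewrite !at1.
rewrite (bigD1 i)//= (bigD1 j) ?nes//= (bigD1 k) ?nes//= (bigD1 l) ?nes//= ?eqxx ?nes.
rewrite big1 => [|t /andP[/andP[/andP[ti tj] tk] tl]]; last first.
  rewrite (negbTE ti) (negbTE tj) (negbTE tk) (negbTE tl) -[RHS]mean_cst1.
  by congr mean; apply/funext => x; rewrite !mulr1.
by rewrite !mulrA [LHS]mulr1; congr (_ * _ * _ * _); congr mean; apply/funext => x; rewrite ?mulr1 ?mul1r.
Qed.

Lemma expectation4_pair (i j : 'I_N) u1 u2 u3 u4 :
  spoly u1 -> spoly u2 -> spoly u3 -> spoly u4 -> i != j ->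
  cintegral P (fun w => u1 (Z i w) * u2 (Z j w) * (u3 (Z i w) * u4 (Z j w))) =
  mean (fun x => u1 x * u3 x) * mean (fun x => u2 x * u4 x).
Proof.
move=> s1 s2 s3 s4 ij; rewrite expectation4//.
have at1 (t i' : 'I_N) u : at_index t i' u = if t == i' then u else fun=> 1.
  by apply/funext => x; rewrite /at_index val_eqE; case: (t == i').
under eq_bigr do rewrite !at1.
have ji : (j == i) = false by rewrite eq_sym (negbTE ij).
rewrite (bigD1 i)//= (bigD1 j) ?ji//= ?eqxx ?ji ?(negbTE ij).
rewrite big1 => [|t /andP[ti tj]]; last first.
  rewrite (negbTE ti) (negbTE tj) -[RHS]mean_cst1.
  by congr mean; apply/funext => x; rewrite !mulr1.
by rewrite mulr1; congr (_ * _); congr mean; apply/funext => x; rewrite ?mulr1 ?mul1r.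
Qed.

Variables (I : finType) (phi : I -> sphere R -> R[i]).
Hypothesis phi_spoly : forall a, spoly (phi a).

Definition kern x y := \sum_a phi a x * (phi a y)^†.

Definition ustat w := \sum_(p : 'I_N * 'I_N | (p.1 < p.2)%N) kern (Z p.1 w) (Z p.2 w).

Let bphi a i : bmeas (fun w => phi a (Z i w)).
Proof. exact: Z_bmeas. Qed.

Lemma bmeas_kern i j : bmeas (fun w => kern (Z i w) (Z j w)).
Proof. by apply: bmeas_sum => a; exact/bmeasM/bmeasJ. Qed.

Lemma bmeas_ustat : bmeas ustat.
Proof. by apply: bmeas_sum => p; exact: bmeas_kern. Qed.

Lemma kern_kern (i j k l : 'I_N) :
  cintegral P (fun w => kern (Z i w) (Z j w) * (kern (Z k w) (Z l w))^†) =
  \sum_a \sum_b cintegral P (fun w => phi a (Z i w) * (phi a (Z j w))^† *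
     ((phi b (Z k w))^† * phi b (Z l w))).
Proof.
transitivity (cintegral P (fun w => \sum_a \sum_b phi a (Z i w) * (phi a (Z j w))^† *
     ((phi b (Z k w))^† * phi b (Z l w)))).
  congr cintegral; apply/funext => w; rewrite mulr_suml; apply: eq_bigr => a _.
  by rewrite conjc_sum mulr_sumr; apply: eq_bigr => b _; rewrite conjcM conjcK.
have bb a b : bmeas (fun w => phi a (Z i w) * (phi a (Z j w))^† *
     ((phi b (Z k w))^† * phi b (Z l w))).
  apply: bmeasM; apply: bmeasM; [exact: bphi|exact/bmeasJ/bphi|exact/bmeasJ/bphi|exact: bphi].
rewrite cintegral_sum//; last by move=> a; exact: bmeas_sum.
by apply: eq_bigr => a _; rewrite cintegral_sum.
Qed.

Lemma meanJ u : spoly u -> mean (fun x => (u x)^†) = (mean u)^†.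
Proof. by move=> su; rewrite /mean cintegralJ//; exact: Z_bmeas. Qed.


Lemma card_pairs : (#|[pred p : 'I_N * 'I_N | (p.1 < p.2)%N]| <= N ^ 2)%N.
Proof. by apply: leq_trans (max_card _) _; rewrite card_prod card_ord. Qed.

(* Two different pairs of indices contribute nothing, since one of the
   indices then occurs only once. *)
Lemma ustat_degenerate : (forall a, mean (phi a) = 0) ->
  complex.Re (cintegral P (fun w => ustat w * (ustat w)^†)) <=
  N%:R ^+ 2 * \sum_a \sum_b normc (mean (fun x => phi a x * (phi b x)^†)) ^+ 2.
Proof.
move=> m0; have m0' a : mean (fun x => (phi a x)^†) = 0 by rewrite meanJ// m0 conjc0.
have sJ a : spoly (fun x => (phi a x)^†) by exact: spolyJ.
set S := \sum_a _; have S0 : 0 <= S.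
  by apply: sumr_ge0 => a _; apply: sumr_ge0 => b _; exact: sqr_ge0.
rewrite /ustat second_moment_sum; last by move=> p; exact: bmeas_kern.
have diag (p : 'I_N * 'I_N) : (p.1 < p.2)%N ->
    \sum_(q : 'I_N * 'I_N | (q.1 < q.2)%N) cintegral P (fun w =>
      kern (Z p.1 w) (Z p.2 w) * (kern (Z q.1 w) (Z q.2 w))^†) = S%:C.
  case: p => i j /= ij; have ij' : i != j by rewrite -val_eqE neq_ltn ij.
  rewrite (bigD1 (i, j))//= [X in _ + X]big1 ?addr0; last first.
    move=> [k l] /= /andP[kl]; rewrite xpair_eqE negb_and => ne.
    have kl' : k != l by rewrite -val_eqE neq_ltn kl.
    rewrite kern_kern big1// => a _; rewrite big1// => b _.
    (* The isolated index is j if i = k (then j and l differ), k if i = l (then k < i < j), and i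
       otherwise. *)
    have [ik|ik] := eqVneq i k.
      rewrite -ik in kl kl' ne *; rewrite eqxx /= in ne.
      transitivity (cintegral P (fun w => (phi a (Z j w))^† * phi a (Z i w) *
         ((phi b (Z i w))^† * phi b (Z l w)))).
        by congr cintegral; apply/funext => w; rewrite [_^† * phi a _]mulrC.
      have ji : j != i by rewrite eq_sym.
      rewrite eq_sym in ne.
      exact: (expectation4_single (sJ a) (phi_spoly a) (sJ b) (phi_spoly b) ji ji ne (m0' a)).
    have [il|il] := eqVneq i l; last first.
      exact: (expectation4_single (phi_spoly a) (sJ a) (sJ b) (phi_spoly b) ij' ik il (m0 a)).
    transitivity (cintegral P (fun w => (phi b (Z k w))^† * phi b (Z l w) *
       (phi a (Z i w) * (phi a (Z j w))^†))).
      by congr cintegral; apply/funext => w; rewrite mulrC.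
    have ki : k != i by rewrite eq_sym.
    have kj : k != j by rewrite -val_eqE neq_ltn (ltn_trans kl)// -il.
    exact: (expectation4_single (sJ b) (phi_spoly b) (phi_spoly a) (sJ a) kl' ki kj (m0' b)).
  rewrite kern_kern rmorph_sum; apply: eq_bigr => a _.
  rewrite rmorph_sum; apply: eq_bigr => b _.
  rewrite (expectation4_pair (phi_spoly a) (sJ a) (sJ b) (phi_spoly b) ij').
  apply: etrans (mul_conj _); congr (_ * _).
  rewrite -meanJ; last by apply: spolyM.
  by congr mean; apply/funext => x; rewrite conjcM conjcK.
rewrite (eq_bigr _ diag) cRe_sum /= sumr_const -[leLHS]mulr_natl -natrX.
by rewrite ler_wpM2r// ler_nat card_pairs.
Qed.

(** Two pairs without a common index have zero covariance, because the centered kernels are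
    independent. The others, of order N^3 in number, are bounded by the supremum of the kernel. *)
Lemma ustat_variance (M b : R) : (forall x y, normc (kern x y) <= M) ->
  b = \sum_a normc (mean (phi a)) ^+ 2 ->
  complex.Re (cintegral P (fun w =>
    (\sum_(p : 'I_N * 'I_N | (p.1 < p.2)%N) (kern (Z p.1 w) (Z p.2 w) - b%:C)) *
    (\sum_(p : 'I_N * 'I_N | (p.1 < p.2)%N) (kern (Z p.1 w) (Z p.2 w) - b%:C))^†)) <=
  4 * N%:R ^+ 3 * (2 * (M + b) ^+ 2).
Proof.
move=> kM bE; have sJ a : spoly (fun x => (phi a x)^†) by exact: spolyJ.
have b0 : 0 <= b by rewrite bE; apply: sumr_ge0 => a _; exact: sqr_ge0.
have bW (p : 'I_N * 'I_N) : bmeas (fun w => kern (Z p.1 w) (Z p.2 w) - b%:C).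
  by apply: bmeasB; [exact: bmeas_kern|exact: bmeas_cst].
have WM' (p : 'I_N * 'I_N) w : normc (kern (Z p.1 w) (Z p.2 w) - b%:C) <= M + b.
  by rewrite (le_trans (normc_triangle _ _))// lerD// normc_opp normc_real ger0_norm.
rewrite second_moment_sum// cRe_sum.
(* The number of coincidences: at least 1 when the pairs meet, and of total 4 N^3 over all
   couples. *)
pose c (p q : 'I_N * 'I_N) : R := (p.1 == q.1)%:R + (p.1 == q.2)%:R + (p.2 == q.1)%:R + (p.2 == q.2)%:R.
have c0 p q : 0 <= c p q by rewrite /c !addr_ge0// ler0n.
have K0 : 0 <= 2 * (M + b) ^+ 2 by rewrite mulr_ge0// sqr_ge0.
have bnd (p q : 'I_N * 'I_N) : (p.1 < p.2)%N -> (q.1 < q.2)%N ->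
    complex.Re (cintegral P (fun w => (kern (Z p.1 w) (Z p.2 w) - b%:C) *
      (kern (Z q.1 w) (Z q.2 w) - b%:C)^†)) <= c p q * (2 * (M + b) ^+ 2).
  case: p q => [i j] [k l] ij kl; rewrite /= in ij kl.
  have cE : c (i, j) (k, l) = (i == k)%:R + (i == l)%:R + (j == k)%:R + (j == l)%:R by [].
  have ij' : i != j by rewrite -val_eqE neq_ltn ij.
  have kl' : k != l by rewrite -val_eqE neq_ltn kl.
  have [/and4P[ik il jk jl]|cov] := boolP [&& i != k, i != l, j != k & j != l].
    have u4 : uniq [:: i; j; k; l] by rewrite /= !inE !negb_or ij' ik il jk jl kl'.
    rewrite cE (negbTE ik) (negbTE il) (negbTE jk) (negbTE jl) !addr0 mul0r.
    have Ek (x y : 'I_N) : x != y -> cintegral P (fun w => kern (Z x w) (Z y w)) = b%:C.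
      move=> xy; rewrite /kern cintegral_sum//; last by move=> a; exact/bmeasM/bmeasJ.
      rewrite bE rmorph_sum; apply: eq_bigr => a _.
      transitivity (cintegral P (fun w => phi a (Z x w) * (phi a (Z y w))^† * (1 * 1))).
        by congr cintegral; apply/funext => w; rewrite !mulr1.
      have := @expectation4_pair x y _ _ _ _ (phi_spoly a) (sJ a) (spoly_cst 1) (spoly_cst 1) xy.
      move=> ->; apply: etrans (mul_conj _); rewrite -meanJ//.
      by congr (mean _ * mean _); apply/funext => z; rewrite mulr1.
    have E4 : cintegral P (fun w => kern (Z i w) (Z j w) * (kern (Z k w) (Z l w))^†) = b%:C * b%:C.
      rewrite kern_kern bE rmorph_sum mulr_suml; apply: eq_bigr => a _.
      rewrite mulr_sumr; apply: eq_bigr => a' _.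
      rewrite (expectation4_distinct (phi_spoly a) (sJ a) (sJ a') (phi_spoly a') u4) !meanJ// !mul_conj.
      by rewrite [X in _ * X]mulrC mul_conj.
    rewrite (_ : cintegral _ _ = 0)//.
    have bk := bmeas_kern; pose k1 w := kern (Z i w) (Z j w); pose k2 w := kern (Z k w) (Z l w).
    transitivity (cintegral P (fun w => (k1 w * (k2 w)^† + (- b%:C) * k1 w) +
      ((- b%:C) * (k2 w)^† + b%:C * b%:C))).
      congr cintegral; apply/funext => w; rewrite -/(k1 w) -/(k2 w) conjcD.
      rewrite (_ : (- b%:C)^† = - b%:C); last by apply: complex_eq; rewrite /= ?oppr0.
      ring.
    have b1 : bmeas k1 by exact: bk. have b2 : bmeas (fun w => (k2 w)^†) by exact/bmeasJ/bk.
    rewrite cintegralD//; last 2 first.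
    - by apply: bmeasD; [exact: bmeasM|exact: bmeasZ].
    - by apply: bmeasD; [exact: bmeasZ|exact: bmeas_cst].
    rewrite cintegralD//; [|exact: bmeasM|exact: bmeasZ].
    rewrite cintegralD//; [|exact: bmeasZ|exact: bmeas_cst].
    rewrite (cintegralZ Pfin _ b1) (cintegralZ Pfin _ b2).
    have -> : cintegral P (fun w => (k2 w)^†) = b%:C.
      by rewrite (cintegralJ Pfin (bk k l)) Ek// conjc_real.
    have -> : cintegral P k1 = b%:C by exact: Ek.
    have -> : cintegral P (fun w => k1 w * (k2 w)^†) = b%:C * b%:C by exact: E4.
    by rewrite cintegral_cst fine_probability_setT; ring.
  have c1 : 1 <= c (i, j) (k, l).
    move: cov; rewrite !negb_and !negbK cE.
    by case: (i == k); case: (i == l); case: (j == k); case: (j == l) => //= _; lra.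
  apply: le_trans (_ : 2 * (M + b) ^+ 2 <= _); last by rewrite ler_peMl.
  have h := @cintegral_bound _ _ _ P Pfin (fun w => (kern (Z i w) (Z j w) - b%:C) *
      (kern (Z k w) (Z l w) - b%:C)^†) ((M + b) ^+ 2).
  rewrite fine_probability_setT mulr1 in h.
  apply: le_trans (le_trans (ler_norm _) (Re_le_normc _)) (h _ _).
    by apply: bmeasM; [exact: (bW (i, j))|apply: bmeasJ; exact: (bW (k, l))].
  move=> w; rewrite Normc.normcM normc_conj expr2 ler_pM ?normc_ge0//.
    exact: (WM' (i, j)).
  exact: (WM' (k, l)).
apply: (@le_trans _ _ (\sum_(p : 'I_N * 'I_N) \sum_(q : 'I_N * 'I_N) c p q * (2 * (M + b) ^+ 2))).
  rewrite [leRHS](bigID (fun p : 'I_N * 'I_N => (p.1 < p.2)%N)) /= -[leLHS]addr0.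
  apply: lerD; last first.
    by apply: sumr_ge0 => p _; apply: sumr_ge0 => q _; rewrite mulr_ge0.
  apply: ler_sum => p pp; rewrite cRe_sum.
  rewrite [leRHS](bigID (fun p : 'I_N * 'I_N => (p.1 < p.2)%N)) /= -[leLHS]addr0.
  apply: lerD; last by apply: sumr_ge0 => q _; rewrite mulr_ge0.
  by apply: ler_sum => q qq; exact: bnd.
have sum1 (x : 'I_N) : \sum_(y < N) ((x == y)%:R : R) = 1.
  by rewrite (bigD1 x)//= eqxx big1 ?addr0// => y yx; rewrite eq_sym (negbTE yx).
have sumc p : \sum_(q : 'I_N * 'I_N) c p q = 4 * N%:R.
  rewrite -(pair_bigA _ (fun k l => c p (k, l))) /=.
  have inner k : \sum_(l < N) c p (k, l) =
      N%:R * ((p.1 == k)%:R + (p.2 == k)%:R) + 2.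
    by rewrite /c /= !big_split /= !sumr_const card_ord !sum1; ring.
  under eq_bigr do rewrite inner.
  by rewrite big_split /= -mulr_sumr big_split /= !sum1 sumr_const card_ord; ring.
under eq_bigr do rewrite -mulr_suml sumc.
rewrite sumr_const card_prod card_ord -[leLHS]mulr_natr natrM.
by rewrite le_eqVlt; apply/orP; left; apply/eqP; ring.
Qed.

End iid_sample.
End second_moments.

(** * Operator and Frobenius norms *)

Section operator_norm.
Variables (R : realType) (n : nat).
Local Open Scope complex_scope.
Implicit Types (A B : 'M[R[i]]_n) (v : 'cV[R[i]]_n).

Lemma sum_cauchy_schwarz (I : finType) (x y : I -> R) :
  (\sum_i x i * y i) ^+ 2 <= (\sum_i x i ^+ 2) * (\sum_i y i ^+ 2).
Proof.
have h : 0 <= \sum_i \sum_j (x i * y j - x j * y i) ^+ 2.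
  by apply: sumr_ge0 => i _; apply: sumr_ge0 => j _; exact: sqr_ge0.
have e1 : \sum_i \sum_j x i ^+ 2 * y j ^+ 2 = (\sum_i x i ^+ 2) * (\sum_i y i ^+ 2).
  by rewrite mulr_suml; apply: eq_bigr => i _; rewrite mulr_sumr.
have e2 : \sum_i \sum_j x j ^+ 2 * y i ^+ 2 = (\sum_i x i ^+ 2) * (\sum_i y i ^+ 2).
  by rewrite exchange_big.
have e3 : \sum_i \sum_j (x i * y i) * (x j * y j) = (\sum_i x i * y i) ^+ 2.
  by rewrite expr2 mulr_suml; apply: eq_bigr => i _; rewrite mulr_sumr.
move: h; have -> : \sum_i \sum_j (x i * y j - x j * y i) ^+ 2 =
    \sum_i \sum_j x i ^+ 2 * y j ^+ 2 + \sum_i \sum_j x j ^+ 2 * y i ^+ 2 -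
    2 * \sum_i \sum_j (x i * y i) * (x j * y j).
  rewrite mulr_sumr -big_split -sumrB /=; apply: eq_bigr => i _.
  by rewrite mulr_sumr -big_split -sumrB /=; apply: eq_bigr => j _; ring.
by rewrite e1 e2 e3; lra.
Qed.

Definition sqnorm v : R := \sum_i normc (v i 0) ^+ 2.

Lemma sqnorm_ge0 v : 0 <= sqnorm v.
Proof. by apply: sumr_ge0 => i _; exact: sqr_ge0. Qed.

Lemma norm2_sqr v : norm2 v ^+ 2 = sqnorm v.
Proof. by rewrite sqr_sqrtr// sqnorm_ge0. Qed.

Lemma norm2_ge0 v : 0 <= norm2 v.
Proof. exact: sqrtr_ge0. Qed.

Definition frob A : R := \sum_i \sum_j normc (A i j) ^+ 2.

Lemma sqnorm_frob A v : sqnorm (A *m v) <= frob A * sqnorm v.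
Proof.
rewrite mulr_suml; apply: ler_sum => i _; rewrite mxE.
apply: le_trans (sum_cauchy_schwarz (fun j => normc (A i j)) (fun j => normc (v j 0))).
rewrite ler_sqr ?nnegrE ?normc_ge0//; last by apply: sumr_ge0 => j _; rewrite mulr_ge0 ?normc_ge0.
rewrite (le_trans (normc_sum _ _ _))//; apply: ler_sum => j _; by rewrite Normc.normcM.
Qed.

Lemma frob_ge0 A : 0 <= frob A.
Proof. by apply: sumr_ge0 => i _; apply: sumr_ge0 => j _; exact: sqr_ge0. Qed.

(** The Frobenius norm is an upper bound. This makes [opnorm] a genuine supremum rather than the
    default value of [sup]. *)
Lemma opnorm_has_sup A :
  has_sup [set norm2 (A *m v) | v in [set v | norm2 v <= 1]].
Proof.
split; first by exists (norm2 (A *m 0)), 0 => //=; rewrite /norm2 big1 ?sqrtr0// => i _;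
   rewrite mxE Normc.normc0 expr0n.
exists (Num.sqrt (frob A)) => _ [v /= v1 <-]; rewrite ler_wsqrtr//.
apply: le_trans (sqnorm_frob A v) _; rewrite ler_piMr ?frob_ge0// -norm2_sqr.
by rewrite expr_le1 ?norm2_ge0.
Qed.

Lemma sqnormZ (c : R) v : sqnorm (c%:C *: v) = c ^+ 2 * sqnorm v.
Proof.
rewrite mulr_sumr; apply: eq_bigr => i _.
by rewrite mxE Normc.normcM exprMn normc_real real_normK ?num_real.
Qed.

Lemma sqnorm_opnorm A v : sqnorm (A *m v) <= opnorm A ^+ 2 * sqnorm v.
Proof.
have [v0|v0] := eqVneq (sqnorm v) 0.
  by apply: le_trans (sqnorm_frob A v) _; rewrite v0 !mulr0.
have vp : 0 < norm2 v.
  by rewrite lt_def norm2_ge0 andbT -sqrf_eq0 norm2_sqr.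
pose u := (norm2 v)^-1%:C *: v.
have u1 : norm2 u <= 1.
  rewrite -(@expr_le1 _ 2) ?norm2_ge0// norm2_sqr sqnormZ -norm2_sqr exprVn mulVf//.
  by rewrite expf_neq0// gt_eqF.
have h : norm2 (A *m u) <= opnorm A.
  by apply: sup_upper_bound; [exact: opnorm_has_sup|exists u].
have : sqnorm (A *m u) <= opnorm A ^+ 2.
  rewrite -norm2_sqr ler_sqr ?nnegrE ?norm2_ge0//; exact: le_trans (norm2_ge0 _) h.
rewrite /u -scalemxAr sqnormZ exprVn norm2_sqr mulrC ler_pdivrMr//.
by rewrite lt_def v0 sqnorm_ge0.
Qed.

Lemma opnorm_ge0 A : 0 <= opnorm A.
Proof.
apply: le_trans (norm2_ge0 (A *m 0)) _; apply: sup_upper_bound; first exact: opnorm_has_sup.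
exists 0 => //=; rewrite /norm2 big1 ?sqrtr0// => i _; by rewrite mxE Normc.normc0 expr0n.
Qed.

Lemma frob_mulmx A B : frob (A *m B) <= opnorm A ^+ 2 * frob B.
Proof.
rewrite /frob exchange_big [X in _ * X]exchange_big mulr_sumr /=; apply: ler_sum => j _.
have -> : \sum_i normc ((A *m B) i j) ^+ 2 = sqnorm (A *m col j B).
  apply: eq_bigr => i _; rewrite !mxE; congr (normc _ ^+ 2).
  by apply: eq_bigr => k _; rewrite mxE.
have -> : \sum_i normc (B i j) ^+ 2 = sqnorm (col j B).
  by apply: eq_bigr => i _; rewrite mxE.
exact: sqnorm_opnorm.
Qed.

Lemma frob_opnorm A : frob A <= opnorm A ^+ 2 * n%:R.
Proof.
have := frob_mulmx A 1%:M; rewrite mulmx1 => /le_trans; apply.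
rewrite ler_wpM2l ?sqr_ge0// /frob (eq_bigr (fun=> 1)) ?sumr_const ?card_ord// => i _.
rewrite (bigD1 i)//= mxE eqxx Normc.normc1 expr1n big1 ?addr0// => j ji.
by rewrite mxE eq_sym (negbTE ji) Normc.normc0 expr0n.
Qed.

(* The Gram matrix of the rows of A. *)
Lemma gram_bound A :
  \sum_i \sum_j normc (\sum_k A i k * (A j k)^†) ^+ 2 <= opnorm A ^+ 4 * n%:R.
Proof.
pose B := \matrix_(i < n, j < n) ((A j i)^†).
have -> : \sum_i \sum_j normc (\sum_k A i k * (A j k)^†) ^+ 2 = frob (A *m B).
  apply: eq_bigr => i _; apply: eq_bigr => j _; rewrite mxE.
  by under [in RHS]eq_bigr do rewrite mxE.
(* B is the adjoint of A, so the Frobenius norm of A B is at most the operator norm of A times the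
   Frobenius norm of A. *)
apply: le_trans (frob_mulmx A B) _; rewrite (exprD _ 2 2) -mulrA ler_wpM2l ?sqr_ge0//.
rewrite (_ : frob B = frob A) ?frob_opnorm// /frob exchange_big /=.
by apply: eq_bigr => i _; apply: eq_bigr => j _; rewrite mxE normc_conj.
Qed.

End operator_norm.

Lemma density_integral d (T : measurableType d) (R : realType) (mu : {measure set T -> \bar R}) f :
  is_density mu f -> mu.-integrable setT (EFin \o f) /\ \int[mu]_x f x = 1.
Proof.
move=> [mf f0 f1]; split; last by rewrite /Rintegral f1.
apply/integrableP; split; first exact/measurable_EFinP.
under eq_integral do rewrite /= ger0_norm//.
by rewrite f1 ltry.
Qed.

(** * The observations Z = eps X: independence and unbiasedness *)

Section observations.
Variables (R : realType) (haar : probability (SO3 R) R).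
Variable D : forall l, SO3 R -> 'M[R[i]]_((2 * l).+1).
Hypothesis D_rot : is_rotational_harmonics D.
Variable feps : SO3 R -> R.
Hypothesis feps_density : is_density haar feps.
Context d (Omega : measurableType d).
Variables (eps : nat -> {mfun Omega >-> SO3 R}) (X : nat -> {mfun Omega >-> sphere R}).
Variable f : sphere R -> R.
Variable P : probability Omega R.
Hypothesis f_density : is_density (@surface_measure R) f.
Hypothesis P_model : noisy_model eps X haar feps f P.
Local Notation sigma := (@surface_measure R).
Local Open Scope complex_scope.

Let Pfin := @probability_lty _ _ _ P.
Let sigma_fin := surface_lty R.

Lemma eps_bmeas i (a : SO3 R -> R[i]) : bmeas a -> bmeas (fun w => a (eps i w)).
Proof. by apply: bmeas_comp; exact: measurable_funP. Qed.

Lemma X_bmeas i (b : sphere R -> R[i]) : bmeas b -> bmeas (fun w => b (X i w)).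
Proof. by apply: bmeas_comp; exact: measurable_funP. Qed.

Lemma rectangle_expectation (i : nat) A B : measurable A -> measurable B ->
  cintegral P (fun w => (\1_A (eps i w))%:C * (\1_B (X i w))%:C) =
  (fine (P (eps i @^-1` A)))%:C * (fine (P (X i @^-1` B)))%:C.
Proof.
move=> mA mB; have [_ _ ind] := P_model.
have mAi : measurable (eps i @^-1` A) by rewrite -[X in measurable X]setTI; exact: measurable_funP.
have mBi : measurable (X i @^-1` B) by rewrite -[X in measurable X]setTI; exact: measurable_funP.
rewrite (_ : (fun w => _) = fun w => (\1_(eps i @^-1` A `&` X i @^-1` B) w)%:C); last first.
  apply/funext => w; rewrite -real_complexM; congr (_%:C).
  by rewrite indicI /= !indicE; congr (_%:R * _%:R); congr nat_of_bool; apply/idP/idP; rewrite !inE.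
rewrite cintegral_indic//; last exact: measurableI.
(* Independence is available for initial segments of indices; the indices below i receive the full
   space, of probability 1. *)
pose A' j := if j == i then A else setT; pose B' j := if j == i then B else setT.
have mA' j : measurable (A' j) by rewrite /A'; case: eqP.
have mB' j : measurable (B' j) by rewrite /B'; case: eqP.
have := ind i.+1 A' B' mA' mB'.
have -> : \bigcap_(j < i.+1) (eps j @^-1` A' j `&` X j @^-1` B' j) =
    eps i @^-1` A `&` X i @^-1` B.
  apply/seteqP; split => w; first by move=> /(_ i (ltnSn i)); rewrite /A' /B' eqxx.
  by move=> [? ?] j _; rewrite /A' /B'; case: eqP => [->|_].
rewrite big_ord_recr /= big1 ?mul1e => [E|j _]; last first.
  rewrite /A' /B' (ltn_eqF (ltn_ord j)) !preimage_setT.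
  by rewrite (_ : P setT = 1%E) ?mule1// probability_setT.
rewrite /A' /B' eqxx in E.
by rewrite -real_complexM -fineM ?fin_num_measure//; congr ((fine _)%:C).
Qed.

Definition rect_gen (i : nat) (W : Omega -> R[i]) := exists A, exists B,
  [/\ measurable A, measurable B & W = fun w => (\1_A (eps i w))%:C * (\1_B (X i w))%:C].

Lemma bmeas_rect_gen i W : rect_gen i W -> bmeas W.
Proof.
move=> [A [B [mA mB ->]]]; apply: bmeasM.
  by apply: (@eps_bmeas i (fun g => (\1_A g)%:C)); apply: bmeas_indicators; exists A.
by apply: (@X_bmeas i (fun x => (\1_B x)%:C)); apply: bmeas_indicators; exists B.
Qed.

Lemma rect_gen_independent n (W : nat -> Omega -> R[i]) :
  (forall i, (i < n)%N -> rect_gen i (W i)) ->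
  cintegral P (fun w => \prod_(i < n) W i w) = \prod_(i < n) cintegral P (W i).
Proof.
move=> WB; have [_ _ ind] := P_model.
have /choice[A_ hA] : forall i, exists A, (i < n)%N -> exists B, [/\ measurable A, measurable B &
    W i = fun w => (\1_A (eps i w))%:C * (\1_B (X i w))%:C].
  move=> i; have [ni|ni] := boolP (i < n)%N; last by exists setT.
  by have [A hA] := WB i ni; exists A.
have /choice[B_ hB] : forall i, exists B, (i < n)%N -> [/\ measurable (A_ i), measurable B &
    W i = fun w => (\1_(A_ i) (eps i w))%:C * (\1_B (X i w))%:C].
  move=> i; have [ni|ni] := boolP (i < n)%N; last by exists setT.
  by have [B hB] := hA i ni; exists B.
pose A i := if (i < n)%N then A_ i else setT; pose B i := if (i < n)%N then B_ i else setT.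
have mA i : measurable (A i) by rewrite /A; case: ifP => // /hB[].
have mB i : measurable (B i) by rewrite /B; case: ifP => // /hB[].
have WE (i : 'I_n) : W i = fun w => (\1_(A i) (eps i w))%:C * (\1_(B i) (X i w))%:C.
  by rewrite /A /B ltn_ord; have [] := hB i (ltn_ord i).
have mAi i : measurable (eps i @^-1` A i).
  by rewrite -[X in measurable X]setTI; exact: measurable_funP.
have mBi i : measurable (X i @^-1` B i).
  by rewrite -[X in measurable X]setTI; exact: measurable_funP.
have -> : (fun w => \prod_(i < n) W i w) = fun w =>
    (\1_(\bigcap_(i < n) (eps i @^-1` A i `&` X i @^-1` B i)) w)%:C.
  apply/funext => w.
  have h (i : 'I_n) : W i w = (\1_(eps i @^-1` A i `&` X i @^-1` B i) w)%:C.
    rewrite WE -real_complexM; congr (_%:C).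
    by rewrite indicI /= !indicE; congr (_%:R * _%:R); congr nat_of_bool; apply/idP/idP; rewrite !inE.
  under eq_bigr do rewrite h; rewrite -rmorph_prod; congr (_%:C).
  have [hw|hw] := pselect ((\bigcap_(i < n) (eps i @^-1` A i `&` X i @^-1` B i)) w).
    rewrite indicE mem_set// big1// => i _; rewrite indicE mem_set//; exact: (hw i (ltn_ord i)).
  rewrite indicE memNset//.
  have /existsNP[i /not_implyP[ni hi]] := hw.
  by rewrite (bigD1 (Ordinal ni))//= indicE memNset ?mul0r.
rewrite cintegral_indic; last first.
  by apply: bigcap_measurableType => i _; apply: measurableI; [exact: mAi|exact: mBi].
have rE (i : 'I_n) : cintegral P (W i) =
    (fine (P (eps i @^-1` A i) * P (X i @^-1` B i)))%:C.
  rewrite (_ : cintegral P (W i) = (fine (P (eps i @^-1` A i)))%:C * (fine (P (X i @^-1` B i)))%:C).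
    by rewrite -real_complexM -fineM ?fin_num_measure.
  by rewrite WE; exact: rectangle_expectation.
rewrite (eq_bigr _ (fun i _ => rE i)) -rmorph_prod; congr (_%:C).
apply: (etrans (congr1 fine (ind n A B mA mB))).
rewrite (eq_bigr (fun i : 'I_n => (fine (P (eps i @^-1` A i) * P (X i @^-1` B i)))%:E)).
  by rewrite prodEFin.
by move=> i _; rewrite fineK// fin_numM// fin_num_measure.
Qed.

Lemma lin_comp (T T' : Type) (B : (T -> R[i]) -> Prop) (B' : (T' -> R[i]) -> Prop) (h : T' -> T) u :
  (forall b, B b -> lin B' (fun x => b (h x))) -> lin B u -> lin B' (fun x => u (h x)).
Proof.
move=> BB'; elim=> [|c b v /BB' Bb _ ih]; first exact: lin0.
by apply: linD => //; exact: linZ.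
Qed.

Definition comp_indicators d' (T : measurableType d') (h : Omega -> T) (W : Omega -> R[i]) :=
  exists2 A, measurable A & W = fun w => (\1_A (h w))%:C.

Lemma lin_comp_indicators d' (T : measurableType d') (h : Omega -> T) u :
  lin (@indicators _ T R) u -> lin (comp_indicators h) (fun w => u (h w)).
Proof.
by apply: lin_comp => _ [A mA ->]; apply: lin_gen; exists A.
Qed.

Lemma uniform_lin_comp_indicators d' (T : measurableType d') (h : Omega -> T) (u : T -> R[i]) :
  bmeas u -> uniform_lin (comp_indicators h) (fun w => u (h w)).
Proof.
move=> /bmeas_uniform_lin bu e /bu[v vl uv]; exists (fun w => v (h w)) => //.
exact: lin_comp_indicators.
Qed.

Lemma uniform_lin_pair i (a : SO3 R -> R[i]) (b : sphere R -> R[i]) : bmeas a -> bmeas b ->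
  uniform_lin (rect_gen i) (fun w => a (eps i w) * b (X i w)).
Proof.
move=> ba bb e e0; have [_ _ [Ma aM]] := ba.
have e20 : 0 < e / 2 by rewrite divr_gt0.
have Ma0 : 0 < `|Ma| + 1 by rewrite ltr_wpDl.
have [b' lb' bb'] := bmeas_uniform_lin bb (divr_gt0 e20 Ma0).
have [_ _ [Mb bM]] := bmeas_lin (@bmeas_indicators _ _ R) lb'.
have Mb0 : 0 < `|Mb| + 1 by rewrite ltr_wpDl.
(* The tolerance for a' involves the bound of b', so b' had to be chosen before it. *)
have [a' la' aa'] := bmeas_uniform_lin ba (divr_gt0 e20 Mb0).
exists (fun w => a' (eps i w) * b' (X i w)).
  apply: lin_mul (lin_comp_indicators (eps i) la') (lin_comp_indicators (X i) lb').
  by move=> _ _ [A mA ->] [B mB ->]; apply: lin_gen; exists A, B.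
move=> w; set x := eps i w; set y := X i w.
have -> : a x * b y - a' x * b' y = a x * (b y - b' y) + (a x - a' x) * b' y by ring.
rewrite (le_trans (normc_triangle _ _))// !Normc.normcM [e]splitr lerD//.
  rewrite (@le_trans _ _ ((`|Ma| + 1) * (e / 2 / (`|Ma| + 1))))//.
    by rewrite ler_pM ?normc_ge0// (le_trans (aM x))// (le_trans (ler_norm _))// lerDl.
  by rewrite mulrC divfK// gt_eqF.
rewrite (@le_trans _ _ ((e / 2 / (`|Mb| + 1)) * (`|Mb| + 1)))//.
  by rewrite ler_pM ?normc_ge0// (le_trans (bM y))// (le_trans (ler_norm _))// lerDl.
by rewrite divfK// gt_eqF.
Qed.

Lemma uniform_lin_tensor i w : lin (@tensor R) w ->
  bmeas (fun v => w (eps i v, X i v)) /\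
  uniform_lin (rect_gen i) (fun v => w (eps i v, X i v)).
Proof.
elim=> [|c _ u [a [b [ba bb ->]]] _ [ih1 ih2]].
  by split; [exact: bmeas_cst|exact/uniform_linS/lin0].
split.
  by apply: bmeasD => //; apply/bmeasZ/bmeasM; [exact: eps_bmeas|exact: X_bmeas].
by apply: uniform_linD => //; apply: uniform_linZ; exact: uniform_lin_pair.
Qed.

Lemma expectation_density d' (T : measurableType d') (h : {mfun Omega >-> T})
    (mu : {measure set T -> \bar R}) (g : T -> R) (u : T -> R[i]) :
  mu.-integrable setT (EFin \o g) -> (forall x, 0 <= g x) ->
  (forall A, measurable A -> P (h @^-1` A) = \int[mu]_(x in A) (g x)%:E)%E -> bmeas u ->
  cintegral P (fun w => u (h w)) = cintegral mu (fun x => (g x)%:C * u x).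
Proof.
move=> gi g0 PE bu.
transitivity (cintegral (distribution P h) u).
  rewrite (@cintegral_density _ Omega _ P (fun=> 1) _ _ _ (distribution P h) h)//.
  - by congr cintegral; apply/funext => w; rewrite mul1r.
  - apply: (bounded_integrable Pfin (M := 1)); first exact: measurable_cst.
    by move=> x; rewrite normr1.
  - move=> A mA; rewrite integral_cst ?mul1e//.
    by rewrite -[X in measurable X]setTI; exact: measurable_funP.
rewrite (@cintegral_density _ T _ mu g gi _ _ _ idfun)//; exact: measurable_id.
Qed.

Let feps_int : haar.-integrable setT (EFin \o feps).
Proof. exact: (density_integral feps_density).1. Qed.

Let f_int : sigma.-integrable setT (EFin \o f).
Proof. exact: (density_integral f_density).1. Qed.

Let feps_ge0 g : 0 <= feps g. Proof. by case: feps_density => _ + _; apply. Qed.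
Let f_ge0 x : 0 <= f x. Proof. by case: f_density => _ + _; apply. Qed.

Lemma eps_expectation i (a : SO3 R -> R[i]) : bmeas a ->
  cintegral P (fun w => a (eps i w)) = cintegral haar (fun g => (feps g)%:C * a g).
Proof.
have [epsE _ _] := P_model => ba.
by apply: (@expectation_density _ _ (eps i) haar feps a) => // A mA; exact: epsE.
Qed.

Lemma X_expectation i (b : sphere R -> R[i]) : bmeas b ->
  cintegral P (fun w => b (X i w)) = cintegral sigma (fun x => (f x)%:C * b x).
Proof.
have [_ XE _] := P_model => bb.
by apply: (@expectation_density _ _ (X i) sigma f b) => // A mA; exact: XE.
Qed.

(** The two-factor case of [prod_expectation_uniform_lin]: factor 0 is generated by indicators of
    [eps i], factor 1 by those of [X i]. *)
Lemma pair_expectation i (a : SO3 R -> R[i]) (b : sphere R -> R[i]) : bmeas a -> bmeas b ->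
  cintegral P (fun w => a (eps i w) * b (X i w)) =
  cintegral haar (fun g => (feps g)%:C * a g) * cintegral sigma (fun x => (f x)%:C * b x).
Proof.
move=> ba bb; rewrite -(eps_expectation i ba) -(X_expectation i bb).
pose B j := if j is 0%N then comp_indicators (eps i) else comp_indicators (X i).
pose W j : Omega -> R[i] := if j is 0%N then fun w => a (eps i w) else fun w => b (X i w).
have BE j W' : B j W' -> bmeas W'.
  case: j => [|j] [A mA ->].
    by apply: (@eps_bmeas i (fun g => (\1_A g)%:C)); apply: bmeas_indicators; exists A.
  by apply: (@X_bmeas i (fun g => (\1_A g)%:C)); apply: bmeas_indicators; exists A.
have := @prod_expectation_uniform_lin _ _ _ P 2 B BE _ W.
rewrite !big_ord_recl !big_ord0 /= mulr1 => <-.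
- by congr cintegral; apply/funext => w; rewrite !big_ord_recl big_ord0 /= mulr1.
- move=> W' hW; rewrite !big_ord_recl big_ord0 mulr1 /=.
  have [A mA AE] := hW 0%N isT; have [A' mA' A'E] := hW 1%N isT.
  have mA1 : measurable (eps i @^-1` A).
    by rewrite -[X in measurable X]setTI; exact: measurable_funP.
  have mA'1 : measurable (X i @^-1` A').
    by rewrite -[X in measurable X]setTI; exact: measurable_funP.
  transitivity (cintegral P (fun w => (\1_A (eps i w))%:C * (\1_A' (X i w))%:C)).
    congr cintegral; apply/funext => w; rewrite !big_ord_recl big_ord0 mulr1 /=.
    by rewrite AE A'E.
  rewrite rectangle_expectation//; congr (_ * _).
    by apply: etrans (esym (cintegral_indic P mA1)) _; rewrite AE.
  by apply: etrans (esym (cintegral_indic P mA'1)) _; rewrite A'E.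
- by move=> [|[|//]] _; split; [exact: eps_bmeas|exact: uniform_lin_comp_indicators
    |exact: X_bmeas|exact: uniform_lin_comp_indicators].
Qed.

Lemma tensor_expectation i w : lin (@tensor R) w ->
  cintegral P (fun v => w (eps i v, X i v)) = cintegral P (fun v => w (eps 0 v, X 0 v)).
Proof.
elim=> [//|c _ u [a [b [ba bb ->]]] su ih].
have h j : cintegral P (fun v => c * (a (eps j v) * b (X j v)) + u (eps j v, X j v)) =
    c * (cintegral haar (fun g => (feps g)%:C * a g) * cintegral sigma (fun x => (f x)%:C * b x)) +
    cintegral P (fun v => u (eps j v, X j v)).
  have bab : bmeas (fun v => a (eps j v) * b (X j v)).
    by apply: bmeasM; [exact: eps_bmeas|exact: X_bmeas].
  rewrite cintegralD//; [|exact: bmeasZ|exact: (uniform_lin_tensor j su).1].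
  by rewrite (cintegralZ Pfin _ bab) pair_expectation.
by rewrite (h i) (h 0%N) ih.
Qed.

Local Notation Z := (fun i w => observation eps X i w).

Lemma observation_bmeas i u : spoly u -> bmeas (fun w => u (Z i w)).
Proof. by move=> /tensor_rot su; exact: (uniform_lin_tensor i su).1. Qed.

(** Each u(eps_i X_i) is a tensor, hence a uniform limit of combinations of rectangle indicators in
    (eps_i, X_i), on which independence holds by assumption. *)
Lemma observation_iid N (u : nat -> sphere R -> R[i]) : (forall i, spoly (u i)) ->
  cintegral P (fun w => \prod_(i < N) u i (Z i w)) = \prod_(i < N) mean P Z (u i).
Proof.
move=> su.
rewrite (@prod_expectation_uniform_lin _ _ _ P N rect_gen bmeas_rect_gen
  (@rect_gen_independent N) (fun i w => u i (Z i w))); last first.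
  by move=> i _; exact: (uniform_lin_tensor i (tensor_rot (su i))).
by apply: eq_bigr => i _; exact: (tensor_expectation i (tensor_rot (su i))).
Qed.

Let F := rot_fourier haar D feps.

(** The convolution theorem: expand the rotated harmonic through D and separate [eps] from [X] by
    independence. *)
Lemma mean_Ylm l (m : 'I_((2 * l).+1)) :
  mean P Z (fun x => (Ylm m x)^†) = \sum_n F l m n * sph_coef f l n 0.
Proof.
rewrite /mean /=.
have bD (n : 'I_((2 * l).+1)) : bmeas (fun g => D l g m n) by exact: D_bmeas.
have bY (n : 'I_((2 * l).+1)) : bmeas (fun x => (@Ylm R l n x)^†) by exact/bmeasJ/bmeas_Ylm.
transitivity (cintegral P (fun w => \sum_n D l (eps 0 w) m n * (Ylm n (X 0 w))^†)).
  by congr cintegral; apply/funext => w; rewrite -Ylm_rot_conj.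
rewrite cintegral_sum//; last first.
  move=> n; apply: bmeasM; first exact: (eps_bmeas 0 (bD n)).
  exact: (X_bmeas 0 (bY n)).
apply: eq_bigr => n _; rewrite (pair_expectation 0 (bD n) (bY n)) sph_coefE.
by rewrite mxE.
Qed.

Hypothesis F_unit : forall l, F l \in unitmx.

(** Deconvolution: the inverse Fourier matrix undoes [mean_Ylm], so [Phi] estimates the coefficients
    of f without bias. *)
Lemma mean_Phi l (m : 'I_((2 * l).+1)) : mean P Z (Phi F m) = sph_coef f l m 0.
Proof.
have bY (n : 'I_((2 * l).+1)) : bmeas (fun w => (Ylm n (Z 0 w))^†).
  by apply: (@observation_bmeas 0 (fun x => (Ylm n x)^†)); apply/spolyJ/lin_gen; exists l, n.
have -> : mean P Z (Phi F m) = \sum_n invmx (F l) m n * mean P Z (fun x => (Ylm n x)^†).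
  rewrite /mean /Phi cintegral_sum//; last by move=> n; exact: (bmeasZ _ (bY n)).
  by apply: eq_bigr => n _; exact: (cintegralZ Pfin _ (bY n)).
transitivity ((invmx (F l) *m (F l *m sph_coef f l)) m 0); last by rewrite mulKmx.
rewrite mxE; apply: eq_bigr => n _; congr (_ * _); rewrite mean_Ylm mxE.
by [].
Qed.

End observations.

(** * Expectations when the X_i are uniform *)

Section mean_under_uniform.
Variables (R : realType) (haar : probability (SO3 R) R).
Variable D : forall l, SO3 R -> 'M[R[i]]_((2 * l).+1).
Hypothesis D_rot : is_rotational_harmonics D.
Variable feps : SO3 R -> R.
Hypothesis feps_density : is_density haar feps.
Context d (Omega : measurableType d).
Variables (eps : nat -> {mfun Omega >-> SO3 R}) (X : nat -> {mfun Omega >-> sphere R}).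
Variable P : probability Omega R.
Hypothesis P_model : noisy_model eps X haar feps (@uniform_density R) P.
Local Notation sigma := (@surface_measure R).
Local Notation Z := (fun i w => observation eps X i w).
Local Open Scope complex_scope.

Let Pfin := @probability_lty _ _ _ P.
Let sigma_fin := surface_lty R.
Let u0 : R[i] := ((4 * pi)^-1 : R)%:C.

Lemma uniform_is_density : is_density sigma (@uniform_density R).
Proof.
have pi4 : 0 < 4 * pi :> R by rewrite mulr_gt0// pi_gt0.
split; [exact: measurable_cst|by move=> x; rewrite invr_ge0 ltW|].
rewrite (_ : (fun x : sphere R => (uniform_density x)%:E) = cst ((4 * pi)^-1 : R)%:E)//.
rewrite integral_cst// -[X in (_ * X)%E]fineK; last by rewrite ge0_fin_numE.
by rewrite [X in (_ * X%:E)%E]surface_total -EFinM mulVf// gt_eqF.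
Qed.

Let udens := uniform_is_density.

Lemma tensor_expectation_uniform w : lin (@tensor R) w ->
  cintegral P (fun v => w (eps 0 v, X 0 v)) =
  cintegral haar (fun g => (feps g)%:C * (u0 * cintegral sigma (fun x => w (g, x)))).
Proof.
have [fi f1] := density_integral feps_density.
have haar0 : cintegral haar (fun g => (feps g)%:C * 0) = 0.
  by under eq_fun do rewrite mulr0; rewrite cintegral_cst mul0r.
elim=> [|c _ v [a [b [ba bb ->]]] sv ih].
  rewrite cintegral_cst mul0r; under eq_fun do rewrite cintegral_cst mul0r mulr0.
  by rewrite haar0.
have bab : bmeas (fun v => a (eps 0 v) * b (X 0 v)).
  exact: (bmeasM (eps_bmeas eps 0 ba) (X_bmeas X 0 bb)).
rewrite (cintegralD Pfin); [|exact: (bmeasZ c bab)|exact: (uniform_lin_tensor eps X 0 sv).1].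
rewrite (cintegralZ Pfin _ bab) (pair_expectation feps_density udens P_model 0 ba bb) ih.
have -> : cintegral sigma (fun x => (uniform_density x)%:C * b x) = u0 * cintegral sigma b.
  exact: (@cintegralZ _ _ _ sigma sigma_fin u0 _ bb).
set K := u0 * _.
have [bv1 bv2] := bmeas_tensor_integral sv.
transitivity (cintegral haar (fun g => (feps g)%:C *
    (c * (a g * K) + u0 * cintegral sigma (fun x => v (g, x))))); last first.
  congr cintegral; apply/funext => g; congr (_ * _) => /=.
  rewrite (cintegralD sigma_fin); [|exact/bmeasZ/bmeasZ|exact: bv1].
  rewrite (cintegralZ sigma_fin _ (bmeasZ _ bb)) (cintegralZ sigma_fin _ bb) /K; ring.
have baK : bmeas (fun g => a g * K) by apply: bmeasM => //; exact: bmeas_cst.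
rewrite (weighted_cintegralP fi _ baK (bmeasZ _ bv2)); congr (_ * _ + _).
transitivity (cintegral haar (fun g => (feps g)%:C * (K * a g + 0))).
  by rewrite (weighted_cintegralP fi _ ba (bmeas_cst _ 0)) haar0 addr0 mulrC.
by congr cintegral; apply/funext => g; congr (_ * _); rewrite addr0 mulrC.
Qed.

(** Whatever the law of the noise, the integral over x does not depend on the rotation
    ([integral_rot]), and [feps] integrates to 1. *)
Lemma mean_uniform u : spoly u -> mean P Z u = u0 * cintegral sigma u.
Proof.
move=> su; apply: etrans (tensor_expectation_uniform (tensor_rot su)) _ => /=.
under eq_fun do rewrite (integral_rot D_rot _ su).
have [fi f1] := density_integral feps_density.
have haar0 : cintegral haar (fun g => (feps g)%:C * 0) = 0.
  by under eq_fun do rewrite mulr0; rewrite cintegral_cst mul0r.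
set K := u0 * _.
transitivity (cintegral haar (fun g => (feps g)%:C * (K * 1 + 0))).
  by congr cintegral; apply/funext => g; rewrite mulr1 addr0.
rewrite (weighted_cintegralP fi _ (bmeas_cst _ 1) (bmeas_cst _ 0)) haar0 addr0.
under eq_fun do rewrite mulr1.
by rewrite cintegral_real f1 mulr1.
Qed.

End mean_under_uniform.

(** * The statistic as a U-statistic, with bounds on its kernel *)

Section statistic.
Variables (R : realType) (F : forall l, 'M[R[i]]_((2 * l).+1)) (L : nat).
Local Notation sigma := (@surface_measure R).
Local Open Scope complex_scope.

(** Element l of ['I_L] stands for degree l + 1, so the degrees are 1 to L; as a finite type it can
    index the kernel [kern]. *)
Definition harm_index := {l : 'I_L & 'I_((2 * l.+1).+1)}.

HB.instance Definition _ := Finite.on harm_index.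

Definition phi (a : harm_index) : sphere R -> R[i] := Phi F (tagged a).

Lemma sum_harm_index (V : nmodType) (g : forall l, 'I_((2 * l).+1) -> V) :
  \sum_(a : harm_index) g (tag a).+1 (tagged a) =
  \sum_(1 <= l < L.+1) \sum_(m < (2 * l).+1) g l m.
Proof.
rewrite big_add1 big_mkord /= (@sig_big_dep _ _ _ 'I_L (fun l : 'I_L => 'I_((2 * l.+1).+1)) xpredT
  (fun _ => xpredT) (fun l m => g l.+1 m)).
by [].
Qed.

Lemma T_statE N (Z : nat -> sphere R) :
  T_stat F N Z L = 2 / (N%:R * (N%:R - 1)) *
    \sum_(p : 'I_N * 'I_N | (p.1 < p.2)%N) kern phi (Z p.1) (Z p.2).
Proof.
rewrite /T_stat /kern exchange_big /=.
rewrite (sum_harm_index (fun l m => \sum_(p : 'I_N * 'I_N | (p.1 < p.2)%N)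
   Phi F m (Z p.1) * (Phi F m (Z p.2))^†)) mulr_sumr.
apply: eq_bigr => l _; rewrite mulr_sumr; apply: eq_bigr => m _; congr (_ * _).
rewrite -(pair_big_dep xpredT (fun i j : 'I_N => (i < j)%N)
  (fun i j => Phi F m (Z i) * (Phi F m (Z j))^†)) /=.
rewrite [RHS](exchange_big_dep xpredT)//=; apply: eq_bigr => j _.
by rewrite (big_ord_widen N (fun i => Phi F m (Z i) * (Phi F m (Z j))^†))// ltnW.
Qed.

Lemma pairs_count N : \sum_(p : 'I_N * 'I_N | (p.1 < p.2)%N) (1 : R[i]) = N%:R * (N%:R - 1) / 2.
Proof.
rewrite -(pair_big_dep xpredT (fun i j : 'I_N => (i < j)%N) (fun _ _ => 1)) /=.
rewrite (exchange_big_dep xpredT)//=.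
transitivity (\sum_(j < N) (j%:R : R[i])).
  apply: eq_bigr => j _; rewrite -(big_ord_widen N (fun=> 1))//; last exact: ltnW.
  by rewrite sumr_const card_ord.
elim: N => [|N ih]; first by rewrite big_ord0 !mul0r.
by rewrite big_ord_recr /= ih -natr1; field.
Qed.

Definition kern_bound : R :=
  \sum_(1 <= l < L.+1) opnorm (invmx (F l)) ^+ 2 * ((2 * l + 1)%:R / (4 * pi)).

Lemma Phi_mulmx l (m : 'I_((2 * l).+1)) x :
  Phi F m x = (invmx (F l) *m \col_n (Ylm n x)^†) m 0.
Proof. by rewrite mxE; apply: eq_bigr => n _; rewrite mxE. Qed.

Variable D : forall l, SO3 R -> 'M[R[i]]_((2 * l).+1).
Hypothesis D_rot : is_rotational_harmonics D.

(** In each degree, [Phi] is the inverse Fourier matrix applied to the vector of conjugate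
    harmonics, whose squared length is known by the addition theorem. *)
Lemma phi_sqnorm x : \sum_a normc (phi a x) ^+ 2 <= kern_bound.
Proof.
rewrite (sum_harm_index (fun l m => normc (Phi F m x) ^+ 2)).
apply: ler_sum => l _.
rewrite -(addition_theorem D_rot l x).
have -> : \sum_(m < (2 * l).+1) normc (Ylm m x) ^+ 2 = sqnorm (\col_n (@Ylm R l n x)^†).
  by apply: eq_bigr => m _; rewrite mxE normc_conj.
apply: le_trans (sqnorm_opnorm _ _).
rewrite le_eqVlt; apply/orP; left; apply/eqP; by apply: eq_bigr => m _; rewrite Phi_mulmx.
Qed.

Lemma kern_le_bound x y : normc (kern phi x y) <= kern_bound.
Proof.
apply: le_trans (normc_sum _ _ _) _.
have h a : normc (phi a x * (phi a y)^†) <= 2^-1 * (normc (phi a x) ^+ 2 + normc (phi a y) ^+ 2).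
  rewrite Normc.normcM normc_conj.
  have := sqr_ge0 (normc (phi a x) - normc (phi a y)); rewrite sqrrB; lra.
apply: le_trans (ler_sum _ (fun a _ => h a)) _; rewrite -mulr_sumr big_split /=.
have := phi_sqnorm x; have := phi_sqnorm y; lra.
Qed.

Lemma kern_bound_ge0 : 0 <= kern_bound.
Proof.
apply: sumr_ge0 => l _; rewrite mulr_ge0 ?sqr_ge0// divr_ge0// ?ler0n//.
by rewrite mulr_ge0// pi_ge0.
Qed.

Lemma Phi_inner l l' (m : 'I_((2 * l).+1)) (m' : 'I_((2 * l').+1)) :
  cintegral sigma (fun x => Phi F m x * (Phi F m' x)^†) =
  \sum_n \sum_n' invmx (F l) m n * (invmx (F l') m' n')^† * ((l' == l) && (n' == n :> nat))%:R.
Proof.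
have bY k (n : 'I_((2 * k).+1)) : bmeas (@Ylm R k n) by exact: bmeas_Ylm.
have bYY (n : 'I_((2 * l).+1)) (n' : 'I_((2 * l').+1)) :
    bmeas (fun x => @Ylm R l' n' x * (@Ylm R l n x)^†).
  exact/bmeasM/bmeasJ.
transitivity (cintegral sigma (fun x => \sum_n \sum_n'
    invmx (F l) m n * (invmx (F l') m' n')^† * (@Ylm R l' n' x * (@Ylm R l n x)^†))).
  congr cintegral; apply/funext => x; rewrite /Phi mulr_suml; apply: eq_bigr => n _.
  rewrite conjc_sum mulr_sumr; apply: eq_bigr => n' _.
  by rewrite conjcM !conjE conjcK; ring.
rewrite (cintegral_sum (surface_lty R)); last first.
  by move=> n; apply: bmeas_sum => n'; exact: bmeasZ.
apply: eq_bigr => n _; rewrite (cintegral_sum (surface_lty R)); last first.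
  by move=> n'; exact: bmeasZ.
by apply: eq_bigr => n' _; rewrite (cintegralZ (surface_lty R) _ (bYY n n')) Ylm_orthonormal.
Qed.

Lemma spoly_phi a : spoly (phi a).
Proof.
by apply: lin_sum => n; apply/linZ/spolyJ/lin_gen; exists (tag a).+1, n.
Qed.

Definition gram_sum : R :=
  \sum_(1 <= l < L.+1) (4 * pi)^-1 ^+ 2 * (opnorm (invmx (F l)) ^+ 4 * (2 * l).+1%:R).

(** Different degrees are orthogonal. Within one degree the inner products are those of the rows of
    the inverse Fourier matrix, to which [gram_bound] applies. *)
Lemma phi_gram : \sum_a \sum_b
  normc (((4 * pi)^-1 : R)%:C * cintegral sigma (fun x => phi a x * (phi b x)^†)) ^+ 2 <= gram_sum.
Proof.
pose g l l' (m : 'I_((2 * l).+1)) (m' : 'I_((2 * l').+1)) : R :=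
  normc (((4 * pi)^-1 : R)%:C * cintegral sigma (fun x => Phi F m x * (Phi F m' x)^†)) ^+ 2.
have gE l (m m' : 'I_((2 * l).+1)) : g l l m m' = (4 * pi)^-1 ^+ 2 *
    normc (\sum_n invmx (F l) m n * (invmx (F l) m' n)^†) ^+ 2.
  rewrite /g Normc.normcM exprMn normc_real real_normK ?num_real//; congr (_ * normc _ ^+ 2).
  rewrite Phi_inner; apply: eq_bigr => n _; rewrite (bigD1 n)//= !eqxx mulr1 big1 ?addr0// => n' nn'.
  by rewrite val_eqE (negbTE nn') mulr0.
have g0 l l' m m' : l != l' -> g l l' m m' = 0.
  move=> ll'; rewrite /g Phi_inner big1 ?mulr0 ?Normc.normc0 ?expr0n// => n _.
  by rewrite big1// => n' _; rewrite eq_sym (negbTE ll') mulr0.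
rewrite (eq_bigr (fun a : harm_index => \sum_(b : harm_index) g (tag a).+1 (tag b).+1 (tagged a) (tagged b)))//.
have inner l (m : 'I_((2 * l).+1)) : (0 < l <= L)%N ->
    \sum_(b : harm_index) g l (tag b).+1 m (tagged b) = \sum_m' g l l m m'.
  move=> lL; rewrite (sum_harm_index (fun l' m' => g l l' m m')).
  rewrite (bigD1_seq l) ?iota_uniq ?mem_index_iota//=.
  rewrite [X in _ + X]big1 ?addr0// => l' l'l; rewrite big1// => m' _.
  by rewrite g0// eq_sym.
rewrite (sum_harm_index (fun l m => \sum_(b : harm_index) g l (tag b).+1 m (tagged b))).
rewrite big_nat_cond /gram_sum [leRHS]big_nat_cond; apply: ler_sum => l; rewrite andbT ltnS => lL.
under eq_bigr do rewrite inner//.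
have := gram_bound (invmx (F l)) => /(ler_wpM2l (sqr_ge0 ((4 * pi)^-1 : R))); apply: le_trans.
rewrite le_eqVlt; apply/orP; left; apply/eqP; rewrite mulr_sumr; apply: eq_bigr => m _; rewrite mulr_sumr; apply: eq_bigr => m' _.
exact: gE.
Qed.

End statistic.

(** * Chebyshev bounds for the statistic at fixed N and L *)

Section test_statistic_deviation.
Variables (R : realType) (haar : probability (SO3 R) R).
Variable D : forall l, SO3 R -> 'M[R[i]]_((2 * l).+1).
Hypothesis D_rot : is_rotational_harmonics D.
Variable feps : SO3 R -> R.
Hypothesis feps_density : is_density haar feps.
Context d (Omega : measurableType d).
Variables (eps : nat -> {mfun Omega >-> SO3 R}) (X : nat -> {mfun Omega >-> sphere R}).
Variables (f : sphere R -> R) (P : probability Omega R).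
Hypothesis f_density : is_density (@surface_measure R) f.
Hypothesis P_model : noisy_model eps X haar feps f P.
Local Notation F := (rot_fourier haar D feps).
Hypothesis F_unit : forall l, F l \in unitmx.
Variables N L : nat.
Hypothesis N_gt1 : (1 < N)%N.
Local Notation Z := (fun i w => observation eps X i w).
Local Open Scope complex_scope.

Let Pfin := @probability_lty _ _ _ P.
Let cN : R := 2 / (N%:R * (N%:R - 1)).
Let Zb := @observation_bmeas R d Omega eps X.
Let Ziid := @observation_iid R haar feps feps_density d Omega eps X f P f_density P_model.
Let T w := T_stat F N (fun i => Z i w) L.

Let cNE : 2 / (N%:R * (N%:R - 1)) = cN%:C :> R[i].
Proof. by rewrite /cN rmorphM fmorphV rmorphM rmorphB !rmorph_nat. Qed.

Let TE w : T w = cN%:C * ustat Z N (@phi R F L) w.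
Proof. by rewrite /T T_statE cNE. Qed.

Lemma bmeas_T_stat : bmeas (fun w => T_stat F N (fun i => observation eps X i w) L).
Proof.
rewrite (_ : (fun _ => _) = fun w => cN%:C * ustat Z N (@phi R F L) w).
  by apply/bmeasZ/bmeas_ustat => //; exact: spoly_phi.
by apply/funext => w; exact: TE.
Qed.

Lemma second_moment_scale (c : R) V : bmeas V ->
  complex.Re (cintegral P (fun w => (c%:C * V w) * (c%:C * V w)^†)) =
  c ^+ 2 * complex.Re (cintegral P (fun w => V w * (V w)^†)).
Proof.
move=> bV; have bVV : bmeas (fun w => V w * (V w)^†) by exact/bmeasM/bmeasJ.
rewrite -cRe_realM -(cintegralZ Pfin _ bVV); congr (complex.Re (cintegral _ _)).
by apply/funext => w; rewrite conjcM conjc_real real_complexM; ring.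
Qed.

Lemma T_stat_uniform (t : R) : f = @uniform_density R -> 0 < t ->
  fine (P [set w | t <= normc (T_stat F N (fun i => observation eps X i w) L)]) <=
  cN ^+ 2 * (N%:R ^+ 2 * gram_sum F L) / t ^+ 2.
Proof.
move=> fu t0; have bT := bmeas_T_stat.
apply: le_trans (chebyshev_normc P bT t0) _.
rewrite ler_wpM2r ?invr_ge0 ?sqr_ge0//.
rewrite (_ : (fun w => _) = fun w => (cN%:C * ustat Z N (@phi R F L) w) *
   (cN%:C * ustat Z N (@phi R F L) w)^†); last by apply/funext => w; rewrite -TE.
have sphi := @spoly_phi R F L.
rewrite second_moment_scale; last exact: bmeas_ustat.
rewrite ler_wpM2l ?sqr_ge0//.
have P_model0 : noisy_model eps X haar feps (@uniform_density R) P by rewrite -fu.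
have mu := mean_uniform D_rot feps_density P_model0.
apply: le_trans (ustat_degenerate Zb Ziid N sphi _) _ => [a|].
  rewrite (mean_Phi D_rot feps_density f_density P_model F_unit).
  rewrite sph_coefE fu.
  transitivity (((4 * pi)^-1 : R)%:C * cintegral (@surface_measure R) (fun x => (Ylm (tagged a) x)^†)).
    exact: (@cintegralZ _ _ _ _ (surface_lty R) (((4 * pi)^-1 : R)%:C) _
      (bmeasJ (@bmeas_Ylm R _ (tagged a)))).
  rewrite (cintegralJ (surface_lty R)); last exact: bmeas_Ylm.
  by rewrite integral_Ylm_gt0// conjc0 mulr0.
rewrite ler_wpM2l ?exprn_ge0 ?ler0n//; apply: le_trans (phi_gram F L).
rewrite le_eqVlt; apply/orP; left; apply/eqP.
apply: eq_bigr => a _; apply: eq_bigr => b _; rewrite mu//.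
exact: (spolyM (sphi a) (spolyJ (sphi b))).
Qed.

Lemma T_stat_deviation (k : R) : 0 < k ->
  let b := \sum_(1 <= l < L.+1) energy f l in
  fine (P [set w | k <= normc (T_stat F N (fun i => observation eps X i w) L - b%:C)]) <=
  cN ^+ 2 * (4 * N%:R ^+ 3 * (2 * (kern_bound F L + b) ^+ 2)) / k ^+ 2.
Proof.
move=> k0; set b := \sum_(1 <= l < L.+1) _ => /=; have sphi := @spoly_phi R F L.
have bTb : bmeas (fun w => T w - b%:C).
  by apply: bmeasB; [exact: bmeas_T_stat|exact: bmeas_cst].
apply: le_trans (chebyshev_normc P bTb k0) _.
rewrite ler_wpM2r ?invr_ge0 ?sqr_ge0//.
pose V w := \sum_(p : 'I_N * 'I_N | (p.1 < p.2)%N) (kern (@phi R F L) (Z p.1 w) (Z p.2 w) - b%:C).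
(* There are N(N-1)/2 pairs and N > 1, so the normalization spreads b evenly over them. *)
have VE w : T w - b%:C = cN%:C * V w.
  rewrite TE /V /ustat sumrB mulrBr; congr (_ - _).
  under eq_bigr do rewrite -[b%:C]mulr1.
  rewrite -mulr_sumr pairs_count -cNE; field.
  have NR n : (n%:R == 0 :> R[i]) = (n == 0%N) by rewrite pnatr_eq0.
  rewrite NR -[X in _ - X]/(1%:R) -natrB ?NR; lia.
rewrite (_ : (fun w => _) = fun w => (cN%:C * V w) * (cN%:C * V w)^†); last first.
  by apply/funext => w; rewrite -VE.
rewrite second_moment_scale; last first.
  apply: bmeas_sum => p; apply: bmeasB; last exact: bmeas_cst.
  exact: (bmeas_kern Zb sphi).
rewrite ler_wpM2l ?sqr_ge0//.
rewrite /V; apply: (ustat_variance Zb Ziid N sphi); first exact: (kern_le_bound F L D_rot).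
rewrite (sum_harm_index L (fun l m => normc (mean P Z (Phi F m)) ^+ 2)).
apply: eq_bigr => l _; apply: eq_bigr => m _.
by rewrite (mean_Phi D_rot feps_density f_density P_model F_unit).
Qed.

End test_statistic_deviation.

(** * Powers against exponentials *)

Section asymptotics.
Variable R : realType.
Implicit Types a b c e k p x y : R.

(** With an integer n >= p, expR(k x) is at least (k x / (n + 1))^(n + 1), which beats x^n by one
    power of x. *)
Lemma powR_expR_le p k e : 0 < k -> 0 < e ->
  exists X, forall x, X <= x -> x `^ p * expR (- (k * x)) <= e.
Proof.
move=> k0 e0; pose n := (Num.truncn p).+1; pose q : R := k / n.+1%:R.
have q0 : 0 < q by rewrite divr_gt0.
have eq0 : 0 < e * q ^+ n.+1 by rewrite mulr_gt0// exprn_gt0.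
exists (1 + (e * q ^+ n.+1)^-1) => x Xx.
have x1 : 1 <= x by apply: le_trans Xx; rewrite lerDl invr_ge0 ltW.
have x2 : 1 <= e * q ^+ n.+1 * x.
  by rewrite -ler_pdivrMl// mulr1 (le_trans _ Xx)// lerDr.
have pn : p <= n%:R by exact/ltW/truncnS_gt.
have x0 : 0 <= x by exact: le_trans x1.
rewrite expRN ler_pdivrMr ?expR_gt0//.
apply: le_trans (ler_powR x1 pn) _; rewrite powR_mulrn//.
have h : (q * x) ^+ n.+1 <= expR (k * x).
  have -> : k * x = q * x * n.+1%:R by rewrite /q; field.
  have qx0 : 0 <= q * x by apply: mulr_ge0 => //; exact: ltW.
  rewrite expRM_natr; apply: lerXn2r; rewrite ?nnegrE ?expR_ge0//.
  by apply: le_trans (expR_ge1Dx _); rewrite lerDr.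
apply: le_trans (ler_wpM2l (ltW e0) h).
rewrite exprMn [x ^+ n.+1]exprS mulrA mulrA ler_peMl ?exprn_ge0//.
Qed.

Lemma powR_le_abs p x y : 1 <= x -> x <= y -> x `^ p <= y `^ `|p|.
Proof.
move=> x1 xy; apply: (@le_trans _ _ (x `^ `|p|)).
  by rewrite ler_powR// ler_norm.
by rewrite ge0_ler_powR ?nnegrE// (le_trans ler01)// (le_trans x1).
Qed.

Lemma powR_half_le p x y : 0 < y -> y <= 2 * x -> x <= y -> x `^ p <= 2 `^ `|p| * y `^ p.
Proof.
move=> y0 yx xy; have x0 : 0 < x by lra.
have [p0|p0] := leP 0 p.
  rewrite (@le_trans _ _ (y `^ p))//.
    by apply: ge0_ler_powR; rewrite ?nnegrE// ltW.
  by rewrite ler_peMl ?powR_ge0// -[leLHS](powRr0 2) ler_powR ?normr_ge0 ?ler1n.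
rewrite ltr0_norm//; have [r r0 ->] : exists2 r, 0 <= r & p = - r by exists (- p); rewrite ?opprK ?oppr_ge0 ?ltW.
rewrite opprK !powRN ler_pdivlMr ?powR_gt0// mulrC ler_pdivrMr ?powR_gt0//.
rewrite -powRM ?(ltW x0)//; apply: ge0_ler_powR => //; rewrite ?nnegrE ?mulr_ge0 ?(ltW x0) ?(ltW y0)//.
Qed.

(** Bounding all L terms by the last one gives only a constant factor. The gain comes from the
    exponential: outside the last fraction 1/n of the degrees the terms are exponentially smaller
    than the last one, and inside it there are at most L/n terms. *)
Lemma weighted_sum_negligible a c b e : 0 < c -> 0 < b -> 0 < e ->
  exists L0, forall L, (L0 <= L)%N ->
  \sum_(1 <= l < L.+1) l%:R `^ a * expR (c * l%:R `^ b) <=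
  e * (L%:R `^ (a + 1) * expR (c * L%:R `^ b)).
Proof.
move=> c0 b0 e0; set K : R := 2 `^ `|a|.
have K0 : 0 < K by exact: powR_gt0.
(* K compares l^a with L^a on [L/2, L], whatever the sign of a; the last block then costs at most K
   / n. *)
have [n n_gt1 nK] : exists2 n : nat, (1 < n)%N & K / n%:R <= e / 2.
  exists (Num.truncn (2 * K / e)).+2 => //.
  have h : 2 * K / e < (Num.truncn (2 * K / e)).+2%:R.
    by rewrite (lt_trans (truncnS_gt _))// ltr_nat.
  rewrite ltr_pdivrMr// in h; rewrite ler_pdivrMr//; lra.
have n_gt0 : (0 < n)%N by exact: ltnW.
have n0 : 0 < n%:R :> R by rewrite ltr0n.
(* The last block has m >= L / (2n) terms, so every degree below it is at most t L. *)
pose t : R := 1 - (2 * n%:R)^-1.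
have n1 : (2 * n%:R)^-1 < 1 :> R.
  by rewrite invf_lt1 ?mulr_gt0// -natrM ltr1n mul2n -addnn (leq_trans n_gt1)// leq_addr.
have n2 : 0 < (2 * n%:R)^-1 :> R by rewrite invr_gt0 mulr_gt0.
have t0 : 0 < t by rewrite /t; lra.
have t1 : t < 1 by rewrite /t; lra.
have tb : t `^ b < 1.
  by have := gt0_ltr_powR b0 (ltW t0) ler01 t1; rewrite powR1.
pose k := c * (1 - t `^ b); have k0 : 0 < k by rewrite mulr_gt0// subr_gt0.
have e20 : 0 < e / 2 by rewrite divr_gt0.
have [X hX] := powR_expR_le ((`|a| - a) / b) k0 e20.
exists (maxn n (Num.truncn (`|X| `^ b^-1)).+1) => L; rewrite geq_max => /andP[nL XL].
have L_gt0 : (0 < L)%N by exact: leq_trans nL.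
have L0 : 0 < L%:R :> R by rewrite ltr0n.
have L1 : 1 <= L%:R :> R by rewrite ler1n.
have [m [mL m1 m2]] : exists m, [/\ (m <= L)%N, m%:R * n%:R <= L%:R :> R &
    L%:R <= 2 * n%:R * m%:R :> R].
  exists (L %/ n)%N; rewrite leq_div -!natrM !ler_nat leq_trunc_div {1}(divn_eq L n); split => //.
  have m_gt0 : (0 < L %/ n)%N by rewrite divn_gt0.
  rewrite (leq_trans (leq_add (leqnn _) (ltnW (ltn_pmod L n_gt0))))//.
  by rewrite addnC -mulSn -mulnA [(n * _)%N]mulnC mulnA leq_mul2r mul2n -addnn -addn1 leq_add2l m_gt0 orbT.
have subE : (L - m)%:R = L%:R - m%:R :> R by rewrite natrB.
rewrite (@big_cat_nat _ _ _ (L - m).+1)//= ?ltnS ?leq_subr//.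
have -> : e * (L%:R `^ (a + 1) * expR (c * L%:R `^ b)) =
   e / 2 * (L%:R `^ (a + 1) * expR (c * L%:R `^ b)) +
   e / 2 * (L%:R `^ (a + 1) * expR (c * L%:R `^ b)) by rewrite -mulrDl -splitr.
have powa1 : L%:R `^ (a + 1) = L%:R * L%:R `^ a :> R.
  by rewrite addrC powRD ?powRr1 ?(ltW L0)// (gt_eqF L0) implybT.
apply: lerD.
  apply: (@le_trans _ _ (\sum_(1 <= l < (L - m).+1) L%:R `^ `|a| * expR (c * (t * L%:R) `^ b))).
    rewrite big_nat_cond [leRHS]big_nat_cond; apply: ler_sum => l; rewrite andbT ltnS => /andP[l1 lL].
    have lR : l%:R <= L%:R - m%:R :> R by rewrite -subE ler_nat.
    have lt : l%:R <= t * L%:R :> R.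
      rewrite (le_trans lR)// /t mulrBl mul1r lerD2l lerN2 mulrC ler_pdivrMr ?mulr_gt0//.
      by rewrite mulrC.
    apply: ler_pM; rewrite ?powR_ge0 ?expR_ge0//.
      by apply: powR_le_abs; rewrite ?ler1n// ler_nat (leq_trans lL)// leq_subr.
    rewrite ler_expR ler_pM2l//; apply: ge0_ler_powR; rewrite ?nnegrE ?ler0n ?(ltW b0)//.
    by rewrite mulr_ge0 ?ler0n ?ltW.
  rewrite sumr_const_nat subn1 /= -[leLHS]mulr_natl.
  apply: (@le_trans _ _ (L%:R * (L%:R `^ `|a| * expR (c * (t * L%:R) `^ b)))).
    by rewrite ler_wpM2r ?mulr_ge0 ?powR_ge0 ?expR_ge0// ler_nat leq_subr.
  have XLb : X <= L%:R `^ b.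
    have h : `|X| `^ b^-1 <= L%:R.
      by apply/ltW; apply: lt_le_trans (truncnS_gt _) _; rewrite ler_nat.
    apply: (le_trans (ler_norm _)).
    have -> : `|X| = (`|X| `^ b^-1) `^ b by rewrite -powRrM mulVf ?powRr1 ?lt0r_neq0.
    by apply: ge0_ler_powR; rewrite ?nnegrE ?powR_ge0 ?ler0n ?(ltW b0).
  have E : (L%:R `^ b) `^ ((`|a| - a) / b) = L%:R `^ (`|a| - a).
    by rewrite -(powRrM L%:R b) [b * _]mulrC divfK// lt0r_neq0.
  have := hX _ XLb; rewrite E => h.
  rewrite powa1 -[L%:R * _ * _]mulrA [leRHS]mulrCA ler_pM2l//.
  have -> : L%:R `^ `|a| = L%:R `^ (`|a| - a) * L%:R `^ a :> R.
    by rewrite -powRD ?subrK// (gt_eqF L0) implybT.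
  have -> : c * (t * L%:R) `^ b = - (k * L%:R `^ b) + c * L%:R `^ b.
    by rewrite powRM ?ltW// /k; ring.
  rewrite expRD [leLHS](_ : _ = L%:R `^ (`|a| - a) * expR (- (k * L%:R `^ b)) *
     (L%:R `^ a * expR (c * L%:R `^ b))); last by ring.
  by rewrite ler_wpM2r ?mulr_ge0 ?powR_ge0 ?expR_ge0.
apply: (@le_trans _ _ (\sum_((L - m).+1 <= l < L.+1) K * L%:R `^ a * expR (c * L%:R `^ b))).
  rewrite big_nat_cond [leRHS]big_nat_cond; apply: ler_sum => l; rewrite andbT ltnS => /andP[l1 lL].
  have lR : L%:R - m%:R <= l%:R :> R by rewrite -subE ler_nat ltnW.
  have n2' : 2 <= n%:R :> R by rewrite ler_nat.
  have lL' : l%:R <= L%:R :> R by rewrite ler_nat.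
  have m0 : 0 <= m%:R :> R by rewrite ler0n.
  apply: ler_pM; rewrite ?powR_ge0 ?expR_ge0//.
    apply: powR_half_le => //; nra.
  by rewrite ler_expR ler_pM2l//; apply: ge0_ler_powR; rewrite ?nnegrE ?ler0n ?(ltW b0).
rewrite sumr_const_nat subSS subKn// -[leLHS]mulr_natl powa1.
have mn : m%:R <= L%:R / n%:R :> R by rewrite ler_pdivlMr.
have E0 : 0 <= L%:R `^ a * expR (c * L%:R `^ b) :> R by rewrite mulr_ge0 ?powR_ge0 ?expR_ge0.
rewrite -[K * _ * _]mulrA -![_ * L%:R `^ a * _]mulrA !mulrA -[X in X <= _]mulrA -[X in _ <= X]mulrA.
rewrite ler_wpM2r//.
rewrite (@le_trans _ _ (L%:R / n%:R * K))//; first by rewrite ler_wpM2r// ltW.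
rewrite [leRHS]mulrC -mulrA ler_wpM2l ?ler0n// mulrC; exact: nK.
Qed.

Lemma ln_nat_large X : exists N0, forall N : nat, (N0 <= N)%N -> X <= ln (N%:R : R).
Proof.
exists (Num.truncn (expR X)).+1 => N NN.
rewrite -[leLHS]expRK ler_ln ?posrE ?expR_gt0 ?ltr0n ?(leq_trans _ NN)//.
by apply/ltW; apply: lt_le_trans (truncnS_gt _) _; rewrite ler_nat.
Qed.

End asymptotics.

(** * Size of the truncation level and of the kernel bounds *)

Section test_asymptotics.
Variable R : realType.
Variables (delta beta : R).
Hypotheses (delta_gt0 : 0 < delta) (beta_gt0 : 0 < beta).
Implicit Types N L : nat.

Local Notation Lst := (L_star delta beta).

Lemma near_ln_large (X : R) : \forall N \near \oo, X <= ln (N%:R : R).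
Proof. by have [N0 h] := ln_nat_large X; exists N0. Qed.

Lemma L_star_le_root N : (0 < N)%N -> (Lst N)%:R <= (delta * ln N%:R / 8) `^ beta^-1.
Proof. by move=> N0; rewrite truncn_le// powR_ge0. Qed.

Lemma ln_nat_ge0 N : 0 <= ln (N%:R : R).
Proof.
case: N => [|N]; first by rewrite ln0.
by rewrite ln_ge0// ler1n.
Qed.

Lemma L_star_powR_le N : (0 < N)%N -> (Lst N)%:R `^ beta <= delta * ln N%:R / 8.
Proof.
move=> N0; have z0 : 0 <= delta * ln N%:R / 8.
  by rewrite divr_ge0// mulr_ge0 ?ln_nat_ge0// ltW.
have -> : delta * ln N%:R / 8 = ((delta * ln N%:R / 8) `^ beta^-1) `^ beta.
  by rewrite -powRrM mulVf ?powRr1// lt0r_neq0.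
by apply: ge0_ler_powR; rewrite ?nnegrE ?powR_ge0 ?ler0n ?(ltW beta_gt0) ?L_star_le_root.
Qed.

(** Replacing 8 by 16 shrinks the root by the factor g = 2^(1/beta) > 1; the gap grows with N and
    eventually exceeds the loss of at most 1 due to the integer part. *)
Lemma near_L_star_ge : \forall N \near \oo,
  (delta * ln N%:R / 16) `^ beta^-1 <= (Lst N)%:R.
Proof.
pose g : R := 2 `^ beta^-1.
have g1 : 1 < g.
  have bi : 0 < beta^-1 by rewrite invr_gt0.
  by have := gt0_ltr_powR bi ler01 (ler0n R 2) (ltr1n R 2); rewrite powR1; apply.
near=> N.
have x0 := ln_nat_ge0 N.
set z := delta * ln N%:R / 16.
have z0 : 0 <= z by rewrite divr_ge0// mulr_ge0// ltW.
have E : (delta * ln N%:R / 8) `^ beta^-1 = g * z `^ beta^-1.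
  by rewrite -powRM//; congr (_ `^ _); rewrite /z; field.
have h : (g - 1)^-1 <= z `^ beta^-1.
  have zX : ((g - 1)^-1) `^ beta <= z.
    rewrite /z ler_pdivlMr// -ler_pdivrMl//.
    near: N; exact: near_ln_large.
  have -> : (g - 1)^-1 = (((g - 1)^-1) `^ beta) `^ beta^-1.
    by rewrite -powRrM mulfV ?powRr1 ?lt0r_neq0// invr_ge0 subr_ge0 ltW.
  by apply: ge0_ler_powR; rewrite ?nnegrE ?powR_ge0 ?invr_ge0 ?(ltW beta_gt0).
rewrite -div1r ler_pdivrMr ?subr_gt0// in h.
have := truncnS_gt ((delta * ln N%:R / 8) `^ beta^-1).
rewrite -/(Lst N) E -natr1; move: h; set w := z `^ _; nra.
Unshelve. all: by end_near. Qed.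

Lemma near_L_star_large (m : nat) : \forall N \near \oo, (m <= Lst N)%N.
Proof.
near=> N; rewrite -(ler_nat R).
have h : (delta * ln N%:R / 16) `^ beta^-1 <= (Lst N)%:R by near: N; exact: near_L_star_ge.
apply: le_trans h.
have -> : m%:R = (m%:R `^ beta) `^ beta^-1 :> R.
  by rewrite -powRrM mulfV ?powRr1 ?lt0r_neq0.
apply: ge0_ler_powR; rewrite ?nnegrE ?powR_ge0 ?invr_ge0 ?(ltW beta_gt0)//.
  by rewrite divr_ge0// mulr_ge0 ?ln_nat_ge0// ltW.
rewrite ler_pdivlMr// -ler_pdivrMl//.
by near: N; exact: near_ln_large.
Unshelve. all: by end_near. Qed.

Lemma L_star_power_le (p : R) N : (0 < N)%N -> (0 < Lst N)%N ->
  (Lst N)%:R `^ p <= (delta / 8) `^ (`|p| / beta) * ln N%:R `^ (`|p| / beta).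
Proof.
move=> N0 L0; have x0 := ln_nat_ge0 N.
have d8 : 0 <= delta / 8 by rewrite divr_ge0// ltW.
rewrite -powRM// [delta / 8 * _]mulrAC [`|p| / beta]mulrC powRrM.
by apply: powR_le_abs; rewrite ?ler1n// L_star_le_root.
Qed.

Lemma expR_ln_nat N : (0 < N)%N -> expR (ln N%:R) = N%:R :> R.
Proof. by move=> N0; rewrite lnK// posrE ltr0n. Qed.

(** The constant 8 in [L_star] serves here: the inverse noise spectrum costs at most N^(1/4). *)
Lemma expR_L_star N : (0 < N)%N ->
  expR (2 * (Lst N)%:R `^ beta / delta) <= expR (ln N%:R / 4).
Proof.
move=> N0; rewrite ler_expR ler_pdivrMr//; have := L_star_powR_le N0; lra.
Qed.

Variables (F : forall l, 'M[R[i]]_((2 * l).+1)) (nu0 d0 : R).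
Hypothesis d0_gt0 : 0 < d0.
Hypothesis F_inv : forall l : nat, (1 <= l)%N ->
  opnorm (invmx (F l)) <= d0^-1 * l%:R `^ (- nu0) * expR (l%:R `^ beta / delta).

Lemma dim_le l : (0 < l)%N -> (2 * l + 1)%:R <= 3 * l%:R :> R.
Proof. by move=> l0; rewrite -natrM ler_nat; lia. Qed.

Lemma powR_exp (x a : R) n : (x `^ a) ^+ n = x `^ (a * n%:R).
Proof. by rewrite powRrM powR_mulrn ?powR_ge0. Qed.

Lemma opnorm_inv_exp l n : (0 < l)%N -> opnorm (invmx (F l)) ^+ n <=
  d0^-1 ^+ n * l%:R `^ (- nu0 * n%:R) * expR (n%:R / delta * l%:R `^ beta).
Proof.
move=> l0; apply: le_trans (_ : _ <= (d0^-1 * l%:R `^ (- nu0) * expR (l%:R `^ beta / delta)) ^+ n) _.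
  by apply: lerXn2r; rewrite ?nnegrE ?opnorm_ge0 ?F_inv// !mulr_ge0 ?invr_ge0 ?powR_ge0 ?expR_ge0 ?ltW.
rewrite !exprMn powR_exp -expRM_natr le_eqVlt; apply/orP; left; apply/eqP.
by congr (_ * _ * expR _); field; rewrite lt0r_neq0.
Qed.

Lemma gram_sum_le : exists2 G : R, 0 < G & forall L, gram_sum F L <=
  G * \sum_(1 <= l < L.+1) l%:R `^ (1 - 4 * nu0) * expR (4 / delta * l%:R `^ beta).
Proof.
have pi4 : 0 < (4 * pi)^-1 :> R by rewrite invr_gt0 mulr_gt0// pi_gt0.
exists ((4 * pi)^-1 ^+ 2 * (d0^-1 ^+ 4 * 3)).
  by rewrite !mulr_gt0// ?exprn_gt0// invr_gt0.
move=> L; rewrite /gram_sum mulr_sumr big_nat_cond [leRHS]big_nat_cond; apply: ler_sum => l.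
rewrite andbT => /andP[l0 _]; rewrite -[leRHS]mulrA ler_wpM2l ?sqr_ge0//.
have h := opnorm_inv_exp 4 l0; have hd := dim_le l0; rewrite addn1 in hd.
have l0R : 0 < l%:R :> R by rewrite ltr0n.
have -> : l%:R `^ (1 - 4 * nu0) = l%:R * l%:R `^ (- nu0 * 4) :> R.
  rewrite (_ : 1 - 4 * nu0 = 1 + - nu0 * 4); last by ring.
  by rewrite powRD ?powRr1 ?ler0n// (gt_eqF l0R) implybT.
apply: le_trans (ler_pM _ _ h hd) _; rewrite ?exprn_ge0 ?opnorm_ge0 ?ler0n//.
by rewrite le_eqVlt; apply/orP; left; apply/eqP; ring.
Qed.

(** A crude bound, with each of the L terms replaced by its maximum; [|nu0|] covers both signs of
    [nu0]. Powers of L are only logarithms of N at [L_star]. *)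
Lemma kern_bound_le : exists2 G : R, 0 < G & forall L, (0 < L)%N -> kern_bound F L <=
  G * L%:R `^ (2 * `|nu0| + 2) * expR (2 * L%:R `^ beta / delta).
Proof.
have pi4 : 0 < (4 * pi)^-1 :> R by rewrite invr_gt0 mulr_gt0// pi_gt0.
exists (d0^-1 ^+ 2 * (3 * (4 * pi)^-1)).
  by rewrite !mulr_gt0// ?exprn_gt0// invr_gt0.
move=> L L0; have L0R : 0 < L%:R :> R by rewrite ltr0n.
apply: (@le_trans _ _ (\sum_(1 <= l < L.+1) d0^-1 ^+ 2 * L%:R `^ (2 * `|nu0|) *
    expR (2 / delta * L%:R `^ beta) * (3 * L%:R * (4 * pi)^-1))).
  rewrite /kern_bound big_nat_cond [leRHS]big_nat_cond; apply: ler_sum => l.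
  rewrite andbT ltnS => /andP[l0 lL]; have lLR : l%:R <= L%:R :> R by rewrite ler_nat.
  apply: ler_pM; rewrite ?exprn_ge0 ?opnorm_ge0 ?mulr_ge0 ?ler0n ?(ltW pi4)//.
    apply: le_trans (opnorm_inv_exp 2 l0) _.
    apply: ler_pM; rewrite ?mulr_ge0 ?exprn_ge0 ?invr_ge0 ?powR_ge0 ?expR_ge0 ?(ltW d0_gt0)//.
      rewrite ler_wpM2l ?exprn_ge0 ?invr_ge0 ?(ltW d0_gt0)//.
      have := @powR_le_abs R (- nu0 * 2) l%:R L%:R; rewrite normrM normrN (ger0_norm (ler0n _ 2)).
      by rewrite [`|nu0| * 2]mulrC; apply; rewrite ?ler1n.
    rewrite ler_expR ler_wpM2l ?divr_ge0 ?(ltW delta_gt0)//.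
    by apply: ge0_ler_powR; rewrite ?nnegrE ?ler0n ?(ltW beta_gt0).
  rewrite ler_wpM2r ?(ltW pi4)// (le_trans (dim_le l0))// ler_wpM2l//.
rewrite sumr_const_nat subn1 /= -[leLHS]mulr_natl powRD; last by rewrite (gt_eqF L0R) implybT.
rewrite (powR_mulrn 2) ?ler0n//.
rewrite le_eqVlt; apply/orP; left; apply/eqP.
have -> : 2 / delta * L%:R `^ beta = 2 * L%:R `^ beta / delta by ring.
by move: (expR _) (_ `^ _) pi4 => E p _; ring.
Qed.

End test_asymptotics.

(** * Limits of the variance bounds along the chosen truncation level *)

Section error_rates.
Variable R : realType.
Variables (delta beta : R).
Hypotheses (delta_gt0 : 0 < delta) (beta_gt0 : 0 < beta).
Variables (F : forall l, 'M[R[i]]_((2 * l).+1)) (nu0 d0 : R).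
Hypothesis d0_gt0 : 0 < d0.
Hypothesis F_inv : forall l : nat, (1 <= l)%N ->
  opnorm (invmx (F l)) <= d0^-1 * l%:R `^ (- nu0) * expR (l%:R `^ beta / delta).
Implicit Types N L : nat.

Local Notation Lst := (L_star delta beta).
Local Notation tsq N := (t_sq nu0 delta beta N (Lst N)).
Let cN N : R := 2 / (N%:R * (N%:R - 1)).

Lemma cN_sqr_le N : (1 < N)%N -> cN N ^+ 2 <= 16 / N%:R ^+ 4.
Proof.
move=> N1; have N2 : 2 <= N%:R :> R by rewrite ler_nat.
have N0 : 0 < N%:R :> R by lra.
have h : cN N <= 4 / N%:R ^+ 2.
  rewrite /cN ler_pdivlMr ?exprn_gt0// mulrAC ler_pdivrMr; nra.
have -> : 16 / N%:R ^+ 4 = (4 / N%:R ^+ 2) ^+ 2 :> R by field; rewrite lt0r_neq0.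
apply: lerXn2r => //; rewrite nnegrE ?divr_ge0 ?exprn_ge0 ?ler0n//.
by rewrite mulr_ge0 ?ler0n// subr_ge0; lra.
Qed.

Lemma tsq_gt0 N : (0 < N)%N -> (0 < Lst N)%N -> 0 < tsq N.
Proof.
move=> N0 L0; rewrite /t_sq divr_gt0 ?ltr0n// mulr_gt0 ?expR_gt0//.
by rewrite powR_gt0// ltr0n.
Qed.

(** The powers of N cancel against those in the squared threshold, leaving the ratio of [gram_sum]
    to U, which tends to 0 with L by [weighted_sum_negligible]. *)
Lemma near_type1_bound (k e : R) : 0 < k -> 0 < e -> \forall N \near \oo,
  cN N ^+ 2 * (N%:R ^+ 2 * gram_sum F (Lst N)) / (k * tsq N) ^+ 2 <= e.
Proof.
move=> k0 e0; have [G G0 gramG] := gram_sum_le delta_gt0 beta_gt0 d0_gt0 F_inv.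
have c0 : 0 < 4 / delta by rewrite divr_gt0.
have e1 : 0 < e * k ^+ 2 / (16 * G) by rewrite !divr_gt0 ?mulr_gt0// exprn_gt0.
have [L0 hL0] := weighted_sum_negligible (1 - 4 * nu0) c0 beta_gt0 e1.
near=> N.
have N1 : (1 < N)%N by near: N; exact: nbhs_infty_ge.
have N0 : (0 < N)%N by exact: ltnW.
have NR : 0 < N%:R :> R by rewrite ltr0n.
have L1 : (1 <= Lst N)%N by near: N; exact: near_L_star_large.
have LL0 : (L0 <= Lst N)%N by near: N; exact: near_L_star_large.
have kt : 0 < k * tsq N by apply: mulr_gt0 => //; exact: tsq_gt0.
rewrite ler_pdivrMr ?exprn_gt0//.
pose U : R := (Lst N)%:R `^ (1 - 4 * nu0 + 1) * expR (4 / delta * (Lst N)%:R `^ beta).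
have tE : tsq N ^+ 2 = U / N%:R ^+ 2.
  rewrite /t_sq /U !exprMn exprVn powR_exp -expRM_natr.
  by congr (_ `^ _ * expR _ / _); [ring|field; rewrite lt0r_neq0].
have gU : gram_sum F (Lst N) <= G * (e * k ^+ 2 / (16 * G) * U).
  by apply: le_trans (gramG _) _; rewrite ler_pM2l// hL0.
rewrite [(k * _) ^+ 2]exprMn tE.
have g0 : 0 <= gram_sum F (Lst N).
  apply: sumr_ge0 => l _; rewrite mulr_ge0 ?sqr_ge0// mulr_ge0 ?ler0n// exprn_ge0//.
  exact: opnorm_ge0.
apply: le_trans (ler_wpM2r _ (cN_sqr_le N1)) _; first by rewrite mulr_ge0 ?sqr_ge0.
apply: le_trans (ler_wpM2l _ (ler_wpM2l _ gU)) _; rewrite ?divr_ge0 ?sqr_ge0 ?exprn_ge0 ?ler0n//.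
rewrite le_eqVlt; apply/orP; left; apply/eqP.
by clearbody U; field; rewrite !lt0r_neq0.
Unshelve. all: by end_near. Qed.

Lemma near_ln_power_exp (p k e : R) : 0 < k -> 0 < e ->
  \forall N \near \oo, ln N%:R `^ p * expR (- (k * ln N%:R)) <= e.
Proof.
move=> k0 e0; have [X hX] := powR_expR_le p k0 e0.
near=> N; apply: hX; near: N; exact: near_ln_large.
Unshelve. all: by end_near. Qed.

(** By [expR_L_star] the threshold is at most a power of log N times N^(-3/4), below any power of
    log N. *)
Lemma near_tsq_psi (s : R) : \forall N \near \oo, tsq N <= psi s beta N.
Proof.
pose q := `|- 2 * nu0 + 1| / beta; pose c := (delta / 8) `^ q.
have c0 : 0 < c by apply: powR_gt0; exact: divr_gt0.
have k0 : 0 < 3 / 4 :> R by [].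
have e0 : 0 < c^-1 by rewrite invr_gt0.
near=> N.
have N0 : (0 < N)%N by near: N; exact: nbhs_infty_ge.
have L1 : (1 <= Lst N)%N by near: N; exact: near_L_star_large.
have x0 : 0 < ln (N%:R : R).
  by apply: (@lt_le_trans _ _ 1) => //; near: N; exact: near_ln_large.
have h : ln N%:R `^ (q + 2 * s / beta) * expR (- (3 / 4 * ln N%:R)) <= c^-1.
  by near: N; exact: near_ln_power_exp.
rewrite /psi; have -> : - 2 * s / beta = - (2 * s / beta) by rewrite !mulNr.
rewrite powRN -div1r ler_pdivlMr ?powR_gt0//.
have NE : N%:R = expR (ln N%:R) :> R by rewrite expR_ln_nat.
rewrite /t_sq [X in _ / X]NE -expRN.
apply: le_trans (_ : c * ln N%:R `^ q * expR (ln N%:R / 4) * expR (- ln N%:R) * ln N%:R `^ (2 * s / beta) <= _).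
  rewrite ler_wpM2r ?powR_ge0// ler_wpM2r ?expR_ge0//.
  apply: ler_pM; rewrite ?powR_ge0 ?expR_ge0//; first exact: L_star_power_le.
  exact: expR_L_star.
move: h; rewrite powRD; last by rewrite (gt_eqF x0) implybT.
have -> : - (3 / 4 * ln N%:R) = ln N%:R / 4 - ln N%:R :> R by field.
rewrite expRD -[leRHS]div1r ler_pdivlMr//; apply: le_trans.
by rewrite le_eqVlt; apply/orP; left; apply/eqP; ring.
Unshelve. all: by end_near. Qed.

(** The variance is at most 128 (M + b)^2 / N with M the kernel bound, and M^2 is N^(1/2) up to
    logarithms, so N^(-1/2) is left against a power of log N. The threshold on N depends on B and
    not on b. *)
Lemma near_type2_bound (s k B e : R) : 0 < k -> 0 <= B -> 0 < e -> \forall N \near \oo,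
  forall b, 0 <= b <= B ->
  cN N ^+ 2 * (4 * N%:R ^+ 3 * (2 * (kern_bound F (Lst N) + b) ^+ 2)) / (k * psi s beta N) ^+ 2 <= e.
Proof.
move=> k0 B0 e0; have [G G0 kG] := kern_bound_le delta_gt0 beta_gt0 d0_gt0 F_inv.
pose q := (2 * `|nu0| + 2); have q0 : 0 <= q by rewrite addr_ge0// mulr_ge0.
pose c := (delta / 8) `^ (q / beta).
have c0 : 0 < c by apply: powR_gt0; exact: divr_gt0.
pose C := 128 * (G + B) ^+ 2 * c ^+ 2 / k ^+ 2.
have GB : 0 < G + B by rewrite ltr_wpDr.
have C0 : 0 < C by rewrite divr_gt0 ?mulr_gt0 ?exprn_gt0.
have e1 : 0 < e / C by rewrite divr_gt0.
have k2 : 0 < 2^-1 :> R by rewrite invr_gt0.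
near=> N => b /andP[b0 bB].
have N1 : (1 < N)%N by near: N; exact: nbhs_infty_ge.
have N0 : (0 < N)%N by exact: ltnW.
have L1 : (1 <= Lst N)%N by near: N; exact: near_L_star_large.
have x0 : 0 < ln (N%:R : R).
  by apply: (@lt_le_trans _ _ 1) => //; near: N; exact: near_ln_large.
have h : ln N%:R `^ (q / beta * 2 + 2 * s / beta * 2) * expR (- (2^-1 * ln N%:R)) <= e / C.
  by near: N; exact: near_ln_power_exp.
set x := ln N%:R in x0 h *.
have NE : N%:R = expR x by rewrite expR_ln_nat.
have psiE : psi s beta N = (x `^ (2 * s / beta))^-1.
  by rewrite /psi -powRN; congr (_ `^ _); rewrite !mulNr.
set y := x `^ (2 * s / beta) in psiE.
have y0 : 0 < y by exact: powR_gt0.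
have Mb : kern_bound F (Lst N) + b <= (G + B) * (c * x `^ (q / beta) * expR (x / 4)).
  have hL : (Lst N)%:R `^ q <= c * x `^ (q / beta).
    by have := L_star_power_le delta_gt0 q N0 L1; rewrite ger0_norm.
  have hE := @expR_L_star R delta beta delta_gt0 beta_gt0 N N0; rewrite -/x in hE.
  have LR : 1 <= (Lst N)%:R :> R by rewrite ler1n.
  have E1 : 1 <= (Lst N)%:R `^ q * expR (2 * (Lst N)%:R `^ beta / delta).
    rewrite -[leLHS]mulr1; apply: ler_pM => //.
      by rewrite -[leLHS](powRr0 (Lst N)%:R) ler_powR.
    by rewrite -expR0 ler_expR divr_ge0 ?mulr_ge0 ?powR_ge0// ltW.
  apply: (@le_trans _ _ ((G + B) * ((Lst N)%:R `^ q * expR (2 * (Lst N)%:R `^ beta / delta)))).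
    rewrite mulrDl lerD//; first by rewrite mulrA kG.
    by rewrite (le_trans bB)// ler_peMr.
  by rewrite ler_pM2l//; apply: ler_pM; rewrite ?powR_ge0 ?expR_ge0.
set M := kern_bound F (Lst N) + b in Mb *.
have M0 : 0 <= M.
  apply: addr_ge0 => //; exact: kern_bound_ge0.
rewrite ler_pdivrMr ?exprn_gt0 ?mulr_gt0 ?psiE ?invr_gt0//.
apply: le_trans (ler_wpM2r _ (cN_sqr_le N1)) _.
  by rewrite !mulr_ge0 ?exprn_ge0 ?ler0n.
have M2 : M ^+ 2 <= ((G + B) * (c * x `^ (q / beta) * expR (x / 4))) ^+ 2.
  by apply: lerXn2r; rewrite // nnegrE ?(le_trans M0 Mb).
have E2 : expR (x / 4) ^+ 2 = expR (- (2^-1 * x)) * expR x.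
  by rewrite -expRM_natr -expRD; congr expR; field.
have xE : x `^ (q / beta * 2 + 2 * s / beta * 2) = (x `^ (q / beta)) ^+ 2 * y ^+ 2.
  by rewrite powRD ?(gt_eqF x0) ?implybT// !powR_exp.
rewrite ler_pdivlMr// /C xE in h.
have n0 : 0 < N%:R :> R by rewrite ltr0n.
rewrite NE in n0 *; move: n0 M2; set n := expR x in E2 *; set z := x `^ _ in h *.
rewrite !exprMn E2; move: h; set E := expR (- _) => h n0 M2.
have -> : 16 / n ^+ 4 * (4 * n ^+ 3 * (2 * M ^+ 2)) = 128 / n * M ^+ 2.
  by field; rewrite lt0r_neq0.
apply: le_trans (ler_wpM2l _ M2) _; first by rewrite divr_ge0// ltW.
have -> : 128 / n * ((G + B) ^+ 2 * (c ^+ 2 * z ^+ 2 * (E * n))) =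
   (z ^+ 2 * y ^+ 2 * E * (128 * (G + B) ^+ 2 * c ^+ 2 / k ^+ 2)) * (k ^+ 2 * y^-1 ^+ 2).
  by field; rewrite !lt0r_neq0.
by rewrite ler_wpM2r//; apply: mulr_ge0; exact: sqr_ge0.
Unshelve. all: by end_near. Qed.

Lemma near_L_star_bias (s : R) : 0 < s -> \forall N \near \oo,
  (Lst N)%:R `^ (- 2 * s) <= (delta / 16) `^ (- 2 * s / beta) * psi s beta N.
Proof.
move=> s0; near=> N.
have h : (delta * ln N%:R / 16) `^ beta^-1 <= (Lst N)%:R by near: N; exact: near_L_star_ge.
have x0 : 0 < ln (N%:R : R).
  by apply: (@lt_le_trans _ _ 1) => //; near: N; exact: near_ln_large.
have d16 : 0 < delta / 16 by rewrite divr_gt0.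
rewrite /psi -powRM ?(ltW d16) ?(ltW x0)// [delta / 16 * _]mulrAC.
have z0 : 0 < delta * ln N%:R / 16 by rewrite mulrAC mulr_gt0.
rewrite (_ : - 2 * s / beta = beta^-1 * - (2 * s)); last by ring.
rewrite (powRrM _ beta^-1) (_ : - 2 * s = - (2 * s)); last by ring.
have w0 : 0 < (delta * ln N%:R / 16) `^ beta^-1 by exact: powR_gt0.
have L0 : 0 < (Lst N)%:R :> R by exact: lt_le_trans h.
rewrite !powRN lef_pV2 ?posrE ?powR_gt0//.
by apply: ge0_ler_powR; rewrite ?nnegrE ?powR_ge0 ?ler0n// mulr_ge0// ltW.
Unshelve. all: by end_near. Qed.

End error_rates.

(** The Sobolev weights are at least 1. The bound is the same for all f in the ball, which makes the
    second error uniform. *)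
Lemma sobolev_ball_energy (R : realType) (s r : R) (f : sphere R -> R) L : 0 < s ->
  sobolev_ball s r f -> \sum_(1 <= l < L.+1) energy f l <= (4 * pi)^-1 + r ^+ 2.
Proof.
move=> s0 [_ _ fs]; rewrite -lee_fin; apply: le_trans fs; rewrite /sobolev_norm2.
apply: le_trans (@nneseries_lim_ge _ _ xpredT 0%N L.+1 _); last first.
  by move=> l _ _; rewrite lee_fin mulr_ge0 ?powR_ge0 ?energy_ge0.
rewrite sumEFin lee_fin [leRHS]big_ltn//= -[leLHS]add0r lerD//.
  by rewrite mulr_ge0 ?powR_ge0 ?energy_ge0.
apply: ler_sum => l _; rewrite ler_peMl ?energy_ge0//.
rewrite -[leLHS](powRr0 (1 + l%:R * (l%:R + 1))) ler_powR ?(ltW s0)//.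
by rewrite lerDl mulr_ge0// addr_ge0.
Qed.

Lemma measurable_normc d (T : measurableType d) (R : realType) (V : T -> R[i]) :
  bmeas V -> measurable_fun setT (fun w => normc (V w)).
Proof.
move=> [mr mi _].
rewrite (_ : (fun _ => _) = fun w =>
    Num.sqrt (complex.Re (V w) ^+ 2 + complex.Im (V w) ^+ 2)); last first.
  by apply/funext => w; case: (V w).
apply: (@measurableT_comp _ _ _ _ _ _ (@Num.sqrt R)).
  by apply: continuous_measurable_fun; exact: sqrt_continuous.
by apply: measurable_funD; exact: measurable_funX.
Qed.

Lemma fine_probability_le d (T : measurableType d) (R : realType) (P : probability T R) A B :
  measurable A -> measurable B -> A `<=` B -> fine (P A) <= fine (P B).
Proof.
move=> mA mB AB; apply: fine_le; rewrite ?fin_num_measure//.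
by apply: le_measure; rewrite ?inE.
Qed.

(** * The two error probabilities of the test *)

Section error_probabilities.
Variables (R : realType) (haar : probability (SO3 R) R).
Variable D : forall l, SO3 R -> 'M[R[i]]_((2 * l).+1).
Hypothesis D_rot : is_rotational_harmonics D.
Variable feps : SO3 R -> R.
Hypothesis feps_density : is_density haar feps.
Context d (Omega : measurableType d).
Variables (eps : nat -> {mfun Omega >-> SO3 R}) (X : nat -> {mfun Omega >-> sphere R}).
Variable P : (sphere R -> R) -> probability Omega R.
Hypothesis P_model : forall f, is_density (@surface_measure R) f ->
  noisy_model eps X haar feps f (P f).
Variables (nu0 nu1 d0 d1 delta beta : R).
Local Notation F := (rot_fourier haar D feps).
Hypothesis feps_smooth : super_smooth F nu0 nu1 d0 d1 delta beta.
Variables s r K0 C : R.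
Hypotheses (s_gt0 : 0 < s) (K0_gt0 : 0 < K0).
Hypothesis C_gt : K0 + ((4 * pi)^-1 + r ^+ 2) * (delta / 16) `^ (- 2 * s / beta) < C.
Local Open Scope complex_scope.

Local Notation T N w := (T_stat F N (fun i => observation eps X i w) (L_star delta beta N)).
Local Notation reject N w := (test F nu0 delta beta K0 N (fun i => observation eps X i w)).
Local Notation tsq N := (t_sq nu0 delta beta N (L_star delta beta N)).

Let delta_gt0 : 0 < delta. Proof. by have [_ [] ] := feps_smooth. Qed.
Let beta_gt0 : 0 < beta. Proof. by have [_ [] ] := feps_smooth. Qed.
Let d0_gt0 : 0 < d0. Proof. by have [_ [] ] := feps_smooth. Qed.
Let F_unit l : F l \in unitmx. Proof. by have [_ _ + _] := feps_smooth; apply. Qed.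
Let F_inv l : (1 <= l)%N -> opnorm (invmx (F l)) <=
  d0^-1 * l%:R `^ (- nu0) * expR (l%:R `^ beta / delta).
Proof. by move=> l1; have [_ _ _ /(_ l l1)[]] := feps_smooth. Qed.

Let bT N : bmeas (fun w => T N w).
Proof. exact: bmeas_T_stat. Qed.

Lemma measurable_reject N : measurable [set w | reject N w].
Proof.
rewrite (_ : [set w | _] = (fun w => normc (T N w) / tsq N) @^-1` `]K0, +oo[).
  rewrite -[X in measurable X]setTI; apply: measurable_funM => //.
  exact: measurable_normc.
by apply/seteqP; split => w /=; rewrite in_itv /= andbT.
Qed.

Lemma near_type1_error e : 0 < e -> \forall N \near \oo,
  fine (P (@uniform_density R) [set w | reject N w]) <= e.
Proof.
move=> e0; near=> N.
have N1 : (1 < N)%N by near: N; exact: nbhs_infty_ge.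
have N0 : (0 < N)%N by exact: ltnW.
have L1 : (1 <= L_star delta beta N)%N by near: N; exact: near_L_star_large.
have t0 : 0 < tsq N by exact: tsq_gt0.
have kt : 0 < K0 * tsq N by exact: mulr_gt0.
apply: (@le_trans _ _ (fine (P (@uniform_density R) [set w | K0 * tsq N <= normc (T N w)]))).
  apply: fine_probability_le; first exact: measurable_reject.
    rewrite (_ : [set w | _] = (fun w => normc (T N w)) @^-1` `[K0 * tsq N, +oo[).
      by rewrite -[X in measurable X]setTI; apply: measurable_normc.
    by apply/seteqP; split => w /=; rewrite in_itv /= andbT.
  by move=> w /=; rewrite /test ltr_pdivlMr// => /ltW.
have udens := uniform_is_density R.
apply: le_trans (T_stat_uniform D_rot feps_density udens (P_model udens) F_unit N _ (erefl _) kt) _.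
by near: N; exact: (near_type1_bound delta_gt0 beta_gt0 d0_gt0 F_inv K0_gt0 e0).
Unshelve. all: by end_near. Qed.

Lemma near_type2_error e : 0 < e -> \forall N \near \oo,
  forall f, alternatives s r (C * psi s beta N) f ->
  fine (P f [set w | ~~ reject N w]) <= e.
Proof.
move=> e0; pose B : R := (4 * pi)^-1 + r ^+ 2.
pose q : R := (delta / 16) `^ (- 2 * s / beta).
have B0 : 0 <= B by rewrite addr_ge0 ?sqr_ge0// invr_ge0 mulr_ge0// pi_ge0.
(* The margin left by the assumption on C once the threshold (K0) and the bias (B q) are paid
   for. *)
pose k := C - (K0 + B * q); have k0 : 0 < k by rewrite subr_gt0.
near=> N => f fA.
have N1 : (1 < N)%N by near: N; exact: nbhs_infty_ge.
have N0 : (0 < N)%N by exact: ltnW.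
have L1 : (1 <= L_star delta beta N)%N by near: N; exact: near_L_star_large.
have x0 : 0 < ln (N%:R : R).
  by apply: (@lt_le_trans _ _ 1) => //; near: N; exact: near_ln_large.
have psi0 : 0 < psi s beta N by exact: powR_gt0.
have t0 : 0 < tsq N by exact: tsq_gt0.
have kpsi : 0 < k * psi s beta N by exact: mulr_gt0.
have tpsi : tsq N <= psi s beta N by near: N; exact: near_tsq_psi.
have bias : (L_star delta beta N)%:R `^ (- 2 * s) <= q * psi s beta N.
  by near: N; exact: near_L_star_bias.
have [fball _] := fA; have [fdens _ _] := fball.
pose b := \sum_(1 <= l < (L_star delta beta N).+1) energy f l.
have b0 : 0 <= b by apply: sumr_ge0 => l _; exact: energy_ge0.
have bB : b <= B by exact: sobolev_ball_energy fball.
have low : C * psi s beta N <= b + q * psi s beta N * B.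
  apply: le_trans (alternatives_energy s_gt0 L1 fA) _.
  by rewrite lerD2l ler_wpM2r.
have bT' : bmeas (fun w => T N w - b%:C) by apply: bmeasB => //; exact: bmeas_cst.
apply: (@le_trans _ _ (fine (P f [set w | k * psi s beta N <= normc (T N w - b%:C)]))).
  apply: fine_probability_le.
  - by rewrite (_ : [set w | _] = ~` [set w | reject N w]);
      [exact/measurableC/measurable_reject|apply/seteqP; split => w /= /negP].
  - rewrite (_ : [set w | _] = (fun w => normc (T N w - b%:C)) @^-1` `[k * psi s beta N, +oo[).
      by rewrite -[X in measurable X]setTI; apply: measurable_normc.
    by apply/seteqP; split => w /=; rewrite in_itv /= andbT.
  (* On acceptance |T| <= K0 psi, whereas b >= (C - q B) psi, so T lies at distance at least k psi
     from its mean b. *)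
  - move=> w /=; rewrite /test -leNgt ler_pdivrMr// => Tt.
    have h1 : b <= normc (T N w) + normc (T N w - b%:C).
      have := normc_triangle (T N w) (b%:C - T N w).
      by rewrite addrC subrK normc_real ger0_norm// -[normc (_ - T N w)]normc_opp opprB.
    have h2 : K0 * tsq N <= K0 * psi s beta N by rewrite ler_pM2l.
    rewrite /k; move: low Tt h1 h2; rewrite -/q -/B; nra.
apply: le_trans (T_stat_deviation D_rot feps_density fdens (P_model fdens) F_unit _ N1 kpsi) _.
have h : forall b, 0 <= b <= B -> (2 / (N%:R * (N%:R - 1))) ^+ 2 * (4 * N%:R ^+ 3 *
    (2 * (kern_bound F (L_star delta beta N) + b) ^+ 2)) / (k * psi s beta N) ^+ 2 <= e.
  by near: N; exact: (near_type2_bound delta_gt0 beta_gt0 d0_gt0 F_inv s k0 B0 e0).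
by apply: h; rewrite b0.
Unshelve. all: by end_near. Qed.

End error_probabilities.

Theorem theorem4 (R : realType)
  (haar : probability (SO3 R) R) (haar_inv : is_haar haar)
  (D : forall l, SO3 R -> 'M[R[i]]_((2 * l).+1))
  (D_rot : is_rotational_harmonics D)
  (feps : SO3 R -> R) (feps_density : is_density haar feps)
  (d : measure_display) (Omega : measurableType d)
  (eps : nat -> {mfun Omega >-> SO3 R}) (X : nat -> {mfun Omega >-> sphere R})
  (P : (sphere R -> R) -> probability Omega R)
  (P_model : forall f, is_density (@surface_measure R) f ->
     noisy_model eps X haar feps f (P f))
  (nu0 nu1 d0 d1 delta beta : R)
  (feps_smooth : super_smooth (rot_fourier haar D feps)
     nu0 nu1 d0 d1 delta beta)
  (s r K0 C : R) (s_gt0 : 0 < s) (r_gt0 : 0 < r) (K0_gt0 : 0 < K0)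
  (C_gt : K0 + ((4 * pi)^-1 + r ^+ 2) * (delta / 16) `^ (- 2 * s / beta) < C) :
  let reject N w := test (rot_fourier haar D feps) nu0 delta beta K0 N
                      (fun i => observation eps X i w) in
  (fun N : nat =>
     fine (P (@uniform_density R) [set w | reject N w]) +
     sup [set fine (P f [set w | ~~ reject N w])
         | f in alternatives s r (C * psi s beta N)])
  @ \oo --> (0 : R).
Proof.
move=> reject; apply/cvgrPdist_le => e e0; have e2 : 0 < e / 2 by rewrite divr_gt0.
near=> N; rewrite sub0r normrN.
have h1 : fine (P (@uniform_density R) [set w | reject N w]) <= e / 2.
  by near: N; exact: (near_type1_error D_rot feps_density P_model feps_smooth K0_gt0 e2).
have h2 f : alternatives s r (C * psi s beta N) f ->
    fine (P f [set w | ~~ reject N w]) <= e / 2.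
  move: f; near: N.
  exact: (near_type2_error D_rot feps_density P_model feps_smooth s_gt0 K0_gt0 C_gt e2).
have p0 f A : 0 <= fine (P f A) by exact: fine_ge0.
set S := [set fine _ | _ in _].
have Sub : ubound S (e / 2) by move=> _ [f fA <-]; exact: h2.
have [S0 Se] : 0 <= sup S /\ sup S <= e / 2.
  (* The class of alternatives may be empty for some N; [sup] is then 0 by convention. *)
  have [->|/set0P[y Sy]] := eqVneq S set0; first by rewrite sup0; split => //; exact: ltW.
  split; last by apply: ge_sup => //; exists y.
  apply: le_trans (_ : y <= _); first by case: Sy => f _ <-; exact: p0.
  by apply: ub_le_sup => //; exists (e / 2).
by rewrite ger0_norm ?addr_ge0// [leRHS]splitr lerD.
Unshelve. all: by end_near. Qed.
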